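(* Let $b\ge 2$ be an integer and let $W$ be a random weight, i.e. a non-constant random variable with $W\ge 0$ and $\mathbb{E}[W]=1$. Assume that $\mathbb{E}[W\log W]<\log b$ and $\mathbb{E}[W^t]<\infty$ for all $t>0$. If moreover $\mathbb{E}[W^{(2)}\log W^{(2)}]>\log b$, where $W^{(2)}=W^2/\mathbb{E}[W^2]$, assume that $\log W$ is non-lattice. Let $\mu_\infty$ be the Mandelbrot canonical cascade measure on $[0,1]$ associated with $(W,b)$. Then almost surely on $\{\mu_\infty\ne0\}$, for any $\varepsilon>0$ there exists a subsequence $(n_k)$ of the positive integers, depending on $\varepsilon$, such that $$\lim_{k\to\infty}b^{\frac{n_k(D_F+\varepsilon)}{2}}\,|\widehat\mu_\infty(b^{n_k})|=\infty.$$
   Context: Convention: $0\log 0=0$. $\log W$ is non-lattice if it is not supported on an arithmetic progression, i.e. there are no $a\in\mathbb{R}$, $h>0$ with $\mathbb{P}(\log W\in a+h\mathbb{Z}\mid W>0)=1$. Cascade measure. Let $\mathcal{A}=\{0,1,\dots,b-1\}$ and $\mathcal{A}^*=\bigsqcup_{n\ge0}\mathcal{A}^n$ (finite words, $\mathcal{A}^0=\{\emptyset\}$); $|u|$ is the length of $u$, $u_k$ its $k$-th letter, $u|_j$ its prefix of length $j$. For $|u|=n$ let $I_u=[\sum_{k=1}^n u_kb^{-k},\ \sum_{k=1}^n u_kb^{-k}+b^{-n})$. Let $(W(u))_{u\in\mathcal{A}^*\setminus\{\emptyset\}}$ be i.i.d. copies of $W$ and $W(\emptyset)=1$. Define random measures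 on $[0,1]$ by $\mu_n(dt)=\sum_{|u|=n}\big(\prod_{j=0}^nW(u|_j)\big)\mathbf{1}_{I_u}(t)\,dt$. Almost surely $\mu_n$ converges weakly to a random measure $\mu_\infty$, the Mandelbrot canonical cascade measure. $\widehat{\mu}_\infty(\zeta)=\int e^{-2\pi i\zeta x}d\mu_\infty(x)$. $$D_F=\begin{cases}1-\dfrac{\log\mathbb{E}[W^2]}{\log b} & \text{if } \mathbb{E}[W^{(2)}\log W^{(2)}]\le\log b,\\[2mm] 1-\inf\limits_{1/2\le t\le 1}\dfrac{\log\mathbb{E}[b^{1-t}W^{2t}]}{t\log b} & \text{if } \mathbb{E}[W^{(2)}\log W^{(2)}]>\log b.\end{cases}$$ *)

(* Defs.v *)
From HB Require Import structures.
From mathcomp Require Import all_boot all_order all_algebra.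
From mathcomp Require Import complex.
From mathcomp Require Import all_classical all_reals all_analysis.
From mathcomp Require Import measurable_realfun.

Set Implicit Arguments.
Unset Strict Implicit.
Unset Printing Implicit Defensive.

Import Order.TTheory GRing.Theory Num.Theory.
Import numFieldNormedType.Exports.

Local Open Scope classical_set_scope.
Local Open Scope ring_scope.

Section probability_notions.
Context (R : realType) (d : measure_display) (T : measurableType d)
  (P : probability T R).
Implicit Type X : {RV P >-> R}.

Definition nonconstant X := ~ exists c : R, {ae P, forall w, X w = c}.

Definition cond_prob (A B : set T) : R := fine (P (A `&` B)) / fine (P B).

Definition log_non_lattice X :=
  ~ exists a h : R, 0 < h /\
    cond_prob [set w | exists k : int, ln (X w) = a + h * k%:~R]
              [set w | 0 < X w] = 1.

Definition identically_distributed d' (T' : measurableType d')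
    (P' : probability T' R) X (Y : {RV P' >-> R}) :=
  forall A : set R, measurable A -> distribution P X A = distribution P' Y A.

Definition mutually_independent (I : choiceType) (D : set I)
    (X : I -> {RV P >-> R}) :=
  forall (s : seq I) (A : I -> set R), uniq s -> [set` s] `<=` D ->
    (forall i, measurable (A i)) ->
    P (\bigcap_(i in [set` s]) (X i @^-1` A i)) =
    (\prod_(i <- s) P (X i @^-1` A i))%E.

(* [ln 0 = 0] in the library, so [X w * ln (X w)] obeys [0 log 0 = 0] *)
Definition mean_xlogx (X : T -> R) : \bar R :=
  ('E_P[fun w => (X w * ln (X w))%R])%E.

(* $X^{(2)} = X^2 / E[X^2]$ *)
Definition square_tilt X (w : T) : R :=
  X w ^+ 2 / fine ('E_P[fun w => (X w ^+ 2)%R])%E.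

(* $D_F$ *)
Definition fourier_dim (b : nat) X : R :=
  if (mean_xlogx (square_tilt X) <= (ln b%:R)%:E)%E then
    1 - ln (fine ('E_P[fun w => (X w ^+ 2)%R])%E) / ln b%:R
  else
    1 - inf [set ln (fine ('E_P[fun w => (b%:R `^ (1 - t) * X w `^ (2 * t))%R])%E)
                 / (t * ln b%:R) | t in `[2^-1, 1]].

End probability_notions.

Section cascade_realisation.
Context (R : realType) (b : nat).
Implicit Type w : seq 'I_b -> R.

Definition badic_left n (u : n.-tuple 'I_b) : R :=
  \sum_(k < n) (tnth u k : nat)%:R * b%:R ^- k.+1.

Definition badic_interval n (u : n.-tuple 'I_b) : set R :=
  `[badic_left u, badic_left u + b%:R ^- n[.

Definition cascade_density w n (t : R) : R :=
  \sum_(u : n.-tuple 'I_b)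
    (\prod_(j < n.+1) w (take j u)) * \1_(badic_interval u) t.

(* The cascade weights are nonnegative almost surely; the absolute value makes
   this a measure on the exceptional null event as well. *)
Definition cascade_measure w n : set (measurableTypeR R) -> \bar R :=
  fun A => (\int[lebesgue_measure]_(t in A) (`|cascade_density w n t|)%:E)%E.

Lemma measurable_cascade_density w n :
  measurable_fun [set: measurableTypeR R] (cascade_density w n).
Proof.
apply: measurable_sum => u; apply: measurable_funM => //.
by apply: measurable_indic; exact: measurable_itv.
Qed.

Section cascade_measure_instance.
Variables (w : seq 'I_b -> R) (n : nat).

Let cascade_measure0 : cascade_measure w n set0 = 0%E.
Proof. by rewrite /cascade_measure integral_set0. Qed.

Let cascade_measure_ge0 A : (0 <= cascade_measure w n A)%E.
Proof. by apply: integral_ge0 => t _; rewrite lee_fin. Qed.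

Let cascade_measure_sigma_additive : semi_sigma_additive (cascade_measure w n).
Proof.
move=> /= F mF tF mUF; rewrite /cascade_measure; apply: cvg_toP.
  apply: ereal_nondecreasing_is_cvgn => k l kl.
  apply: lee_sum_nneg_natr => // m _ _.
  by apply: integral_ge0 => t _; rewrite lee_fin.
rewrite ge0_integral_bigcup//=.
apply: measurable_funTS; apply/measurable_EFinP; apply: measurableT_comp => //.
exact: measurable_cascade_density.
Qed.

HB.instance Definition _ := isMeasure.Build _ _ _ (cascade_measure w n)
  cascade_measure0 cascade_measure_ge0 cascade_measure_sigma_additive.

End cascade_measure_instance.
End cascade_realisation.

(* Weak convergence on the real line.  All the measures [cascade_measure w n]
   are carried by [0, 1[, so their weak limits are carried by [0, 1]. *)
Definition weakly_converges (R : realType)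
    (nu : nat -> {measure set (measurableTypeR R) -> \bar R})
    (mu : {measure set (measurableTypeR R) -> \bar R}) :=
  forall f : R -> R, continuous f -> (exists M, forall x, `|f x| <= M) ->
    (\int[nu n]_x (f x)%:E)%E @[n --> \oo] --> (\int[mu]_x (f x)%:E)%E.

Section cascade.
Context (R : realType) (b : nat) (d0 d : measure_display)
  (T0 : measurableType d0) (P0 : probability T0 R)
  (T : measurableType d) (P : probability T R).

Definition cascade_weights (W : {RV P0 >-> R}) (Wu : seq 'I_b -> {RV P >-> R}) :=
  [/\ forall w, Wu [::] w = 1,
      forall u, u != [::] -> identically_distributed (Wu u) W &
      mutually_independent [set u | u != [::]] Wu].

Definition is_cascade_limit (Wu : seq 'I_b -> {RV P >-> R})
    (mu : T -> {finite_measure set (measurableTypeR R) -> \bar R}) :=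
  (forall A, measurable A -> measurable_fun [set: T] (mu ^~ A)) /\
  {ae P, forall w, weakly_converges (cascade_measure (Wu ^~ w)) (mu w)}.

End cascade.

Section fourier.
Local Open Scope complex_scope.
Context (R : realType) (mu : {measure set (measurableTypeR R) -> \bar R}).

(* $e^{i\theta}$ *)
Definition expi (theta : R) : R[i] := cos theta +i* sin theta.

Definition complex_integral (f : R -> R[i]) : R[i] :=
  (\int[mu]_x complex.Re (f x)) +i* (\int[mu]_x complex.Im (f x)).

Definition fourier_transform (zeta : R) : R[i] :=
  complex_integral (fun x => expi (- (2 * pi * zeta * x))).

End fourier.

(* Main.v *)
(** With [g v = W(v) / b], let [tree_sum g F k u] be the sum of [F v] over the
descendants [v] of [u], [k] levels below, each weighted by the product of [g] along
the path from [u].  Then the integral of [sin (2 pi b^n x)] against [mu_N] is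
[tree_sum g F_n N [::]], where [F_n v] is the average of the sine over [I_v].  Its
first [n] levels factor out: it is a weighted sum of the variables rooted at the words
of length [n], which are independent and centred, with a mean deviation bounded below
and a [p]-th moment bounded above for some [p > 1].  Their characteristic functions
are thus at most [exp (- c s^2)] near [0], so that the sum falls, with probability
bounded below, at distance at least a constant times the square root of the sum of the
squared weights from any prescribed point.

For [psi a = (1 - a) ln b + ln E[W^a]], the sum of the squared weights exceeds
[exp (n (2 psi a / a - eps))] with probability bounded below when [a] minimises
[psi a / a] on [[1, 2]]: compare moments of orders [a' < a < 2] close to the minimiser.
Since [D_F ln b >= - 2 psi a / a] for all [a] in [[1, 2]], the sine integral exceeds
[b^(- n (D_F + eps) / 2)] with conditional probability bounded below given finitely
many levels on which the cascade survives.  The event that this fails for all large [n]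
is a limit of events depending on finitely many levels, hence is null on survival. *)

Require Import Defs.
From HB Require Import structures.
From mathcomp Require Import all_boot all_order all_algebra.
From mathcomp Require Import complex.
From mathcomp Require Import all_classical all_reals all_analysis.
From mathcomp Require Import measurable_realfun.
From mathcomp Require Import ring lra zify.

Set Implicit Arguments.
Unset Strict Implicit.
Unset Printing Implicit Defensive.

Import Order.TTheory GRing.Theory Num.Theory.
Import numFieldNormedType.Exports.
Local Open Scope classical_set_scope.
Local Open Scope ring_scope.

(** * Independence and freezing *)

(** Nothing forces [E[W^2] < b], so second moments of the total mass may be unbounded in the depth.
    The condition [E[W ln W] < ln b] only yields [E[W^p] < b^(p-1)] for some [p] near 1, which is
    why the estimates rest on a mean deviation and a [p]-th moment. Anticoncentration is uniform
    over the target point because branches that have been frozen act as a translation. One real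
    coordinate of the transform is enough, and the sine is preferred to the cosine: its average over
    the leftmost b-adic interval of length [1 / b] is positive for every [b], whereas that of the
    cosine vanishes for [b = 2]. The limit measure is not a function of finitely many levels. The
    probabilistic part therefore concerns sums truncated some levels below the frequency level [n],
    with bounds that do not depend on the depth of truncation; weak convergence is used for a fixed
    outcome only. Since the weights are nonnegative only almost surely, [g y = |y| / b] replaces
    [y / b]: it is nonnegative everywhere and differs from it on a null event only. *)

Section freezing.
Context d d1 d2 (T : measurableType d) (T1 : measurableType d1)
  (T2 : measurableType d2) (R : realType) (P : probability T R).
Variables (U : T -> T1) (V : T -> T2).
Hypotheses (mU : measurable_fun setT U) (mV : measurable_fun setT V).
Hypothesis indUV : forall A B, measurable A -> measurable B ->
  P (U @^-1` A `&` V @^-1` B) = (P (U @^-1` A) * P (V @^-1` B))%E.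

Let mUV : measurable_fun setT (fun w => (U w, V w)).
Proof. exact/measurable_fun_pair. Qed.

Let U' : {mfun T >-> T1} := mfun_Sub (mem_set mU).
Let V' : {mfun T >-> T2} := mfun_Sub (mem_set mV).
Let UV' : {mfun T >-> (T1 * T2)%type} := mfun_Sub (mem_set mUV).

(** Independence makes the law of [(U, V)] the product of the two laws, by uniqueness of the product
    measure on rectangles; Tonelli's theorem does the rest. *)
Lemma integral_freezing (Phi : (T1 * T2)%type -> \bar R) :
  measurable_fun setT Phi -> (forall z, (0 <= Phi z)%E) ->
  (\int[P]_w Phi (U w, V w) = \int[P]_w \int[P]_w' Phi (U w, V w'))%E.
Proof.
move=> mPhi Phi0.
have -> : (\int[P]_w Phi (U w, V w) = \int[distribution P UV']_z Phi z)%E.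
  by rewrite ge0_integral_distribution.
rewrite (eq_measure_integral (distribution P U' \x distribution P V')%E).
  rewrite fubini_tonelli1// ge0_integral_distribution//.
  - apply: eq_integral => w _ /=; rewrite /fubini_F.
    by rewrite ge0_integral_distribution//; apply: measurableT_comp.
  - exact: measurable_fun_fubini_tonelli_F.
  - by move=> x; apply: integral_ge0.
by move=> A mA _; apply/esym; apply: product_measure_unique.
Qed.

End freezing.

Section independence.
Context d (T : measurableType d) (R : realType) (P : probability T R).
Context (I : choiceType) (D : set I) (X : I -> {RV P >-> R}).
Hypothesis indX : mutually_independent D X.
Implicit Types J : set I.

Definition cylinders J : set (set T) :=
  [set C | exists s A, [/\ uniq s, [set` s] `<=` J `&` D,
     forall i, measurable (A i) & C = \bigcap_(i in [set` s]) X i @^-1` A i]].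

(** The sigma-algebra generated by the [X i] with [i] in [J] and [D], placed on the sample space
    itself: a function of these coordinates remains a function on [T], with no factorisation through
    a product space. *)
Definition coords J := g_sigma_algebraType (cylinders J).

Lemma cylindersT J : cylinders J setT.
Proof.
exists [::], (fun=> setT); split => //.
by apply/seteqP; split => w // _ i; rewrite /= in_nil.
Qed.

Lemma cylindersI J : setI_closed (cylinders J).
Proof.
move=> _ _ [s [A [us sJ mA ->]]] [t [B [ut tJ mB ->]]].
exists (undup (s ++ t)),
  (fun i => (if i \in s then A i else setT) `&` (if i \in t then B i else setT)).
split.
- exact: undup_uniq.
- move=> i /=; rewrite mem_undup mem_cat => /orP[/sJ|/tJ]//.
- by move=> i; apply: measurableI; case: ifPn.
- apply/seteqP; split=> w /=.
    move=> [wA wB] i /=; rewrite mem_undup mem_cat => _; split.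
      by case: ifPn => // /wA.
    by case: ifPn => // /wB.
  move=> wAB; split => i /= ii; have := wAB i;
    rewrite /= mem_undup mem_cat ii ?orbT => /(_ isT)[];
    by rewrite ?ii.
Qed.

Lemma measurable_cylinders J : cylinders J `<=` measurable.
Proof.
move=> _ [s [A [_ _ mA ->]]].
apply: fin_bigcap_measurable => [|i _]; first exact: finite_seq.
exact: measurable_funPTI.
Qed.

Lemma measurable_coords J (A : set (coords J)) :
  measurable A -> measurable (A : set T).
Proof.
apply: smallest_sub; last exact: measurable_cylinders.
exact: sigma_algebra_measurable.
Qed.

Lemma measurable_fun_coords J : measurable_fun [set: T] (fun w => w : coords J).
Proof. by move=> _ A mA; rewrite setTI; exact: (@measurable_coords J A mA). Qed.

Lemma measurable_fun_coordsT J d' (T' : measurableType d') (f : T -> T') :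
  measurable_fun [set: coords J] f -> measurable_fun [set: T] f.
Proof. by move=> mf _ A mA; exact: (@measurable_coords J _ (mf measurableT A mA)). Qed.

Lemma measurable_coords_sub J J' d' (T' : measurableType d') (f : T -> T') :
  J `<=` J' -> measurable_fun [set: coords J] f -> measurable_fun [set: coords J'] f.
Proof.
move=> JJ' mf mT A mA; have /= := mf measurableT A mA.
apply: smallest_sub.
  exact: smallest_sigma_algebra.
move=> B [s [C [us sJ mC ->]]]; apply: sub_sigma_algebra.
by exists s, C; split => // i /sJ[/JJ'].
Qed.

Lemma measurable_coord J i : J i -> D i -> measurable_fun [set: coords J] (X i).
Proof.
move=> Ji Di mT A mA; apply: sub_sigma_algebra.
exists [:: i], (fun=> A); split => //.
  by move=> j /=; rewrite inE => /eqP ->.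
rewrite setTI; apply/seteqP; split => w /=.
  by move=> Aw j /=; rewrite inE => /eqP ->.
by apply; rewrite /= inE.
Qed.

Lemma independent_cylinders J1 J2 A B :
  (forall i, D i -> J1 i -> J2 i -> False) ->
  cylinders J1 A -> cylinders J2 B -> P (A `&` B) = (P A * P B)%E.
Proof.
move=> J12 [s [F [us sJ mF ->]]] [t [G [ut tJ mG ->]]].
have dst i : i \in s -> i \notin t.
  move=> si; apply/negP => ti; have [Ji Di] := sJ i si.
  by apply: (J12 i) => //; have [] := tJ i ti.
pose H i := if i \in s then F i else G i.
have -> : \bigcap_(i in [set` s]) X i @^-1` F i `&`
    \bigcap_(i in [set` t]) X i @^-1` G i =
    \bigcap_(i in [set` s ++ t]) X i @^-1` H i.
  apply/seteqP; split => w /=.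
    move=> [wF wG] i /=; rewrite mem_cat /H.
    by case: ifPn => [/wF//|_ /= /wG].
  move=> wH; split=> i /= ii; have := wH i; rewrite /= mem_cat ii ?orbT => /(_ isT).
    by rewrite /H ii.
  by rewrite /H; case: ifPn => // /dst; rewrite ii.
rewrite indX//.
- rewrite big_cat/=; congr (_ * _)%E.
    rewrite indX//; last by move=> i /sJ[].
    by apply: eq_big_seq => i si; rewrite /H si.
  rewrite indX//; last by move=> i /tJ[].
  apply: eq_big_seq => i ti; rewrite /H; case: ifPn => // /dst.
  by rewrite ti.
- rewrite cat_uniq us ut andbT/=; apply/hasPn => i ti; apply/negP => /dst.
  by rewrite ti.
- by move=> i /=; rewrite mem_cat => /orP[/sJ[]|/tJ[]].
- by move=> i; rewrite /H; case: ifPn.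
Qed.

Let mid := measurable_fun_coords.

(** For a fixed event [C], the probability of the intersection with [E] and the product [P C * P E]
    are finite measures in [E]; they coincide once they agree on the cylinders, which are closed
    under intersection. The argument is applied to each factor in turn. *)
Lemma independent_coords J1 J2 (A : set (coords J1)) (B : set (coords J2)) :
  (forall i, D i -> J1 i -> J2 i -> False) ->
  measurable A -> measurable B -> P (A `&` B) = (P A * P B)%E.
Proof.
move=> J12.
have fin (C : set T) : measurable C -> P C = (fine (P C))%:E.
  by move=> mC; rewrite fineK// fin_num_measure.
have scale (C : set T) (mC : measurable C) E : (P C * P E)%E =
    mscale (NngNum (fine_ge0 (measure_ge0 P C))) P E.
  by rewrite /mscale/= -fin.
have step J (C : set T) (mC : measurable C) :
    (forall E, cylinders J E -> P (C `&` E) = (P C * P E)%E) ->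
    forall E, measurable (E : set (coords J)) -> P (C `&` E) = (P C * P E)%E.
  move=> h E mE; rewrite scale// setIC.
  rewrite -/(mrestr P mC E).
  apply: (g_sigma_algebra_measure_unique (cylinders J) _ (fun=> setT)) => //.
  - exact: measurable_cylinders.
  - by move=> n; exact: cylindersT.
  - by rewrite bigcup_const//; exists 0%N.
  - exact: cylindersI.
  - by move=> G cG /=; rewrite -scale// -h// /mrestr setIC.
  - move=> k; rewrite /= /mrestr setTI (le_lt_trans (probability_le1 _ _))//.
    exact: ltry.
move=> mA mB; apply: (step J2 A) => //.
  exact: measurable_coords mA.
move=> E cE; rewrite setIC muleC; apply: (step J1 E) => //.
  exact: measurable_cylinders cE.
move=> F cF; rewrite setIC muleC.
exact: (independent_cylinders J12).
Qed.

(** Conditioning on the coordinates in [J1] without conditional expectations: the two occurrences of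
    the outcome in [Phi] see disjoint families of coordinates and can be decoupled. *)
Lemma freezing J1 J2 (Phi : T -> T -> \bar R) :
  (forall i, D i -> J1 i -> J2 i -> False) ->
  measurable_fun [set: (coords J1 * coords J2)%type] (fun z => Phi z.1 z.2) ->
  (forall w w', (0 <= Phi w w')%E) ->
  (\int[P]_w Phi w w = \int[P]_w \int[P]_w' Phi w w')%E.
Proof.
move=> J12 mPhi Phi0.
have ind (A : set (coords J1)) (B : set (coords J2)) : measurable A ->
    measurable B -> P ((fun w => w : coords J1) @^-1` A `&`
      (fun w => w : coords J2) @^-1` B) = (P A * P B)%E.
  exact: independent_coords.
exact: (@integral_freezing _ _ _ T (coords J1) (coords J2) R P _ _ (@mid J1)
  (@mid J2) ind (fun z => Phi z.1 z.2) mPhi (fun z => Phi0 z.1 z.2)).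
Qed.

Lemma measurable_freezing J1 J2 (Phi : T -> T -> \bar R) :
  measurable_fun [set: (coords J1 * coords J2)%type] (fun z => Phi z.1 z.2) ->
  (forall w w', (0 <= Phi w w')%E) ->
  measurable_fun [set: coords J1] (fun w => \int[P]_w' Phi w w')%E.
Proof.
move=> mPhi Phi0; pose V : {mfun T >-> coords J2} := mfun_Sub (mem_set (@mid J2)).
rewrite (_ : (fun w => _) =
    fubini_F (distribution P V) (fun z : coords J1 * coords J2 => Phi z.1 z.2)).
  exact: measurable_fun_fubini_tonelli_F.
apply/funext => w; rewrite /fubini_F ge0_integral_distribution//.
by apply: (measurableT_comp mPhi); exact/measurable_fun_pair.
Qed.

End independence.

(** * Sums over the leaves of a weighted tree *)

(** Weights are read at the children, so the weight of [u] itself does not occur. The recursion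
    starts from the root in order that the branches at [u], which are independent, come apart at
    each step. *)
Fixpoint tree_sum (R : realType) b (x F : seq 'I_b -> R) k (u : seq 'I_b) : R :=
  if k is k'.+1 then \sum_(i < b) x (rcons u i) * tree_sum x F k' (rcons u i)
  else F u.

Section tree_sum.
Context (R : realType) (b : nat).
Implicit Types (x F G : seq 'I_b -> R) (u v : seq 'I_b).

Lemma tree_sumD x F n k u :
  tree_sum x F (n + k) u = tree_sum x (tree_sum x F k) n u.
Proof. by elim: n u => //= n IH u; apply: eq_bigr => i _; rewrite IH. Qed.

Lemma eq_tree_suml x y F k u : x =1 y -> tree_sum x F k u = tree_sum y F k u.
Proof.
by move=> xy; elim: k u => //= k IH u; apply: eq_bigr => i _; rewrite xy IH.
Qed.

Lemma tree_sumZ x F c k u :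
  tree_sum (fun v => c * x v) F k u = c ^+ k * tree_sum x F k u.
Proof.
elim: k u => [|k IH] u /=; first by rewrite mul1r.
rewrite mulr_sumr; apply: eq_bigr => i _.
by rewrite IH exprS; ring.
Qed.

Lemma tree_sum_addr x F G k u :
  tree_sum x (fun v => F v + G v) k u = tree_sum x F k u + tree_sum x G k u.
Proof.
elim: k u => //= k IH u; rewrite -big_split/=.
by apply: eq_bigr => i _; rewrite IH mulrDr.
Qed.

Lemma tree_sum_ge0 x F k u : (forall v, 0 <= x v) -> (forall v, 0 <= F v) ->
  0 <= tree_sum x F k u.
Proof.
move=> x0 F0; elim: k u => //= k IH u.
by apply: sumr_ge0 => i _; rewrite mulr_ge0.
Qed.

Lemma ler_norm_tree_sum x F k u : (forall v, 0 <= x v) ->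
  (forall v, `|F v| <= 1) ->
  `|tree_sum x F k u| <= tree_sum x (fun=> 1) k u.
Proof.
move=> x0 F1; elim: k u => //= k IH u.
apply: le_trans (ler_norm_sum _ _ _) _; apply: ler_sum => i _.
by rewrite normrM (ger0_norm (x0 _)) ler_wpM2l.
Qed.

Lemma tree_sum_eq0 x F k u : (forall v, 0 <= x v) ->
  tree_sum x (fun=> 1) k u = 0 -> tree_sum x F k u = 0.
Proof.
move=> x0; elim: k u => [u /eqP|k IH u /= h]; first by rewrite /= oner_eq0.
have t0 v : 0 <= tree_sum x (fun=> 1) k v by apply: tree_sum_ge0.
have {}h i : x (rcons u i) * tree_sum x (fun=> 1) k (rcons u i) = 0.
  have h0 (j : 'I_b) : true -> 0 <= x (rcons u j) * tree_sum x (fun=> 1) k (rcons u j).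
    by rewrite mulr_ge0.
  by move/eqP: h; rewrite psumr_eq0// => /allP/(_ i); rewrite mem_index_enum =>
    /(_ isT)/eqP.
apply: big1 => i _; have /eqP := h i; rewrite mulf_eq0 => /orP[/eqP ->|/eqP/IH ->].
  by rewrite mul0r.
by rewrite mulr0.
Qed.

Lemma tree_sum_cst x c k u : (forall v, \sum_(i < b) x (rcons v i) = 1) ->
  tree_sum x (fun=> c) k u = c.
Proof.
move=> x1; elim: k u => //= k IH u.
by under eq_bigr do rewrite IH; rewrite -mulr_suml x1 mul1r.
Qed.

(* Each leaf product [v] satisfies [v `^ a <= K `^ (a - a') * v `^ a'] if
   [v <= K] and [v `^ a <= K `^ (a - c) * v `^ c] if [K <= v]. *)
Lemma tree_sum_powR_interpolation x (a' a c K : R) k u :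
  (forall v, 0 <= x v) -> 0 < a' -> a' <= a -> a <= c -> 0 < K ->
  tree_sum (fun v => x v `^ a) (fun=> 1) k u <=
  K `^ (a - a') * tree_sum (fun v => x v `^ a') (fun=> 1) k u +
  K `^ (a - c) * tree_sum (fun v => x v `^ c) (fun=> 1) k u.
Proof.
move=> x0 a'0 a'a ac; elim: k K u => [|k IH] K u K0 /=.
  rewrite !mulr1; have [K1|K1] := leP 1 K.
    apply: le_trans (_ : K `^ (a - a') <= _); last by rewrite lerDl powR_ge0.
    by rewrite -[X in X <= _](powRr0 K) ler_powR// subr_ge0.
  apply: le_trans (_ : K `^ (a - c) <= _); last by rewrite lerDr powR_ge0.
  by rewrite -[X in X <= _](powRr0 K) ger_powR ?K0 ?(ltW K1)// subr_le0.
rewrite !mulr_sumr -big_split/=; apply: ler_sum => i _.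
have [xi0|xi0] := eqVneq (x (rcons u i)) 0.
  have a0 := lt_le_trans a'0 a'a; have c0 := lt_le_trans a0 ac.
  by rewrite xi0 !powR0 ?gt_eqF// !mul0r !mulr0 addr0.
have {}xi0 : 0 < x (rcons u i) by rewrite lt_neqAle eq_sym xi0 x0.
(* The leaf products above [u] are the weight just crossed times those of the child, so the
   threshold passed to the child is divided by that weight. *)
have Kx : 0 < K / x (rcons u i) by rewrite divr_gt0.
apply: le_trans (ler_wpM2l (powR_ge0 _ _) (IH _ _ Kx)) _.
have E e : x (rcons u i) `^ a * (K / x (rcons u i)) `^ (a - e) =
    K `^ (a - e) * x (rcons u i) `^ e.
  rewrite powRM ?invr_ge0 ?ltW// -powR_inv1 ?ltW// -powRrM mulrCA -powRD.
    by congr (_ * _ `^ _); ring.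
  by apply/implyP => _; rewrite gt_eqF.
by rewrite mulrDr !mulrA !E.
Qed.

End tree_sum.

(** The measurable space is arbitrary so that the lemma applies to every [coords D X J]; accordingly
    only the weights strictly below [u] and the values [k] levels below have to be measurable. *)
Lemma measurable_tree_sum (R : realType) b d (T : measurableType d)
    (x F : seq 'I_b -> T -> R) k u :
  (forall v, prefix u v -> (size u < size v)%N -> measurable_fun setT (x v)) ->
  (forall v, prefix u v -> size v = (size u + k)%N -> measurable_fun setT (F v)) ->
  measurable_fun setT (fun w => tree_sum (x^~ w) (F^~ w) k u).
Proof.
elim: k u => [|k IH] u mx mF /=; first by apply: mF; rewrite ?prefix_refl ?addn0.
have pu i v : prefix (rcons u i) v -> prefix u v.
  by apply: prefix_trans; exact: prefix_rcons.
apply: measurable_sum => i; apply: measurable_funM.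
  by apply: mx; rewrite ?size_rcons// prefix_rcons.
apply: IH => v /[dup] uv /pu puv.
  rewrite size_rcons => /ltnW; exact: mx.
by rewrite size_rcons addSnnS; exact: mF.
Qed.

(** * Trigonometric and probabilistic estimates *)

Section trigonometric_bounds.
Context (R : realType).
Implicit Types x p : R.

(** Keeping the intermediate point lets the remainder [1 - cos c] be estimated in turn, which gives
    the third-order bound on [sin x - x] and the quadratic lower bound on [1 - cos x]. *)
Lemma mvt_sin x : exists2 c : R, `|c| <= `|x| & sin x = x * cos c.
Proof.
have pos (y : R) : 0 <= y -> exists2 c : R, `|c| <= `|y| & sin y = y * cos c.
  move=> y0; have [c] := MVT_segment y0 (fun z _ => is_derive_sin z)
    (continuous_subspaceT (@continuous_sin R)).
  rewrite in_itv/= sin0 !subr0 mulrC => /andP[c0 cy] ->.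
  by exists c => //; rewrite !ger0_norm.
have [/pos//|/ltW] := leP 0 x.
rewrite -oppr_ge0 => /pos[c cx]; rewrite sinN mulNr => /oppr_inj ->.
by exists c => //; rewrite normrN in cx.
Qed.

Lemma ler_norm_sin x : `|sin x| <= `|x|.
Proof.
have [c _ ->] := mvt_sin x.
by rewrite normrM ler_piMr// cos_max.
Qed.

Lemma subr1_cos x : 1 - cos x = 2 * sin (x / 2) ^+ 2.
Proof.
rewrite [in cos _](_ : x = (x / 2) *+ 2); last by rewrite -mulr_natr mulfVK.
by rewrite cos_mulr2n cos2sin2; ring.
Qed.

Lemma subr1_cos_ge0 x : 0 <= 1 - cos x.
Proof. by rewrite subr_ge0 cos_le1. Qed.

Lemma subr1_cos_le2 x : 1 - cos x <= 2.
Proof. by have := cos_geN1 x; lra. Qed.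

Lemma subr1_cos_le x : 1 - cos x <= x ^+ 2 / 2.
Proof.
rewrite subr1_cos -real_normK ?num_real//.
have := ler_norm_sin (x / 2); have := normr_ge0 (sin (x / 2)).
rewrite normrM [`|_^-1|]ger0_norm// => s0 sx.
have : `|sin (x / 2)| ^+ 2 <= (`|x| * 2^-1) ^+ 2 by rewrite ler_sqr ?nnegrE.
by rewrite exprMn !real_normK ?num_real//; lra.
Qed.

Lemma subr1_cos_le_norm x : 1 - cos x <= `|x|.
Proof.
have := subr1_cos_le x; have := subr1_cos_le2 x; have := normr_ge0 x.
by rewrite -[x ^+ 2]real_normK ?num_real//; nra.
Qed.

Lemma ler_norm_sinB x : `|sin x - x| <= `|x| ^+ 3.
Proof.
have [c cx ->] := mvt_sin x.
rewrite -[X in _ - X]mulr1 -mulrBr normrM exprS ler_wpM2l//.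
rewrite distrC ger0_norm ?subr1_cos_ge0//.
apply: le_trans (subr1_cos_le c) _.
have : `|c| ^+ 2 <= `|x| ^+ 2 by rewrite ler_sqr ?nnegrE.
by rewrite !real_normK ?num_real//; have := sqr_ge0 c; lra.
Qed.

Lemma sqr_le_subr1_cos x : `|x| <= 1 -> x ^+ 2 <= 4 * (1 - cos x).
Proof.
move=> x1; rewrite subr1_cos.
have [c cx ->] := mvt_sin (x / 2).
have := subr1_cos_le c.
have : `|c| ^+ 2 <= 1 / 4.
  have : `|c| <= 1 / 2.
    by apply: le_trans cx _; rewrite normrM [`|_^-1|]ger0_norm//; lra.
  by have := normr_ge0 c; nra.
rewrite real_normK ?num_real// => c2 cc.
have c8 : 7 / 8 <= cos c by lra.
have : (7 / 8) ^+ 2 <= cos c ^+ 2.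
  by rewrite ler_sqr ?nnegrE//; lra.
move=> c49; rewrite !exprMn.
have := sqr_ge0 x; rewrite le_eqVlt => /predU1P[<-|x0]; first by rewrite !mul0r !mulr0.
rewrite [leRHS](_ : _ = x ^+ 2 * (2 * cos c ^+ 2)); last by field.
by rewrite ler_peMr// ?ltW//; lra.
Qed.

Lemma ler_exp_powR x p n : p <= n%:R -> 0 <= x <= 1 -> 0 < p -> x ^+ n <= x `^ p.
Proof.
move=> pn /andP[]; rewrite le_eqVlt => /predU1P[<- _ p0|x0 x1 _].
  by rewrite powR0 ?gt_eqF// expr0n; case: n pn => //; rewrite leNgt p0.
by rewrite -powR_mulrn ?(ltW x0)// ger_powR// x0.
Qed.

Lemma ler_norm_sinB_powR x p : 1 <= p -> p <= 2 ->
  `|sin x - x| <= 2 * `|x| `^ p.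
Proof.
move=> p1 p2; have [x1|/ltW x1] := leP `|x| 1.
  apply: le_trans (ler_norm_sinB x) _.
  apply: le_trans (@ler_exp_powR `|x| p 3 _ _ _) _; [lra|by rewrite normr_ge0|lra|].
  by rewrite ler_peMl ?powR_ge0//; lra.
apply: le_trans (ler_normB _ _) _.
have := ler_norm_sin x; have := le1r_powR x1 p1; lra.
Qed.

Lemma subr1_cos_le_powR x p : 1 <= p -> p <= 2 -> 1 - cos x <= 2 * `|x| `^ p.
Proof.
move=> p1 p2; have [x1|/ltW x1] := leP `|x| 1.
  have h : `|x| ^+ 2 <= `|x| `^ p by apply: ler_exp_powR; rewrite ?normr_ge0//; lra.
  have := subr1_cos_le x; have := sqr_ge0 `|x|; move: h.
  by rewrite real_normK ?num_real//; lra.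
by have := subr1_cos_le2 x; have := le1r_powR x1 p1; lra.
Qed.

(* A lower bound for [1 - cos (s * z)] that is integrable in [z] as soon as
   [`|z| `^ p] is; it follows from [z ^+ 2 >= 2 * h * `|z| - h ^+ 2]. *)
Lemma subr1_cos_ge s z h p : 0 <= h -> 1 < p ->
  s ^+ 2 * (2 * h * `|z| - h ^+ 2 - 2 * h * `|s| `^ (p - 1) * `|z| `^ p) <=
  4 * (1 - cos (s * z)).
Proof.
move=> h0 p1.
have [->|s0] := eqVneq s 0.
  by rewrite !mul0r expr0n/= mul0r cos0 subrr mulr0.
have s2 : 0 < s ^+ 2 by rewrite exprn_even_gt0.
have [sz|sz] := leP `|s * z| 1.
  apply: le_trans (sqr_le_subr1_cos sz).
  rewrite exprMn ler_pM2l// -[z ^+ 2]real_normK ?num_real//.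
  have := sqr_ge0 (`|z| - h).
  have : 0 <= 2 * h * `|s| `^ (p - 1) * `|z| `^ p.
    by rewrite !mulr_ge0 ?powR_ge0.
  by rewrite sqrrB => ? ?; lra.
(* When [|s * z| > 1] the bracket is nonpositive, because [|s * z|^(p-1) >= 1] makes its last term
   dominate [2 * h * |z|]. *)
apply: le_trans (_ : 0 <= _); last by rewrite mulr_ge0 ?subr1_cos_ge0.
rewrite pmulr_rle0//.
have -> : `|z| `^ p = `|z| * `|z| `^ (p - 1) by rewrite mulr_powRB1//; lra.
have : `|z| <= `|s| `^ (p - 1) * `|z| `^ (p - 1) * `|z|.
  rewrite ler_peMl// -powRM// -normrM.
  by rewrite -[X in X <= _](powRr0 `|s * z|) ler_powR ?ltW//; lra.
move=> /(ler_wpM2l h0); have := sqr_ge0 h.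
by move: (`|s| `^ _) (`|z| `^ _) => A B ? ?; nra.
Qed.

End trigonometric_bounds.

Section probability_integrals.
Context d (T : measurableType d) (R : realType) (P : probability T R).
Implicit Types f g : T -> R.

Lemma bounded_integrable f M : measurable_fun setT f ->
  (forall w, `|f w| <= M) -> P.-integrable setT (EFin \o f).
Proof.
move=> mf fM; apply: measurable_bounded_integrable => //.
  by rewrite (le_lt_trans (probability_le1 _ _))// ltry.
exists M; split; first exact: num_real.
by move=> x Mx w _ /=; apply: le_trans (fM w) (ltW Mx).
Qed.

Lemma Rintegral_indicator (A : set T) : measurable A ->
  \int[P]_w \1_A w = fine (P A).
Proof. by move=> mA; rewrite /Rintegral integral_indic// setIT. Qed.

Lemma Rintegral_cst1 (c : R) : \int[P]_w c = c.
Proof. by rewrite Rintegral_cst// [X in fine X](_ : _ = 1%E) ?mulr1//; exact: probability_setT. Qed.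

Lemma integrable_indicator (A : set T) : measurable A ->
  P.-integrable setT (EFin \o \1_A).
Proof.
move=> mA; apply: (@bounded_integrable _ 1).
  exact: measurable_indic.
by move=> w; rewrite indicE; case: (_ \in _); rewrite ?normr1 ?normr0.
Qed.

Lemma Rintegral_fine f : measurable_fun setT f -> (forall w, 0 <= f w) ->
  (\int[P]_w (f w)%:E < +oo)%E ->
  P.-integrable setT (EFin \o f).
Proof.
move=> mf f0 foo; apply/integrableP; split; first exact/measurable_EFinP.
rewrite (eq_integral (fun w => (f w)%:E))// => w _ /=.
by rewrite ger0_norm.
Qed.

Lemma integrable_Rintegral f : P.-integrable setT (EFin \o f) ->
  (\int[P]_w (f w)%:E = (\int[P]_w f w)%:E)%E.
Proof. by move=> fi; rewrite /Rintegral fineK//; exact: integrable_fin_num. Qed.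

End probability_integrals.

Section independent_products.
Context d (T : measurableType d) (R : realType) (P : probability T R).
Context (I : choiceType) (D : set I) (X : I -> {RV P >-> R}).
Hypothesis indX : mutually_independent D X.
Implicit Types (J : set I) (f g : T -> R).

Local Notation meas J f := (measurable_fun [set: coords D X J] f).
Local Notation separated J1 J2 := (forall i, D i -> J1 i -> J2 i -> False).

Lemma measurable_coords_fst J1 J2 f : meas J1 f ->
  measurable_fun [set: (coords D X J1 * coords D X J2)%type] (fun z => f z.1).
Proof. by move=> mf; apply: measurableT_comp mf _; exact: measurable_fst. Qed.

Lemma measurable_coords_snd J1 J2 f : meas J2 f ->
  measurable_fun [set: (coords D X J1 * coords D X J2)%type] (fun z => f z.2).
Proof. by move=> mf; apply: measurableT_comp mf _; exact: measurable_snd. Qed.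

Lemma independent_integralM J1 J2 f g : separated J1 J2 ->
  meas J1 f -> meas J2 g -> (forall w, 0 <= f w) -> (forall w, 0 <= g w) ->
  (\int[P]_w (f w * g w)%:E = \int[P]_w (f w)%:E * \int[P]_w (g w)%:E)%E.
Proof.
move=> J12 mf mg f0 g0.
have mf' := measurable_fun_coordsT mf.
have mg' := measurable_fun_coordsT mg.
rewrite (freezing indX J12 (Phi := fun w w' => (f w * g w')%:E)).
- rewrite (eq_integral (fun w => (f w)%:E * \int[P]_w' (g w')%:E)%E); last first.
    move=> w _; under eq_integral do rewrite EFinM.
    rewrite ge0_integralZl_EFin//; first by move=> w' _; rewrite lee_fin.
    exact/measurable_EFinP.
  rewrite ge0_integralZr//.
  - exact/measurable_EFinP.
  - by move=> w _; rewrite lee_fin.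
  - by apply: integral_ge0 => w _; rewrite lee_fin.
- apply/measurable_EFinP; apply: measurable_funM.
    exact: measurable_coords_fst.
  exact: measurable_coords_snd.
- by move=> w w'; rewrite lee_fin mulr_ge0.
Qed.

(** The product formula for nonnegative functions is applied to [f + 1] and [g + 1], and the cross
    terms cancel. *)
Lemma independent_RintegralM J1 J2 f g : separated J1 J2 ->
  meas J1 f -> meas J2 g ->
  (forall w, `|f w| <= 1) -> (forall w, `|g w| <= 1) ->
  \int[P]_w (f w * g w) = (\int[P]_w f w) * (\int[P]_w g w).
Proof.
move=> J12 mf mg f1 g1.
have mf' := measurable_fun_coordsT mf.
have mg' := measurable_fun_coordsT mg.
have intf := bounded_integrable P mf' f1.
have intg := bounded_integrable P mg' g1.
have int1 : P.-integrable setT (EFin \o cst 1).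
  exact: finite_measure_integrable_cst.
have intfg : P.-integrable setT (EFin \o (fun w => f w * g w)).
  apply: (@bounded_integrable _ _ _ P _ 1); first exact: measurable_funM.
  by move=> w; rewrite normrM -[leRHS]mulr1 ler_pM.
have intf1 : P.-integrable setT (EFin \o (fun w => f w + 1)).
  exact: integrableD intf int1.
have intg1 : P.-integrable setT (EFin \o (fun w => g w + 1)).
  exact: integrableD intg int1.
have intfgf : P.-integrable setT (EFin \o (fun w => f w * g w + f w)).
  exact: integrableD intfg intf.
have intfgfg : P.-integrable setT (EFin \o (fun w => f w * g w + f w + g w)).
  exact: integrableD intfgf intg.
have E : \int[P]_w ((f w + 1) * (g w + 1)) =
    (\int[P]_w (f w + 1)) * (\int[P]_w (g w + 1)).
  rewrite /Rintegral -fineM.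
  - rewrite (independent_integralM J12)//.
    + by apply: measurable_funD => //; exact: measurable_cst.
    + by apply: measurable_funD => //; exact: measurable_cst.
    + by move=> w; have := f1 w; rewrite ler_norml; lra.
    + by move=> w; have := g1 w; rewrite ler_norml; lra.
  - exact: integrable_fin_num intf1.
  - exact: integrable_fin_num intg1.
have L : \int[P]_w ((f w + 1) * (g w + 1)) =
    \int[P]_w (f w * g w) + \int[P]_w f w + \int[P]_w g w + 1.
  transitivity (\int[P]_w (f w * g w + f w + g w + 1)).
    by apply: eq_Rintegral => w _; ring.
  by rewrite !RintegralD// Rintegral_cst1.
rewrite !RintegralD// Rintegral_cst1 in E.
by move: E; rewrite L; lra.
Qed.

End independent_products.

(** * Characteristic functions of independent sums *)

(** The squared modulus of the characteristic function of [f] at [l], written with real integrals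
    only. It is all that is needed: it is multiplicative over independent sums and controls
    concentration around every point at once. *)
Definition charfun_sqr d (T : measurableType d) (R : realType)
    (P : probability T R) (f : T -> R) (l : R) : R :=
  (\int[P]_w cos (l * f w)) ^+ 2 + (\int[P]_w sin (l * f w)) ^+ 2.

Section characteristic_function.
Context d (T : measurableType d) (R : realType) (P : probability T R).
Implicit Types (f g : T -> R) (l : R).

Lemma measurable_cosM l d' (T' : measurableType d') (h : T' -> R) :
  measurable_fun setT h -> measurable_fun setT (fun w => cos (l * h w)).
Proof.
move=> mh; apply: (measurableT_comp (f := cos)).
  by apply: continuous_measurable_fun; exact: continuous_cos.
by apply: measurable_funM => //; exact: measurable_cst.
Qed.

Lemma measurable_sinM l d' (T' : measurableType d') (h : T' -> R) :
  measurable_fun setT h -> measurable_fun setT (fun w => sin (l * h w)).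
Proof.
move=> mh; apply: (measurableT_comp (f := sin)).
  by apply: continuous_measurable_fun; exact: continuous_sin.
by apply: measurable_funM => //; exact: measurable_cst.
Qed.

Lemma integrable_cosM f l : measurable_fun setT f ->
  P.-integrable setT (EFin \o (fun w => cos (l * f w))).
Proof.
move=> mf; apply: (@bounded_integrable _ _ _ P _ 1).
  exact: measurable_cosM.
by move=> w; exact: cos_max.
Qed.

Lemma integrable_sinM f l : measurable_fun setT f ->
  P.-integrable setT (EFin \o (fun w => sin (l * f w))).
Proof.
move=> mf; apply: (@bounded_integrable _ _ _ P _ 1).
  exact: measurable_sinM.
by move=> w; exact: sin_max.
Qed.

Lemma charfun_sqrZ f c l : charfun_sqr P (fun w => c * f w) l =
  charfun_sqr P f (l * c).
Proof.
by rewrite /charfun_sqr; congr (_ ^+ 2 + _ ^+ 2); apply: eq_Rintegral => w _;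
  rewrite mulrA.
Qed.

Lemma charfun_sqr0 l : charfun_sqr P (fun=> 0) l = 1.
Proof.
rewrite /charfun_sqr.
by rewrite !mulr0 cos0 sin0 !Rintegral_cst1 expr1n expr0n/= addr0.
Qed.

(* [1 - cos (l * (f - y)) <= l * r + 2 * 1_{|f - y| >= r}] *)
Lemma charfun_sqr_concentration f l q r y : measurable_fun setT f ->
  0 <= l -> 0 <= q -> 0 <= r -> charfun_sqr P f l <= q ^+ 2 ->
  (1 - q - l * r) / 2 <= fine (P [set w | r <= `|f w - y|]).
Proof.
move=> mf l0 q0 r0 fq.
have mA : measurable [set w | r <= `|f w - y|].
  rewrite -[X in measurable X]setTI; apply: measurable_fun_ler => //.
  by apply: measurableT_comp => //; apply: measurable_funB.
set A := [set w | _] in mA *.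
have intc := integrable_cosM l mf.
have ints := integrable_sinM l mf.
have intC : P.-integrable setT (EFin \o (fun w => cos (l * f w) * cos (l * y))).
  by apply: (@bounded_integrable _ _ _ P _ 1) => [|w];
    [apply: measurable_funM; [exact: measurable_cosM|exact: measurable_cst]|
     rewrite normrM -[leRHS]mulr1 ler_pM ?cos_max].
have intS : P.-integrable setT (EFin \o (fun w => sin (l * f w) * sin (l * y))).
  by apply: (@bounded_integrable _ _ _ P _ 1) => [|w];
    [apply: measurable_funM; [exact: measurable_sinM|exact: measurable_cst]|
     rewrite normrM -[leRHS]mulr1 ler_pM ?sin_max].
(* The integrand is [cos (l * (f - y))]. By the Cauchy-Schwarz inequality in the plane, against the
   unit vector of angle [l * y], its mean is at most the modulus of the characteristic function. *)
have E : \int[P]_w (cos (l * f w) * cos (l * y) + sin (l * f w) * sin (l * y)) <= q.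
  rewrite RintegralD// !RintegralZr//; move: fq; rewrite /charfun_sqr.
  have := cos2Dsin2 (l * y).
  move: (\int[P]_w cos (l * f w)) (\int[P]_w sin (l * f w)) (cos _) (sin _).
  move=> a b c s cs ab.
  have : (a * c + b * s) ^+ 2 <= q ^+ 2.
    apply: le_trans ab.
    rewrite -[leRHS]mulr1 -cs -subr_ge0.
    rewrite (_ : _ - _ = (a * s - b * c) ^+ 2) ?sqr_ge0//; ring.
  move=> h; rewrite leNgt; apply/negP => qx; move: h; apply/negP.
  by rewrite -ltNge ltr_sqr ?nnegrE// (le_trans q0)// ltW.
have int1 (c : R) : P.-integrable setT (EFin \o cst c).
  exact: finite_measure_integrable_cst.
have intA : P.-integrable setT (EFin \o (fun w => 2 * \1_A w)).
  apply: (@bounded_integrable _ _ _ P _ 2).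
    by apply: measurable_funM; [exact: measurable_cst|exact: measurable_indic].
  by move=> w; rewrite indicE; case: (_ \in _); rewrite ?mulr0 ?mulr1 ?normr0 ?ger0_norm.
have : \int[P]_w (1 - l * r - 2 * \1_A w) <=
    \int[P]_w (cos (l * f w) * cos (l * y) + sin (l * f w) * sin (l * y)).
  apply: le_Rintegral => //.
  - exact: (integrableB _ (int1 (1 - l * r)) intA).
  - exact: (integrableD _ intC intS).
  move=> w _; rewrite -cosB -mulrBr indicE.
  have [/set_mem wA|/negP wA] := boolP (w \in A).
    by have := cos_geN1 (l * (f w - y)); have := mulr_ge0 l0 r0; rewrite /=; lra.
  have {}wA : `|f w - y| < r by rewrite ltNge; apply/negP => h; apply: wA; rewrite inE.
  have : l * `|f w - y| <= l * r by rewrite ler_wpM2l// ltW.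
  have := subr1_cos_le_norm (l * (f w - y)).
  by rewrite normrM (ger0_norm l0)/=; lra.
rewrite (RintegralB measurableT (int1 (1 - l * r)) intA).
rewrite Rintegral_cst1 RintegralZl//; last exact: integrable_indicator.
rewrite Rintegral_indicator//.
move: E; lra.
Qed.

End characteristic_function.

Section charfun_independent_sum.
Context d (T : measurableType d) (R : realType) (P : probability T R).
Context (I : choiceType) (D : set I) (X : I -> {RV P >-> R}).
Hypothesis indX : mutually_independent D X.
Implicit Types (J : set I) (f g : T -> R).

Local Notation meas J f := (measurable_fun [set: coords D X J] f).
Local Notation separated J1 J2 := (forall i, D i -> J1 i -> J2 i -> False).

(** By the addition formulas the two integrals of the sum are the real and imaginary parts of a
    product of complex numbers, and squared moduli multiply. *)
Lemma charfun_sqrD J1 J2 f g l : separated J1 J2 -> meas J1 f -> meas J2 g ->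
  charfun_sqr P (fun w => f w + g w) l = charfun_sqr P f l * charfun_sqr P g l.
Proof.
move=> J12 mf mg.
have mf' := measurable_fun_coordsT mf.
have mg' := measurable_fun_coordsT mg.
have mc J h : meas J h -> meas J (fun w => cos (l * h w)) by exact: measurable_cosM.
have ms J h : meas J h -> meas J (fun w => sin (l * h w)) by exact: measurable_sinM.
have bd (a b : T -> R) : measurable_fun setT a -> measurable_fun setT b ->
    (forall w, `|a w| <= 1) -> (forall w, `|b w| <= 1) ->
    P.-integrable setT (EFin \o (fun w => a w * b w)).
  move=> ma mb a1 b1; apply: (@bounded_integrable _ _ _ P _ 1).
    exact: measurable_funM.
  by move=> w; rewrite normrM -[leRHS]mulr1 ler_pM.
have icc := bd _ _ (measurable_cosM l mf') (measurable_cosM l mg')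
  (fun w => cos_max _) (fun w => cos_max _).
have iss := bd _ _ (measurable_sinM l mf') (measurable_sinM l mg')
  (fun w => sin_max _) (fun w => sin_max _).
have isc := bd _ _ (measurable_sinM l mf') (measurable_cosM l mg')
  (fun w => sin_max _) (fun w => cos_max _).
have ics := bd _ _ (measurable_cosM l mf') (measurable_sinM l mg')
  (fun w => cos_max _) (fun w => sin_max _).
have prod (a b : T -> R) : meas J1 a -> meas J2 b ->
    (forall w, `|a w| <= 1) -> (forall w, `|b w| <= 1) ->
    \int[P]_w (a w * b w) = (\int[P]_w a w) * (\int[P]_w b w).
  exact: (independent_RintegralM indX J12).
have EC : \int[P]_w cos (l * (f w + g w)) =
    (\int[P]_w cos (l * f w)) * (\int[P]_w cos (l * g w)) -
    (\int[P]_w sin (l * f w)) * (\int[P]_w sin (l * g w)).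
  transitivity (\int[P]_w (cos (l * f w) * cos (l * g w) -
                           sin (l * f w) * sin (l * g w))).
    by apply: eq_Rintegral => w _; rewrite mulrDr cosD.
  rewrite (RintegralB measurableT icc iss).
  congr (_ - _); apply: prod => //.
  - exact: mc.
  - exact: mc.
  - by move=> w; exact: cos_max.
  - by move=> w; exact: cos_max.
  - exact: ms.
  - exact: ms.
  - by move=> w; exact: sin_max.
  - by move=> w; exact: sin_max.
have ES : \int[P]_w sin (l * (f w + g w)) =
    (\int[P]_w sin (l * f w)) * (\int[P]_w cos (l * g w)) +
    (\int[P]_w cos (l * f w)) * (\int[P]_w sin (l * g w)).
  transitivity (\int[P]_w (sin (l * f w) * cos (l * g w) +
                           cos (l * f w) * sin (l * g w))).
    by apply: eq_Rintegral => w _; rewrite mulrDr sinD.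
  rewrite (RintegralD measurableT isc ics).
  congr (_ + _); apply: prod => //.
  - exact: ms.
  - exact: mc.
  - by move=> w; exact: sin_max.
  - by move=> w; exact: cos_max.
  - exact: mc.
  - exact: ms.
  - by move=> w; exact: cos_max.
  - by move=> w; exact: sin_max.
by rewrite /charfun_sqr EC ES; ring.
Qed.

Lemma charfun_sqr_sum (K : eqType) (r : seq K) (J : K -> set I)
    (f : K -> T -> R) l : uniq r ->
  (forall i j, i != j -> separated (J i) (J j)) -> (forall i, meas (J i) (f i)) ->
  charfun_sqr P (fun w => \sum_(i <- r) f i w) l =
  \prod_(i <- r) charfun_sqr P (f i) l.
Proof.
move=> + sJ mf; elim: r => [_|i r IH /= /andP[ir ur]].
  rewrite big_nil -[RHS](charfun_sqr0 P l); congr charfun_sqr.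
  by apply/funext => w; rewrite big_nil.
rewrite big_cons -IH//.
rewrite -(@charfun_sqrD (J i) (\bigcup_(j in [set` r]) J j) (f i)
  (fun w => \sum_(j <- r) f j w) l).
- by congr charfun_sqr; apply/funext => w; rewrite big_cons.
- move=> k Dk Jik [j /= jr Jjk]; apply: (sJ i j) Dk Jik Jjk.
  by apply: contraNneq ir => ->.
- exact: mf.
(* The sum has to be measurable for the union of the [J j] over [r] alone, hence the terms with
   index outside [r] are replaced by 0. *)
- rewrite (_ : (fun w => _) = (fun w => \sum_(j <- r)
      (if j \in r then f j w else 0))); last first.
    by apply/funext => w; apply: eq_big_seq => j ->.
  apply: measurable_sum => j; have [jr|_] := boolP (j \in r); last exact: measurable_cst.
  apply: measurable_coords_sub (mf j) => k Jk; exists j => //.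
Qed.

End charfun_independent_sum.

Section charfun_small_argument.
Context d (T : measurableType d) (R : realType) (P : probability T R).

(** No second moment is assumed. The mean deviation alone makes [y = 1 - E cos (s f)] at least
    [c1^2 s^2 / 8]. As [f] is centred, the sine integral is that of [sin (s f) - s f], at most
    [c1 |s| / 4] for small [s]. With [y <= 1] this bounds the squared modulus by
    [1 - y + c1^2 s^2 / 16]. The constants do not depend on [f], so they serve for tree sums of
    every depth. *)
Lemma charfun_sqr_small (p c1 C1 : R) : 1 < p -> p <= 2 -> 0 < c1 -> 0 < C1 ->
  exists c s0 : R, [/\ 0 < c, 0 < s0 &
  forall f : T -> R, measurable_fun setT f ->
    \int[P]_w f w = 0 -> c1 <= \int[P]_w `|f w| ->
    (\int[P]_w (`|f w| `^ p)%:E <= C1%:E)%E ->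
    forall s, `|s| <= s0 -> charfun_sqr P f s <= expR (- (c * s ^+ 2))].
Proof.
move=> p1 p2 c10 C10.
have p10 : 0 < p - 1 by lra.
(* The bound [4 / c1] yields [y <= 1] below; the last one yields [|s|^(p-1) * C1 <= c1 / 8], which
   turns each error [|s|^p * C1] into a small multiple of [c1 * |s|]. *)
pose s0 := Num.min 1 (Num.min (4 / c1) ((c1 / (8 * C1)) `^ (p - 1)^-1)).
have q0 : 0 < c1 / (8 * C1) by rewrite divr_gt0// mulr_gt0.
exists (c1 ^+ 2 / 16), s0; split.
- by rewrite divr_gt0// exprn_gt0.
- by rewrite !lt_min ltr01 divr_gt0// powR_gt0.
move=> f mf f0 fc fC s.
rewrite !le_min => /and3P[s1 s4 sp].
have sp1 : `|s| `^ (p - 1) * C1 <= c1 / 8.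
  have : `|s| `^ (p - 1) <= c1 / (8 * C1).
    have -> : c1 / (8 * C1) = ((c1 / (8 * C1)) `^ (p - 1)^-1) `^ (p - 1).
      by rewrite -powRrM mulVf ?gt_eqF// powRr1// ltW.
    by rewrite ge0_ler_powR ?nnegrE ?powR_ge0// ltW.
  rewrite ler_pdivlMr ?mulr_gt0//; lra.
have spE : `|s| `^ p = `|s| * `|s| `^ (p - 1) by rewrite mulr_powRB1//; lra.
have sC : `|s| `^ p * C1 <= `|s| * (c1 / 8).
  by rewrite spE -mulrA ler_wpM2l.
have mfp : measurable_fun setT (fun w => `|f w| `^ p).
  apply: (measurableT_comp (f := fun x : R => x `^ p)).
    exact: measurable_powR.
  exact: measurableT_comp.
have ip : P.-integrable setT (EFin \o (fun w => `|f w| `^ p)).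
  apply: Rintegral_fine => //.
  by rewrite (le_lt_trans fC)// ltry.
have fC' : \int[P]_w (`|f w| `^ p) <= C1.
  by move: fC; rewrite (integrable_Rintegral ip) lee_fin.
have i1 (c : R) : P.-integrable setT (EFin \o cst c).
  exact: finite_measure_integrable_cst.
have ifn : P.-integrable setT (EFin \o (fun w => `|f w|)).
  have i1p : P.-integrable setT (EFin \o (fun w => 1 + `|f w| `^ p)).
    exact: (integrableD _ (i1 1) ip).
  apply: le_integrable i1p => //.
    by apply/measurable_EFinP; exact: measurableT_comp.
  move=> w _ /=; rewrite lee_fin normr_id [leRHS]ger0_norm ?addr_ge0 ?powR_ge0//.
  have [fw1|/ltW fw1] := leP `|f w| 1.
    by have := powR_ge0 `|f w| p; lra.
  by have := le1r_powR fw1 (ltW p1); lra.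
have if_ : P.-integrable setT (EFin \o f).
  apply: le_integrable ifn => //; first exact/measurable_EFinP.
  by move=> w _ /=; rewrite normr_id.
have ic := integrable_cosM P s mf.
have is_ := integrable_sinM P s mf.
have i1c : P.-integrable setT (EFin \o (fun w => 1 - cos (s * f w))).
  exact: (integrableB _ (i1 1) ic).
have iZ (c : R) (g : T -> R) : P.-integrable setT (EFin \o g) ->
    P.-integrable setT (EFin \o (fun w => c * g w)).
  by move=> ig; exact: (integrableZl measurableT c ig).
set y := 1 - \int[P]_w cos (s * f w).
have yE : \int[P]_w (1 - cos (s * f w)) = y.
  by rewrite (RintegralB measurableT (i1 1) ic) Rintegral_cst1.
have y_ge : s ^+ 2 * (c1 ^+ 2 / 2) <= 4 * y.
  (* With this [h] the mean of the bracket of [subr1_cos_ge] is at least [c1^2 * (1 - 1/4 - 1/8)],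
     above the [c1^2 / 2] that is claimed. *)
  pose h := c1 / 2.
  have h0 : 0 <= h by rewrite /h; lra.
  pose K := 2 * h * `|s| `^ (p - 1).
  have iL : P.-integrable setT (EFin \o (fun w => 2 * h * `|f w| - h ^+ 2)).
    exact: (integrableB _ (iZ _ _ ifn) (i1 (h ^+ 2))).
  have iL2 : P.-integrable setT (EFin \o
      (fun w => 2 * h * `|f w| - h ^+ 2 - K * `|f w| `^ p)).
    exact: (integrableB _ iL (iZ _ _ ip)).
  have : \int[P]_w (s ^+ 2 * (2 * h * `|f w| - h ^+ 2 - K * `|f w| `^ p)) <=
      \int[P]_w (4 * (1 - cos (s * f w))).
    apply: le_Rintegral => //; [exact: iZ|exact: iZ|].
    by move=> w _; exact: subr1_cos_ge.
  rewrite (RintegralZl _ _ i1c)// yE RintegralZl//.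
  rewrite (RintegralB measurableT iL (iZ _ _ ip)).
  rewrite (RintegralB measurableT (iZ _ _ ifn) (i1 (h ^+ 2))).
  rewrite Rintegral_cst1 !RintegralZl//.
  apply: le_trans; rewrite ler_wpM2l ?sqr_ge0//.
  have : 2 * h * c1 <= 2 * h * \int[P]_w `|f w| by rewrite ler_wpM2l// mulr_ge0.
  have : K * \int[P]_w (`|f w| `^ p) <= 2 * h * (c1 / 8).
    apply: le_trans (_ : K * C1 <= _).
      by apply: ler_wpM2l fC'; rewrite /K mulr_ge0 ?powR_ge0// mulr_ge0.
    by rewrite /K -[X in X <= _]mulrA; apply: ler_wpM2l sp1; rewrite mulr_ge0.
  rewrite /h; nra.
have y_le : y <= 1.
  rewrite -yE; apply: le_trans (_ : \int[P]_w (2 * `|s| `^ p * `|f w| `^ p) <= _).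
    apply: le_Rintegral => //; first exact: iZ.
    move=> w _; rewrite -mulrA -powRM// -normrM.
    by apply: subr1_cos_le_powR => //; exact: ltW.
  rewrite RintegralZl//.
  have : `|s| `^ p * \int[P]_w (`|f w| `^ p) <= `|s| `^ p * C1.
    by rewrite ler_wpM2l ?powR_ge0.
  have : `|s| * c1 <= 4 by move: s4; rewrite ler_pdivlMr.
  lra.
have S_le : `|\int[P]_w sin (s * f w)| <= `|s| * (c1 / 4).
  have -> : \int[P]_w sin (s * f w) = \int[P]_w (sin (s * f w) - s * f w).
    by rewrite (RintegralB measurableT is_ (iZ _ _ if_)) RintegralZl// f0 mulr0 subr0.
  have iss : P.-integrable setT (EFin \o (fun w => sin (s * f w) - s * f w)).
    exact: (integrableB _ is_ (iZ _ _ if_)).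
  apply: le_trans (le_normr_Rintegral _ iss) _ => //.
  apply: le_trans (_ : \int[P]_w (2 * `|s| `^ p * `|f w| `^ p) <= _).
    apply: le_Rintegral => //; [|exact: iZ|].
      exact: integrable_norm iss.
    move=> w _; rewrite -mulrA -powRM// -normrM.
    by apply: ler_norm_sinB_powR => //; exact: ltW.
  rewrite RintegralZl//.
  have : `|s| `^ p * \int[P]_w (`|f w| `^ p) <= `|s| `^ p * C1.
    by rewrite ler_wpM2l ?powR_ge0.
  lra.
have y0 : 0 <= y by rewrite -yE; apply: Rintegral_ge0 => w _; exact: subr1_cos_ge0.
apply: le_trans (expR_ge1Dx _).
rewrite /charfun_sqr (_ : \int[P]_w cos (s * f w) = 1 - y); last by rewrite /y; ring.
have : (\int[P]_w sin (s * f w)) ^+ 2 <= s ^+ 2 * c1 ^+ 2 / 16.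
  have : `|\int[P]_w sin (s * f w)| ^+ 2 <= (`|s| * (c1 / 4)) ^+ 2.
    by rewrite ler_sqr ?nnegrE// mulr_ge0//; lra.
  by rewrite !exprMn !real_normK ?num_real//; lra.
have : (1 - y) ^+ 2 <= 1 - y by nra.
lra.
Qed.

End charfun_small_argument.

(** * Moments of random tree sums *)

Section powR_sums.
Context (R : realType).

(** For a ratio [z / (x + y)] in [0, 1] the power [q <= 1] only increases it; summing over [z = x]
    and [z = y] gives the bound. *)
Lemma powR_subadditive (x y q : R) : 0 <= x -> 0 <= y -> 0 < q -> q <= 1 ->
  (x + y) `^ q <= x `^ q + y `^ q.
Proof.
move=> x0 y0 q0 q1.
have := addr_ge0 x0 y0; rewrite le_eqVlt => /predU1P[<-|s0].
  by rewrite powR0 ?gt_eqF// addr_ge0 ?powR_ge0.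
have part z : 0 <= z -> z <= x + y -> (x + y) `^ q * (z / (x + y)) <= z `^ q.
  rewrite le_eqVlt => /predU1P[<- _|z0 zs].
    by rewrite mul0r mulr0 powR_ge0.
  have -> : z `^ q = (x + y) `^ q * (z / (x + y)) `^ q.
    by rewrite -powRM ?divr_ge0 ?ltW// mulrCA divff ?gt_eqF// mulr1.
  rewrite ler_wpM2l ?powR_ge0// ger1_powR// divr_gt0//=.
  by rewrite ler_pdivrMr// mul1r.
have -> : (x + y) `^ q = (x + y) `^ q * (x / (x + y)) + (x + y) `^ q * (y / (x + y)).
  by rewrite -mulrDr -mulrDl divff ?gt_eqF// mulr1.
by apply: lerD; apply: part => //; lra.
Qed.

Lemma powR_sum_le (K : Type) (r : seq K) (F : K -> R) q :
  (forall i, 0 <= F i) -> 0 < q -> q <= 1 ->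
  (\sum_(i <- r) F i) `^ q <= \sum_(i <- r) F i `^ q.
Proof.
move=> F0 q0 q1; elim: r => [|i r IH].
  by rewrite !big_nil powR0 ?gt_eqF.
rewrite !big_cons; apply: le_trans (powR_subadditive _ _ q0 q1) _ => //.
  exact: sumr_ge0.
by rewrite lerD2l.
Qed.

(* [(\sum F) ^ p = (\sum_i \sum_j F i * F j) ^ (p / 2)] *)
Lemma powR_sum_pair_le (K : finType) (F : K -> R) p :
  (forall i, 0 <= F i) -> 0 < p -> p <= 2 ->
  (\sum_i F i) `^ p <= \sum_i \sum_j (F i * F j) `^ (p / 2).
Proof.
move=> F0 p0 p2.
have -> : (\sum_i F i) `^ p = ((\sum_i F i) ^+ 2) `^ (p / 2).
  by rewrite -powR_mulrn ?sumr_ge0// -powRrM mulrC divfK.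
rewrite expr2 mulr_suml.
apply: le_trans (powR_sum_le _ _ _ _) _; [|lra|lra|].
  by move=> i; rewrite mulr_ge0 ?sumr_ge0.
apply: ler_sum => i _; rewrite mulr_sumr.
by apply: powR_sum_le; [move=> j; rewrite mulr_ge0|lra|lra].
Qed.

End powR_sums.

Section lower_tail.
Context d (T : measurableType d) (R : realType) (P : probability T R).

(** Pointwise [f <= 1/2 + K * 1_A + K^(1-p) * f^p], where [A] is the event [f >= 1/2]. The threshold
    [K] is such that the last term has mean at most 1/4, so that [K * P A >= 1/4]. *)
Lemma lower_tail_bound (p C : R) : 1 < p -> 0 < C ->
  exists2 c : R, 0 < c & forall f : T -> R, measurable_fun setT f ->
    (forall w, 0 <= f w) -> (\int[P]_w (f w)%:E = 1)%E ->
    (\int[P]_w (f w `^ p)%:E <= C%:E)%E ->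
    c <= fine (P [set w | 1 / 2 <= f w]).
Proof.
move=> p1 C0; have p10 : 0 < p - 1 by lra.
pose K := Num.max 1 ((4 * C) `^ (p - 1)^-1).
have K1 : 1 <= K by rewrite le_max lexx.
have K0 : 0 < K by apply: lt_le_trans K1.
have KC : 4 * C <= K `^ (p - 1).
  have -> : 4 * C = ((4 * C) `^ (p - 1)^-1) `^ (p - 1).
    by rewrite -powRrM mulVf ?gt_eqF// powRr1// ltW// mulr_gt0.
  by rewrite ge0_ler_powR ?nnegrE ?powR_ge0 ?(ltW p10) ?(ltW K0)// le_max lexx orbT.
have Kp0 : 0 < K `^ (p - 1) by rewrite powR_gt0.
exists (1 / (4 * K)); first by rewrite divr_gt0// mulr_gt0.
move=> f mf f0 f1 fC.
have mA : measurable [set w | 1 / 2 <= f w].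
  by rewrite -[X in measurable X]setTI; apply: measurable_fun_ler.
set A := [set w | _] in mA *.
have mfp : measurable_fun setT (fun w => f w `^ p).
  by apply: (measurableT_comp (f := fun x : R => x `^ p)) => //; exact: measurable_powR.
have ip : P.-integrable setT (EFin \o (fun w => f w `^ p)).
  apply: Rintegral_fine => //; first by move=> w; exact: powR_ge0.
  by rewrite (le_lt_trans fC)// ltry.
have fC' : \int[P]_w (f w `^ p) <= C.
  by move: fC; rewrite (integrable_Rintegral ip) lee_fin.
have if_ : P.-integrable setT (EFin \o f).
  by apply: Rintegral_fine => //; rewrite f1 ltry.
have f1' : \int[P]_w f w = 1 by rewrite /Rintegral f1.
have iA := integrable_indicator P mA.
have i1 (c : R) : P.-integrable setT (EFin \o cst c).
  exact: finite_measure_integrable_cst.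
have iKA : P.-integrable setT (EFin \o (fun w => K * \1_A w)).
  exact: (integrableZl measurableT K iA).
have iKp : P.-integrable setT (EFin \o (fun w => (K `^ (p - 1))^-1 * f w `^ p)).
  exact: (integrableZl measurableT _ ip).
have i2 : P.-integrable setT (EFin \o (fun w => 1 / 2 + K * \1_A w)).
  exact: (integrableD measurableT (i1 (1 / 2)) iKA).
have : \int[P]_w f w <=
    \int[P]_w (1 / 2 + K * \1_A w + (K `^ (p - 1))^-1 * f w `^ p).
  apply: le_Rintegral => //; first exact: (integrableD measurableT i2 iKp).
  move=> w _; have fp := powR_ge0 (f w) p.
  have t0 : 0 <= (K `^ (p - 1))^-1 * f w `^ p by rewrite mulr_ge0// invr_ge0 ltW.
  rewrite indicE; have [/set_mem wA|/negP wA] := boolP (w \in A); last first.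
    have : f w < 1 / 2 by rewrite ltNge; apply/negP => h; apply: wA; rewrite inE.
    by rewrite mulr0; lra.
  rewrite mulr1; have [|fK] := leP (f w) K; first lra.
  have : f w <= (K `^ (p - 1))^-1 * f w `^ p.
    rewrite mulrC ler_pdivlMr// -(@mulr_powRB1 _ (f w) p)//; last lra.
    rewrite ler_wpM2l// ge0_ler_powR ?nnegrE// ?ltW//; exact: lt_trans fK.
  lra.
rewrite f1' (RintegralD measurableT i2 iKp).
rewrite (RintegralD measurableT (i1 (1 / 2)) iKA) Rintegral_cst1.
rewrite !RintegralZl// Rintegral_indicator//.
have : (K `^ (p - 1))^-1 * \int[P]_w (f w `^ p) <= 1 / 4.
  rewrite mulrC ler_pdivrMr//; lra.
move=> h1 h2; rewrite ler_pdivrMr ?mulr_gt0//; lra.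
Qed.

End lower_tail.

(** [words_below u] indexes the weights that enter a tree sum at [u], to which the weight of [u]
    does not belong; [words_from u] adds [u] and indexes a whole branch of its parent. *)
Definition words_below b (u : seq 'I_b) : set (seq 'I_b) :=
  [set v | prefix u v /\ (size u < size v)%N].

Definition words_from b (u : seq 'I_b) : set (seq 'I_b) := [set v | prefix u v].

Section words.
Context (b : nat).
Implicit Types u v : seq 'I_b.

Lemma prefix_rconsW i u v : prefix (rcons u i) v -> prefix u v.
Proof. by apply: prefix_trans; exact: prefix_rcons. Qed.

Lemma words_from_rcons i u : words_from (rcons u i) `<=` words_below u.
Proof.
move=> v uv; split; first exact: prefix_rconsW uv.
by have /size_prefix := uv; rewrite size_rcons.
Qed.

Lemma words_below_from u : words_below u `<=` words_from u.
Proof. by move=> v []. Qed.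

Lemma words_below_rcons i u : words_below (rcons u i) `<=` words_below u.
Proof. exact: subset_trans (@words_below_from _) (@words_from_rcons i u). Qed.

Lemma words_from_neq i j u v : i != j ->
  words_from (rcons u i) v -> words_from (rcons u j) v -> False.
Proof.
move=> ij; rewrite /words_from/= !prefixE !size_rcons => /eqP -> /eqP/rcons_inj[] ji.
by rewrite ji eqxx in ij.
Qed.

End words.

Section random_tree_sums.
Context (R : realType) (b : nat) d (T : measurableType d) (P : probability T R).
Context (Wu : seq 'I_b -> {RV P >-> R}).
Hypothesis indW : mutually_independent [set u | u != [::]] Wu.

Local Notation meas J f :=
  (measurable_fun [set: coords [set u | u != [::]] Wu J] f).

Lemma measurable_weight (g : R -> R) J v : measurable_fun setT g ->
  J v -> v != [::] -> meas J (fun w => g (Wu v w)).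
Proof.
by move=> mg Jv v0; apply: measurableT_comp mg _; exact: measurable_coord.
Qed.

Lemma measurable_random_tree_sum (g : R -> R) J (F : seq 'I_b -> T -> R) k u :
  measurable_fun setT g -> words_below u `<=` J ->
  (forall v, prefix u v -> size v = (size u + k)%N -> meas J (F v)) ->
  meas J (fun w => tree_sum (fun v => g (Wu v w)) (F^~ w) k u).
Proof.
move=> mg uJ mF.
apply: (@measurable_tree_sum R b _ (coords [set u | u != [::]] Wu J)
  (fun v w => g (Wu v w)) F k u) => // v uv suv.
apply: measurable_weight => //; first by apply: uJ.
by apply: contraTneq suv => ->.
Qed.

Lemma measurable_branch (g : R -> R) F k u i : measurable_fun setT g ->
  meas (words_from (rcons u i)) (fun w => g (Wu (rcons u i) w) *
    tree_sum (fun v => g (Wu v w)) F k (rcons u i)).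
Proof.
move=> mg; apply: measurable_funM.
  by apply: measurable_weight => //; [exact: prefix_refl|case: (u)].
by apply: measurable_random_tree_sum => //; exact: words_below_from.
Qed.

Section one_weight_function.
Context (g : R -> R).
Hypotheses (mg : measurable_fun setT g) (g0 : forall y, 0 <= g y).
Implicit Types (F : seq 'I_b -> R) (u v : seq 'I_b).

Let Z F k u w := tree_sum (fun v => g (Wu v w)) F k u.

Let meas_Z F k u : meas (words_below u) (Z F k u).
Proof. exact: measurable_random_tree_sum. Qed.

Let Z_ge0 F k u w : (forall v, 0 <= F v) -> 0 <= Z F k u w.
Proof. by move=> F0; exact: tree_sum_ge0. Qed.

(** The weight of a child is independent of the weights strictly below it. The function [h] is the
    identity for means and a power for moments. *)
Lemma integral_branch (h : R -> R) F k u i : measurable_fun setT h ->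
  (forall y, 0 <= y -> 0 <= h y) -> (forall v, 0 <= F v) ->
  (\int[P]_w (h (g (Wu (rcons u i) w)) * h (Z F k (rcons u i) w))%:E =
   \int[P]_w (h (g (Wu (rcons u i) w)))%:E *
   \int[P]_w (h (Z F k (rcons u i) w))%:E)%E.
Proof.
move=> mh h0 F0.
apply: (independent_integralM indW (J1 := [set rcons u i])
    (J2 := words_below (rcons u i))).
- by move=> _ _ -> []; rewrite ltnn.
- apply: (measurable_weight (g := h \o g)) => //; last by case: (u).
  exact: measurableT_comp.
- by apply: measurableT_comp mh _; exact: meas_Z.
- by move=> w; exact: h0.
- by move=> w; apply: h0; exact: Z_ge0.
Qed.

Lemma integral_branch_id F k u i : (forall v, 0 <= F v) ->
  (\int[P]_w (g (Wu (rcons u i) w) * Z F k (rcons u i) w)%:E =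
   \int[P]_w (g (Wu (rcons u i) w))%:E * \int[P]_w (Z F k (rcons u i) w)%:E)%E.
Proof.
move=> F0.
exact: (integral_branch k u i (@measurable_id _ _ setT) (fun _ => id) F0).
Qed.

Lemma integral_tree_sum (m : R) F k u : (forall v, 0 <= F v) ->
  (forall v, v != [::] -> (\int[P]_w (g (Wu v w))%:E = m%:E)%E) ->
  (\int[P]_w (Z F k u w)%:E = (tree_sum (fun=> m) F k u)%:E)%E.
Proof.
move=> F0 gm; elim: k u => [|k IH] u.
  rewrite /Z /= (integral_cst _ _ (F u)%:E)// -[RHS]mule1; congr (_ * _)%E.
  exact: probability_setT.
rewrite /Z/=; under eq_integral do rewrite -sumEFin.
rewrite ge0_integral_sum//.
- rewrite -sumEFin; apply: eq_bigr => i _.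
  rewrite integral_branch_id// EFinM; congr (_ * _)%E.
  + by apply: gm; case: (u).
  + exact: IH.
- move=> i; apply/measurable_EFinP.
  exact: (measurable_fun_coordsT (measurable_branch F k mg)).
- by move=> i w _; rewrite lee_fin mulr_ge0 ?Z_ge0.
Qed.

(** Induction on the depth. After expansion into pairs of children, a diagonal term contributes at
    most [r * C], while an off-diagonal one factors into two means of [y^(p/2) <= 1 + y], each at
    most 2. This gives [b r C + 4 b^2] at the next depth, and [b r < 1] makes that stable. *)
Lemma tree_sum_moment_bound (m p r : R) : 0 <= m -> b%:R * m = 1 ->
  1 < p -> p <= 2 -> b%:R * r < 1 -> 0 <= r ->
  (forall v, v != [::] -> (\int[P]_w (g (Wu v w))%:E = m%:E)%E) ->
  (forall v, v != [::] -> (\int[P]_w (g (Wu v w) `^ p)%:E = r%:E)%E) ->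
  exists2 C : R, 0 < C & forall k u, (\int[P]_w (Z (fun=> 1) k u w `^ p)%:E <= C%:E)%E.
Proof.
move=> m0 bm p1 p2 br r0 gm gp.
have p0 : 0 < p by lra.
(* The quotient is the fixed point of [t = b r t + 4 b^2]; the added 1 covers depth 0, where the
   tree sum is 1. *)
pose C := 1 + 4 * b%:R ^+ 2 / (1 - b%:R * r).
have br1 : 0 < 1 - b%:R * r by lra.
have b0 : 0 <= b%:R :> R by rewrite ler0n.
have C1 : 1 <= C by rewrite lerDl divr_ge0 ?(ltW br1)// mulr_ge0 ?sqr_ge0.
have CC : b%:R * r * C + 4 * b%:R ^+ 2 <= C.
  pose t := 4 * b%:R ^+ 2 / (1 - b%:R * r); rewrite /C -/t.
  have -> : 4 * b%:R ^+ 2 = t * (1 - b%:R * r) by rewrite /t divfK ?gt_eqF.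
  lra.
have b1 : 1 <= b%:R :> R.
  rewrite ler1n lt0n; apply/eqP => b0'; move: bm; rewrite b0' mul0r => /eqP.
  by rewrite eq_sym oner_eq0.
have m1 : m <= 1 by nra.
exists C; first lra.
elim=> [|k IH] u.
  rewrite /Z/= powR1 (integral_cst _ _ 1%:E)// mul1e [X in (X <= _)%E](_ : _ = 1%E).
    by rewrite lee_fin.
  exact: probability_setT.
pose y i w := g (Wu (rcons u i) w) * Z (fun=> 1) k (rcons u i) w.
have y0 i w : 0 <= y i w by rewrite mulr_ge0 ?Z_ge0.
have my i : meas (words_from (rcons u i)) (y i) by exact: measurable_branch.
have myT i := measurable_fun_coordsT (my i).
have mpow q (h : T -> R) : measurable_fun setT h -> measurable_fun setT (fun w => h w `^ q).
  by move=> mh; apply: (measurableT_comp (f := fun x : R => x `^ q)) => //; exact: measurable_powR.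
have Ey i : (\int[P]_w (y i w)%:E <= 1)%E.
  rewrite /y integral_branch_id// gm; last by case: (u).
  rewrite (integral_tree_sum k (rcons u i) (fun=> ler01) gm).
  rewrite tree_sum_cst ?mule1 ?lee_fin// => _.
  by rewrite sumr_const card_ord -mulr_natl bm.
have Eyp i : (\int[P]_w (y i w `^ p)%:E <= (r * C)%:E)%E.
  under eq_integral do rewrite powRM ?Z_ge0//.
  rewrite (integral_branch (h := fun x => x `^ p))//.
  - by rewrite gp; [rewrite EFinM lee_wpmul2l// lee_fin|case: (u)].
  - by move=> x _; exact: powR_ge0.
have Eyq i : (\int[P]_w (y i w `^ (p / 2))%:E <= 2%:E)%E.
  apply: (@le_trans _ _ (\int[P]_w (1 + y i w)%:E)%E).
    apply: ge0_le_integral => //.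
    - by move=> w _; rewrite lee_fin powR_ge0.
    - by apply/measurable_EFinP; exact: mpow.
    - by apply/measurable_EFinP; apply: measurable_funD.
    move=> w _; rewrite lee_fin; have [y1|/ltW y1] := leP (y i w) 1.
      apply: le_trans (_ : 1 <= _); last by rewrite lerDl.
      have : y i w `^ (p / 2) <= 1 `^ (p / 2).
        by rewrite ge0_ler_powR ?nnegrE//; lra.
      by rewrite powR1.
    have : y i w `^ (p / 2) <= y i w by apply: ler1_powR => //; lra.
    lra.
  under eq_integral do rewrite EFinD.
  rewrite ge0_integralD//; last first.
  - exact/measurable_EFinP.
  - by move=> w _; rewrite lee_fin.
  rewrite (integral_cst _ _ 1%:E)// mul1e (_ : 2%:E = 1%:E + 1%:E)%E; last first.
    by rewrite -EFinD; congr EFin; ring.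
  by apply: leeD (Ey i); rewrite le_eqVlt; apply/orP; left; apply/eqP; exact: probability_setT.
have Eyy i j : (\int[P]_w ((y i w * y j w) `^ (p / 2))%:E <=
    ((if j == i then r * C else 0) + 4)%:E)%E.
  case: (eqVneq i j) => [<-|ij].
    rewrite (eq_integral (fun w => (y i w `^ p)%:E)).
      by apply: le_trans (Eyp i) _; rewrite lee_fin lerDl.
    by move=> w _; rewrite -expr2 -powR_mulrn// -powRrM mulrC divfK.
  rewrite add0r; under eq_integral do rewrite powRM//.
  rewrite (independent_integralM indW (J1 := words_from (rcons u i))
    (J2 := words_from (rcons u j))).
  - rewrite (_ : 4 = 2 * 2); last by ring.
    rewrite EFinM; apply: lee_pmul => //;
      by apply: integral_ge0 => w _; rewrite lee_fin powR_ge0.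
  - by move=> v _; exact: words_from_neq.
  - by apply: (measurableT_comp (f := fun x : R => x `^ (p / 2))) (my i);
      exact: measurable_powR.
  - by apply: (measurableT_comp (f := fun x : R => x `^ (p / 2))) (my j);
      exact: measurable_powR.
  - by move=> w; exact: powR_ge0.
  - by move=> w; exact: powR_ge0.
have m2 i j : measurable_fun setT (fun w => ((y i w * y j w) `^ (p / 2))%:E).
  by apply/measurable_EFinP; apply: mpow; apply: measurable_funM.
apply: (@le_trans _ _ (\int[P]_w (\sum_i \sum_j ((y i w * y j w) `^ (p / 2))%:E))%E).
  apply: ge0_le_integral => //.
  - by move=> w _; rewrite lee_fin powR_ge0.
  - apply/measurable_EFinP; apply: mpow.
    exact: (measurable_fun_coordsT (@meas_Z (fun=> 1) k.+1 u)).
  - by apply: emeasurable_sum => i; apply: emeasurable_sum => j.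
  move=> w _; under eq_bigr do rewrite sumEFin.
  rewrite sumEFin lee_fin.
  exact: (powR_sum_pair_le (F := y^~ w)).
rewrite ge0_integral_sum//; last 2 first.
- by move=> i; apply: emeasurable_sum => j.
- by move=> i w _; apply: sume_ge0 => j _; rewrite lee_fin powR_ge0.
apply: (@le_trans _ _ (\sum_(i < b) \sum_(j < b) ((if j == i then r * C else 0) + 4)%:E)%E).
  apply: lee_sum => i _; rewrite ge0_integral_sum//.
    by apply: lee_sum => j _; exact: Eyy.
  by move=> j w _; rewrite lee_fin powR_ge0.
under eq_bigr do rewrite sumEFin.
rewrite sumEFin lee_fin.
under eq_bigr do rewrite big_split/= -big_mkcond/= big_pred1_eq sumr_const card_ord.
rewrite sumr_const card_ord -[X in X <= _]mulr_natl -[4 *+ b]mulr_natl.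
by apply: le_trans CC; rewrite le_eqVlt; apply/orP; left; apply/eqP; ring.
Qed.

End one_weight_function.
End random_tree_sums.

Section markov_inequality.
Context d (T : measurableType d) (R : realType) (P : probability T R).

Lemma markov_bound (f : T -> R) (e B : R) : measurable_fun setT f ->
  (forall w, 0 <= f w) -> (\int[P]_w (f w)%:E <= e%:E)%E -> 0 < B ->
  fine (P [set w | B <= f w]) <= e / B.
Proof.
move=> mf f0 fe B0.
have mA : measurable [set w | B <= f w].
  by rewrite -[X in measurable X]setTI; apply: measurable_fun_ler.
have if_ : P.-integrable setT (EFin \o f).
  by apply: Rintegral_fine => //; rewrite (le_lt_trans fe)// ltry.
rewrite -Rintegral_indicator// ler_pdivlMr// -RintegralZr//; last first.
  exact: integrable_indicator.
move: fe; rewrite (integrable_Rintegral if_) lee_fin; apply: le_trans.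
apply: le_Rintegral => //.
  exact: (integrableZr measurableT B (integrable_indicator P mA)).
move=> w _; rewrite indicE; have [/set_mem wA|_] := boolP (w \in _).
  by rewrite mul1r.
by rewrite mul0r.
Qed.

Lemma probability_subU (A B C : set T) : measurable A -> measurable B ->
  measurable C -> A `<=` B `|` C -> fine (P A) <= fine (P B) + fine (P C).
Proof.
move=> mA mB mC ABC.
rewrite -fineD ?fin_num_measure// fine_le ?fin_num_measure//.
  by rewrite fin_numD !fin_num_measure.
apply: le_trans (measureU2 P mB mC).
by rewrite le_measure// inE//; exact: measurableU.
Qed.

End markov_inequality.

(** * Lower tail of the sum of squared weights *)

Section square_sum.
Context (R : realType) (b : nat) d (T : measurableType d) (P : probability T R).
Context (Wu : seq 'I_b -> {RV P >-> R}).
Hypothesis indW : mutually_independent [set u | u != [::]] Wu.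
Context (g : R -> R).
Hypotheses (mg : measurable_fun setT g) (g0 : forall y, 0 <= g y).

(* The tree sum of [a]-th powers is comparable to its mean with positive
   probability (Paley-Zygmund in [L^p]), while [tree_sum_powR_interpolation]
   bounds it by the tree sums of [a']-th powers, controlled in mean, and of squares. *)
Lemma square_tree_sum_lower_tail (a' a p m' m r : R) : (0 < b)%N ->
  0 < a' -> a' < a -> a < 2 -> 1 < p -> p <= 2 -> 0 < m' -> 0 < m -> 0 <= r ->
  b%:R * r < (b%:R * m) `^ p ->
  (forall v, v != [::] -> (\int[P]_w (g (Wu v w) `^ a')%:E = m'%:E)%E) ->
  (forall v, v != [::] -> (\int[P]_w (g (Wu v w) `^ a)%:E = m%:E)%E) ->
  (forall v, v != [::] -> (\int[P]_w (g (Wu v w) `^ (p * a))%:E = r%:E)%E) ->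
  exists c K : R, [/\ 0 < c, 0 < K & forall n u,
    c <= fine (P [set w | K * (b%:R * m * (m / m') `^ ((2 - a) / (a - a'))) ^+ n <=
                  tree_sum (fun v => g (Wu v w) `^ 2) (fun=> 1) n u])].
Proof.
move=> b_gt0 a'0 a'a a2 p1 p2 m'0 m0 r0 brm Ea' Ea Ep.
have b0 : 0 < b%:R :> R by rewrite ltr0n.
have bm0 : 0 < b%:R * m by rewrite mulr_gt0.
have mgp e : measurable_fun setT (fun y => g y `^ e).
  by apply: (measurableT_comp (f := fun x : R => x `^ e)) => //; exact: measurable_powR.
(* The normalised [a]-th power: its tree sums have mean 1, and the hypothesis comparing [b r] with
   [(b m)^p] becomes the condition of [tree_sum_moment_bound]. *)
pose gA y := (b%:R * m)^-1 * g y `^ a.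
have mgA : measurable_fun setT gA.
  by apply: measurable_funM => //; exact: measurable_cst.
have gA0 y : 0 <= gA y by rewrite mulr_ge0 ?powR_ge0// invr_ge0 ltW.
have mgW (h : R -> R) v : measurable_fun setT h -> measurable_fun setT (fun w => h (Wu v w)).
  by move=> mh; apply: measurableT_comp.
have EgA v : v != [::] -> (\int[P]_w (gA (Wu v w))%:E = (b%:R^-1)%:E)%E.
  move=> v0; under eq_integral do rewrite EFinM.
  rewrite ge0_integralZl_EFin//.
  - by rewrite Ea// -EFinM; congr EFin; field; rewrite !gt_eqF.
  - by move=> w _; rewrite lee_fin powR_ge0.
  - by apply/measurable_EFinP; exact: (mgW (fun y => g y `^ a)).
  - by rewrite invr_ge0 ltW.
have EgAp v : v != [::] ->
    (\int[P]_w (gA (Wu v w) `^ p)%:E = (((b%:R * m) `^ p)^-1 * r)%:E)%E.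
  move=> v0.
  rewrite (eq_integral (fun w => ((((b%:R * m) `^ p)^-1)%:E *
      (g (Wu v w) `^ (p * a))%:E)%E)); last first.
    move=> w _; rewrite -EFinM; congr EFin.
    rewrite /gA [LHS]powRM ?powR_ge0 ?invr_ge0 ?(ltW bm0)// -powRrM [a * p]mulrC.
    by rewrite -[(_ * _)^-1]powR_inv1 ?(ltW bm0)// -[(_ `^ -1) `^ p]powRrM mulN1r powRN.
  rewrite ge0_integralZl_EFin//.
  - by rewrite Ep// -EFinM.
  - by move=> w _; rewrite lee_fin powR_ge0.
  - by apply/measurable_EFinP; exact: (mgW (fun y => g y `^ (p * a))).
  - by rewrite invr_ge0 powR_ge0.
have bmp0 : 0 < (b%:R * m) `^ p by rewrite powR_gt0.
have binv0 : 0 <= b%:R^-1 :> R by rewrite invr_ge0 ltW.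
have br1 : b%:R * (((b%:R * m) `^ p)^-1 * r) < 1.
  by rewrite mulrCA mulrC ltr_pdivrMr// mul1r.
have rp0 : 0 <= ((b%:R * m) `^ p)^-1 * r by rewrite mulr_ge0// invr_ge0 ltW.
have [C C0 CP] := tree_sum_moment_bound indW mgA gA0 binv0 (divff (lt0r_neq0 b0))
  p1 p2 br1 rp0 EgA EgAp.
have [c c0 cP] := lower_tail_bound P p1 C0.
pose e := (2 - a) / (a - a').
pose K := (c / 8) `^ e / 4.
have c8 : 0 < c / 8 by rewrite divr_gt0.
have aa'0 : 0 < a - a' by rewrite subr_gt0.
exists (c / 2), K; split; [by rewrite divr_gt0|by rewrite divr_gt0// powR_gt0|].
move=> n u.
have mts (h : R -> R) : measurable_fun setT h ->
    measurable_fun setT (fun w => tree_sum (fun v => h (Wu v w)) (fun=> 1) n u).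
  move=> mh; apply: (measurable_fun_coordsT (J := words_below u)
    (D := [set u | u != [::]]) (X := Wu)).
  exact: measurable_random_tree_sum.
pose Z w := tree_sum (fun v => gA (Wu v w)) (fun=> 1) n u.
pose S w := tree_sum (fun v => g (Wu v w) `^ a') (fun=> 1) n u.
pose Y w := tree_sum (fun v => g (Wu v w) `^ 2) (fun=> 1) n u.
have mZ : measurable_fun setT Z by exact: mts.
have mS : measurable_fun setT S by exact: (mts (fun y => g y `^ a')).
have mY : measurable_fun setT Y by exact: (mts (fun y => g y `^ 2)).
have S0 w : 0 <= S w by apply: tree_sum_ge0 => // v; exact: powR_ge0.
have EZ : (\int[P]_w (Z w)%:E = 1)%E.
  rewrite (integral_tree_sum indW mgA gA0 n u (fun=> ler01) EgA) tree_sum_cst// => _.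
  by rewrite sumr_const card_ord -[LHS]mulr_natl divff ?gt_eqF.
have ES : (\int[P]_w (S w)%:E = ((b%:R * m') ^+ n)%:E)%E.
  rewrite (integral_tree_sum indW (mgp a') (fun y => powR_ge0 _ _) n u (fun=> ler01) Ea').
  rewrite (eq_tree_suml (y := fun=> (b%:R * m') * b%:R^-1)); last first.
    by move=> v; field; rewrite gt_eqF.
  rewrite tree_sumZ tree_sum_cst ?mulr1// => _.
  by rewrite sumr_const card_ord -[LHS]mulr_natl divff ?gt_eqF.
have Z0 w : 0 <= Z w by exact: tree_sum_ge0.
(* By Markov's inequality the tree sum of [a']-th powers exceeds [B] with probability at most
   [c / 2], half of the probability supplied by the lower tail of [Z]. *)
pose B := 2 / c * (b%:R * m') ^+ n.
have m'n0 : 0 < (b%:R * m') ^+ n by rewrite exprn_gt0// mulr_gt0.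
have B0 : 0 < B by rewrite mulr_gt0// divr_gt0.
have cZ := cP Z mZ Z0 EZ (CP n u).
have PS : fine (P [set w | B <= S w]) <= c / 2.
  apply: le_trans (markov_bound mS S0 _ B0) _; first by rewrite ES.
  rewrite /B invfM mulrCA divff ?gt_eqF// mulr1 invf_div; lra.
set Q := (m / m') `^ e.
have mle (h k : T -> R) : measurable_fun setT h -> measurable_fun setT k ->
    measurable [set w | h w <= k w].
  by move=> mh mk; rewrite -[X in measurable X]setTI; apply: measurable_fun_ler.
have mcst (k : R) : measurable_fun [set: T] (fun=> k) by exact: measurable_cst.
have /le_trans : c <= fine (P [set w | K * (b%:R * m * Q) ^+ n <= Y w]) +
    fine (P [set w | B <= S w]).
  apply: le_trans cZ _; apply: probability_subU; [exact: mle|exact: mle|exact: mle|].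
  move=> w /= Zw; have [BS|SB] := leP B (S w); [by right|left].
  (* The interpolation threshold for which [k^(a-a') * B = (b m)^n / 4]. On the good event the left
     side of the interpolation is at least [(b m)^n / 2], so the sum of squares must supply the
     other [(b m)^n / 4]. *)
  pose k := (c / 8 * (m / m') ^+ n) `^ (a - a')^-1.
  have mm'0 : 0 < m / m' by rewrite divr_gt0.
  have k0 : 0 < k by rewrite powR_gt0// mulr_gt0// exprn_gt0.
  have kE : k `^ (a - a') = c / 8 * (m / m') ^+ n.
    by rewrite -powRrM mulVf ?gt_eqF// powRr1// mulr_ge0 ?exprn_ge0 ?ltW.
  have k2 : k `^ (2 - a) = (c / 8) `^ e * Q ^+ n.
    rewrite -powRrM [_^-1 * _]mulrC -/e powRM ?exprn_ge0 ?ltW//.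
    by rewrite -[_ ^+ n]powR_mulrn ?(ltW mm'0)// powRAC powR_mulrn// powR_ge0.
  have := tree_sum_powR_interpolation n u (fun v => g0 (Wu v w)) a'0 (ltW a'a) (ltW a2) k0.
  have -> : tree_sum (fun v => g (Wu v w) `^ a) (fun=> 1) n u = (b%:R * m) ^+ n * Z w.
    rewrite /Z tree_sumZ mulrA -exprMn divff ?gt_eqF// expr1n mul1r//.
  rewrite -/(S w) -/(Y w) kE -opprB powRN k2 => h.
  have h1 : c / 8 * (m / m') ^+ n * S w <= (b%:R * m) ^+ n / 4.
    apply: le_trans (_ : c / 8 * (m / m') ^+ n * B <= _).
      by rewrite ler_wpM2l ?ltW// mulr_gt0// exprn_gt0.
    rewrite /B !exprMn exprVn le_eqVlt; apply/orP; left; apply/eqP; field.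
    by rewrite expf_neq0 ?gt_eqF.
  have h2 : (b%:R * m) ^+ n * (1 / 2) <= (b%:R * m) ^+ n * Z w.
    by rewrite ler_wpM2l// exprn_ge0 ?ltW.
  have D0 : 0 < (c / 8) `^ e * Q ^+ n by rewrite mulr_gt0 ?exprn_gt0 ?powR_gt0.
  have : (b%:R * m) ^+ n / 4 <= ((c / 8) `^ e * Q ^+ n)^-1 * Y w by lra.
  rewrite [X in _ <= X -> _]mulrC ler_pdivlMr// => h3.
  apply: le_trans h3; rewrite /K [X in _ * X]exprMn; lra.
by move=> /(_ (fine (P [set w | K * (b%:R * m * Q) ^+ n <= Y w]) + c / 2));
  rewrite lerD2l => /(_ PS); lra.
Qed.

End square_sum.

Section freezing_events.
Context d (T : measurableType d) (R : realType) (P : probability T R).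
Context (I : choiceType) (D : set I) (X : I -> {RV P >-> R}).
Hypothesis indX : mutually_independent D X.

(** A lower bound on conditional probabilities, integrated over [A] by freezing the coordinates in
    [J1]. The event [B] is a set of pairs precisely so that the two roles of the outcome can be told
    apart. *)
Lemma freezing_event (J1 J2 : set I) (A : set T) (B : set (T * T)) (c : R) :
  (forall i, D i -> J1 i -> J2 i -> False) ->
  measurable (A : set (coords D X J1)) ->
  measurable (B : set (coords D X J1 * coords D X J2)%type) -> 0 <= c ->
  (forall w, A w -> c <= fine (P [set w' | B (w, w')])) ->
  c * fine (P A) <= fine (P [set w | A w /\ B (w, w)]).
Proof.
move=> J12 mA mB c0 cB.
have mAT : measurable A := measurable_coords mA.
have mAB : measurable ((A `*` setT) `&` B : set (coords D X J1 * coords D X J2)%type).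
  by apply: measurableI => //; exact: measurableX.
have mfst : measurable_fun [set: T] (fun w => (w, w) : (coords D X J1 * coords D X J2)%type).
  by apply/measurable_fun_pair; exact: measurable_fun_coords.
have msnd w : measurable_fun [set: T] (fun w' => (w, w') : (coords D X J1 * coords D X J2)%type).
  by apply/measurable_fun_pair; [exact: measurable_cst|exact: measurable_fun_coords].
have mE : measurable [set w | A w /\ B (w, w)].
  rewrite (_ : mkset _ = (fun w => (w, w) : (coords D X J1 * coords D X J2)%type)
      @^-1` ((A `*` setT) `&` B)); last first.
    by apply/seteqP; split=> w /=; tauto.
  by rewrite -[X in measurable X]setTI; exact: mfst.
have mB2 w : measurable [set w' | B (w, w')].
  by rewrite -[X in measurable X]setTI; exact: msnd.
have mPhi : measurable_fun [set: (coords D X J1 * coords D X J2)%type]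
    (fun z => (\1_((A `*` setT) `&` B) (z.1, z.2))%:E : \bar R).
  apply/measurable_EFinP; rewrite (_ : (fun _ => _) = \1_((A `*` setT) `&` B)).
    exact: measurable_indic.
  by apply/funext => -[].
have E1 : P [set w | A w /\ B (w, w)] =
    (\int[P]_w \int[P]_w' (\1_((A `*` setT) `&` B) (w, w'))%:E)%E.
  rewrite -(freezing indX J12 (Phi := fun w w' => (\1_((A `*` setT) `&` B) (w, w'))%:E)).
  - rewrite -[in LHS](setIT [set w | _]) -(integral_indic P measurableT mE).
    apply: eq_integral => w _; congr EFin; rewrite !indicE.
    by apply/congr1/congr1; apply/idP/idP; rewrite !inE/=; tauto.
  - exact: mPhi.
  - by move=> w w'; rewrite lee_fin.
rewrite -lee_fin fineK ?fin_num_measure// E1 EFinM fineK ?fin_num_measure//.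
rewrite -[X in (_ * P X)%E](setIT A) -(integral_indic P measurableT mAT).
rewrite -ge0_integralZl_EFin//; last by apply/measurable_EFinP; exact: measurable_indic.
have inner w : (\int[P]_w' (\1_((A `*` setT) `&` B) (w, w'))%:E =
    (\1_A w)%:E * P [set w' | B (w, w')])%E.
  rewrite -[X in (_ * P X)%E](setIT [set w' | _]) -(integral_indic P measurableT (mB2 w)).
  rewrite -ge0_integralZl_EFin//; last by apply/measurable_EFinP; exact: measurable_indic.
  apply: eq_integral => w' _; rewrite -EFinM; congr EFin; rewrite !indicE -natrM mulnb.
  by congr (nat_of_bool _)%:R; apply/idP/andP; rewrite !inE/=; tauto.
apply: ge0_le_integral => //.
- by move=> w _; rewrite mule_ge0.
- by apply/measurable_EFinP; apply: measurable_funM => //; exact: measurable_indic.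
- apply: (measurable_fun_coordsT (J := J1) (D := D) (X := X)).
  apply: (measurable_freezing (J1 := J1) (J2 := J2)
    (Phi := fun w w' => (\1_((A `*` setT) `&` B) (w, w'))%:E)); last first.
    by move=> w w'; rewrite lee_fin.
  exact: mPhi.
- move=> w _; rewrite inner indicE; have [/set_mem Aw|_] := boolP (w \in A).
    rewrite mule1 mul1e -[leRHS]fineK ?fin_num_measure// lee_fin.
    exact: cB.
  by rewrite mule0 mul0e.
Qed.

End freezing_events.

(** * Averages of the sine on b-adic intervals *)

Section sine_average.
Context (R : realType) (b : nat).
Hypothesis b_gt1 : (1 < b)%N.
Implicit Types u v : seq 'I_b.

Definition word_left v : R :=
  \sum_(k < size v) (nth 0%N (map val v) k)%:R * b%:R ^- k.+1.

(* Average of [y |-> sin (2 * pi * y)] on the b-adic interval coded by [v]. *)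
Definition sine_average v : R :=
  b%:R ^+ size v * (cos (2 * pi * word_left v) -
    cos (2 * pi * (word_left v + b%:R ^- size v))) / (2 * pi).

Let b_gt0 : 0 < b%:R :> R. Proof. by rewrite ltr0n ltnW. Qed.
Let bN0 : b%:R != 0 :> R. Proof. by rewrite gt_eqF. Qed.
Let pi2_gt0 : 0 < 2 * pi :> R. Proof. by rewrite mulr_gt0// pi_gt0. Qed.

Lemma word_left_rcons v i :
  word_left (rcons v i) = word_left v + (i : nat)%:R * b%:R ^- (size v).+1.
Proof.
rewrite /word_left size_rcons big_ord_recr/= map_rcons nth_rcons size_map ltnn eqxx.
congr (_ + _); apply: eq_bigr => k _.
by rewrite nth_rcons size_map ltn_ord.
Qed.

Lemma word_left_cat u v :
  word_left (u ++ v) = word_left u + b%:R ^- size u * word_left v.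
Proof.
elim/last_ind: v => [|v i IH]; first by rewrite cats0 /word_left [X in _ * X]big_ord0 mulr0 addr0.
rewrite -rcons_cat !word_left_rcons IH size_cat mulrDr addrA; congr (_ + _).
by rewrite mulrCA -addnS exprD invfM.
Qed.

(** Multiplying by the power of [b] turns the endpoint into an integer, that is, into whole periods:
    this is why a prefix of length [n] disappears from [sin (2 pi b^n x)]. *)
Lemma word_left_natE v : exists m : nat, b%:R ^+ size v * word_left v = m%:R.
Proof.
elim/last_ind: v => [|v i [m IH]]; first by exists 0%N; rewrite /word_left big_ord0 mulr0.
exists (b * m + i)%N; rewrite word_left_rcons size_rcons exprS mulrDr -mulrA IH.
by rewrite natrD natrM; congr (_ + _); rewrite mulrCA divff ?mulr1// mulf_neq0 ?expf_neq0.
Qed.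

(** The children of [v] cut its interval into adjacent pieces, over which the cosine differences
    telescope. *)
Lemma sum_sine_average v : \sum_(i < b) b%:R^-1 * sine_average (rcons v i) = sine_average v.
Proof.
pose h : R := b%:R ^- (size v).+1.
pose f (k : nat) : R := - cos (2 * pi * (word_left v + k%:R * h)).
transitivity (b%:R ^+ size v / (2 * pi) * \sum_(0 <= k < b) (f k.+1 - f k)).
  rewrite big_mkord mulr_sumr; apply: eq_bigr => i _.
  rewrite /sine_average word_left_rcons size_rcons -/h /f.
  rewrite (_ : word_left v + i.+1%:R * h = word_left v + i%:R * h + h); last first.
    by rewrite -natr1; ring.
  rewrite exprS; move: (cos _) (cos _) => A B; have := pi2_gt0.
  by move: (2 * pi) => q q0; field; rewrite bN0 gt_eqF.
have bh : b%:R * h = b%:R ^- size v by rewrite /h exprS invfM mulrA divff// mul1r.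
rewrite telescope_sumr// /f mul0r addr0 bh /sine_average.
by rewrite opprK addrC mulrAC.
Qed.

Lemma ler_norm_sine_average v : `|sine_average v| <= 1.
Proof.
rewrite /sine_average; set h : R := b%:R ^- size v.
have h0 : 0 < h by rewrite invr_gt0 exprn_gt0.
pose m := 2 * pi * (word_left v + h / 2).
have -> : cos (2 * pi * word_left v) - cos (2 * pi * (word_left v + h)) =
    2 * (sin m * sin (pi * h)).
  rewrite (_ : 2 * pi * word_left v = m - pi * h); last by rewrite /m; field.
  rewrite (_ : 2 * pi * (word_left v + h) = m + pi * h); last by rewrite /m; field.
  by rewrite cosB cosD; ring.
rewrite !normrM [`|(2 * pi)^-1|]gtr0_norm ?invr_gt0// ler_pdivrMr// mul1r.
rewrite (_ : b%:R ^+ size v = h^-1); last by rewrite /h invrK.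
have hV : `|h^-1| = h^-1 by rewrite gtr0_norm// invr_gt0.
rewrite hV normr_nat.
rewrite mulrC ler_pdivrMr// -mulrA ler_pM2l//.
apply: le_trans (_ : 1 * `|pi * h| <= _).
  by rewrite ler_pM// ?sin_max// ler_norm_sin.
by rewrite mul1r ger0_norm// mulr_ge0 ?pi_ge0// ltW.
Qed.

Lemma sine_average_nil : sine_average [::] = 0.
Proof.
rewrite /sine_average /word_left big_ord0 expr0 invr1 add0r mulr0 mulr1 cos0.
by rewrite [2 * pi]mulrC mulr_natr cos2pi subrr mulr0 mul0r.
Qed.

(** [1 - cos (2 pi / b)] is twice the square of [sin (pi / b)], positive since [b >= 2]. This keeps
    the rooted variables from degenerating, uniformly in the depth. *)
Lemma sine_average_first_gt0 : 0 < sine_average [:: Ordinal (ltnW b_gt1)].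
Proof.
rewrite /sine_average /word_left/= big_ord_recl big_ord0/= !mul0r addr0 mulr0 cos0 add0r.
have b2 : 2 <= b%:R :> R by rewrite ler_nat.
have p0 := @pi_gt0 R.
have : 0 < sin (2 * pi * b%:R^-1 / 2 : R).
  rewrite (_ : 2 * pi * b%:R^-1 / 2 = pi / b%:R); last first.
    by move: (pi) => q; field.
  by rewrite sin_gt0_pi// divr_gt0//= ltr_pdivrMr// ltr_pMr//; lra.
rewrite expr1 subr1_cos; move: (sin _) => s s0.
by rewrite divr_gt0// mulr_gt0// mulr_gt0// exprn_gt0.
Qed.

Lemma tree_sum_sine_average N k u : (N <= size u)%N ->
  tree_sum (fun=> b%:R^-1) (fun v => sine_average (drop N v)) k u =
  sine_average (drop N u).
Proof.
elim: k u => //= k IH u Nu; rewrite -[RHS]sum_sine_average; apply: eq_bigr => i _.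
by rewrite IH ?size_rcons ?leqW// drop_rcons.
Qed.

End sine_average.

Section affine_deviation.
Context d (T : measurableType d) (R : realType) (P : probability T R).

(** [t * (f - m)] is the difference of [f * t + s] and its mean, and the absolute value of that mean
    is at most the mean of the absolute value. *)
Lemma affine_deviation (f : T -> R) (t s : R) : P.-integrable setT (EFin \o f) ->
  `|t| * (\int[P]_w `|f w - \int[P]_z f z|) <= 2 * \int[P]_w `|f w * t + s|.
Proof.
move=> if_; set m := \int[P]_z f z.
have i1 (c : R) : P.-integrable setT (EFin \o cst c).
  exact: finite_measure_integrable_cst.
have ift : P.-integrable setT (EFin \o (fun w => f w * t)).
  exact: (integrableZr measurableT t if_).
have ia : P.-integrable setT (EFin \o (fun w => f w * t + s)).
  exact: (integrableD measurableT ift (i1 s)).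
have ina : P.-integrable setT (EFin \o (fun w => `|f w * t + s|)).
  exact: (integrable_norm ia).
have ifm : P.-integrable setT (EFin \o (fun w => f w - m)).
  exact: (integrableB measurableT if_ (i1 m)).
have ind : P.-integrable setT (EFin \o (fun w => `|f w - m|)).
  exact: (integrable_norm ifm).
have mE : `|m * t + s| <= \int[P]_w `|f w * t + s|.
  have -> : m * t + s = \int[P]_w (f w * t + s).
    by rewrite (RintegralD measurableT ift (i1 s)) Rintegral_cst1 RintegralZr.
  exact: le_normr_Rintegral.
rewrite -RintegralZl//.
apply: le_trans (_ : \int[P]_w (`|f w * t + s| + `|m * t + s|) <= _).
  apply: le_Rintegral => //.
  - exact: (integrableZl measurableT _ ind).
  - exact: (integrableD measurableT ina (i1 `|m * t + s|)).
  move=> w _; rewrite -normrM.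
  rewrite (_ : t * (f w - m) = (f w * t + s) - (m * t + s)); last by ring.
  exact: ler_normB.
rewrite (RintegralD measurableT ina (i1 `|m * t + s|)) Rintegral_cst1; lra.
Qed.

End affine_deviation.

Section sine_sums.
Context (R : realType) (b : nat) d (T : measurableType d) (P : probability T R).
Context (Wu : seq 'I_b -> {RV P >-> R}).
Hypothesis indW : mutually_independent [set u | u != [::]] Wu.
Hypothesis b_gt1 : (1 < b)%N.
Context (g : R -> R).
Hypotheses (mg : measurable_fun setT g) (g0 : forall y, 0 <= g y).
Hypothesis Eg : forall v, v != [::] -> (\int[P]_w (g (Wu v w))%:E = (b%:R^-1)%:E)%E.

Local Notation meas J f :=
  (measurable_fun [set: coords [set u | u != [::]] Wu J] f).

(** [sine_average (drop N v)] is the average of [sin (2 pi b^N x)] over the interval of [v]. This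
    includes words shorter than [N]: nothing remains after the drop, and the interval consists of
    whole periods. *)
Definition sine_sum N k u w : R :=
  tree_sum (fun v => g (Wu v w)) (fun v => sine_average R (drop N v)) k u.

Let mass k u w := tree_sum (fun v => g (Wu v w)) (fun=> 1) k u.

Let b_gt0 : 0 < b%:R :> R. Proof. by rewrite ltr0n ltnW. Qed.

Lemma measurable_sine_sum N k u : meas (words_below u) (sine_sum N k u).
Proof. exact: measurable_random_tree_sum. Qed.

Lemma measurable_sine_sumT N k u : measurable_fun [set: T] (sine_sum N k u).
Proof. exact: measurable_fun_coordsT (@measurable_sine_sum N k u). Qed.

Lemma sum_inv_arity (i : seq 'I_b) : \sum_(j < b) b%:R^-1 = 1 :> R.
Proof. by rewrite sumr_const card_ord -[LHS]mulr_natl divff ?gt_eqF. Qed.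

Let Emass k u : (\int[P]_w (mass k u w)%:E = 1)%E.
Proof.
rewrite (integral_tree_sum indW mg g0 k u (fun=> ler01) Eg) tree_sum_cst//.
exact: sum_inv_arity.
Qed.

Let mmass k u : measurable_fun setT (mass k u).
Proof.
apply: (measurable_fun_coordsT (J := words_below u)
  (D := [set u | u != [::]]) (X := Wu)).
exact: measurable_random_tree_sum.
Qed.

Let imass k u : P.-integrable setT (EFin \o mass k u).
Proof.
apply: Rintegral_fine => //; last by rewrite Emass ltry.
by move=> w; exact: tree_sum_ge0.
Qed.

Lemma ler_norm_sine_sum N k u w :
  `|sine_sum N k u w| <= tree_sum (fun v => g (Wu v w)) (fun=> 1) k u.
Proof. by apply: ler_norm_tree_sum => // v; exact: ler_norm_sine_average. Qed.

Lemma integrable_sine_sum N k u : P.-integrable setT (EFin \o sine_sum N k u).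
Proof.
apply: le_integrable (imass k u) => //.
  by apply/measurable_EFinP; exact: measurable_sine_sumT.
move=> w _ /=; rewrite lee_fin; apply: le_trans (ler_norm_sine_sum _ _ _ _) _.
exact: ler_norm.
Qed.

Lemma Rintegral_sine_sum N k u : (N <= size u)%N ->
  \int[P]_w sine_sum N k u w = sine_average R (drop N u).
Proof.
(* Adding 1 makes the leaf function nonnegative, as [integral_tree_sum] requires; the mass, of mean
   1, is subtracted afterwards. *)
move=> Nu; pose F (v : seq 'I_b) : R := sine_average R (drop N v) + 1.
have F0 v : 0 <= F v.
  by have := ler_norm_sine_average R b_gt1 (drop N v); rewrite ler_norml /F; lra.
have : \int[P]_w (tree_sum (fun v => g (Wu v w)) F k u) =
    sine_average R (drop N u) + 1.
  rewrite /Rintegral (integral_tree_sum indW mg g0 k u F0 Eg)/=.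
  rewrite tree_sum_addr tree_sum_sine_average// tree_sum_cst//.
  exact: sum_inv_arity.
under eq_Rintegral do rewrite tree_sum_addr.
rewrite (RintegralD measurableT (integrable_sine_sum N k u) (imass k u)).
rewrite (_ : \int[P]_w mass k u w = 1); last by rewrite /Rintegral Emass.
by move/addIr.
Qed.

(** The sum is affine in the weight of the child [rcons u i0], with slope the sine sum [A] of that
    child. Averaging over this one weight leaves a multiple of [|A|], and [E|A|] is at least
    [|E A|], the positive average of the sine on the leftmost subinterval. The depth is a successor
    so that this weight exists. *)
Lemma sine_sum_deviation (dev : R) N k u : size u = N ->
  (forall v, v != [::] -> dev <= \int[P]_w `|g (Wu v w) - b%:R^-1|) ->
  dev / 2 * sine_average R [:: Ordinal (ltnW b_gt1)] <= \int[P]_w `|sine_sum N k.+1 u w|.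
Proof.
move=> uN devP; set i0 := Ordinal _.
(* All weights but one are frozen, so [A] and [B] become constants in the inner integral. *)
pose J1 := [set v | v != rcons u i0]; pose J2 := [set rcons u i0].
pose A w := sine_sum N k (rcons u i0) w.
pose B w := \sum_(i < b | i != i0) g (Wu (rcons u i) w) * sine_sum N k (rcons u i) w.
have u0 : rcons u i0 != [::] by case: (u).
have mA : meas J1 A.
  apply: measurable_coords_sub (@measurable_sine_sum N k (rcons u i0)).
  by move=> v [_]; rewrite /J1/=; apply: contraTneq => ->; rewrite ltnn.
have mB : meas J1 B.
  rewrite /B (_ : (fun w => _) = (fun w => \sum_(i < b)
      if i != i0 then g (Wu (rcons u i) w) * sine_sum N k (rcons u i) w else 0)).
    apply: measurable_sum => i; have [->|ii0] := eqVneq i i0.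
      exact: measurable_cst.
    apply: measurable_coords_sub (@measurable_branch _ _ _ _ _ Wu g _ k u i mg).
    move=> v vi; rewrite /J1/=; apply/eqP => vi0; apply: (words_from_neq ii0 vi).
    by rewrite vi0; exact: prefix_refl.
  by apply/funext => w; rewrite big_mkcond.
have mG : meas J2 (fun w => g (Wu (rcons u i0) w)) by exact: measurable_weight.
have mAT := measurable_fun_coordsT mA.
have mBT := measurable_fun_coordsT mB.
have mGT := measurable_fun_coordsT mG.
pose Phi w w' := `|g (Wu (rcons u i0) w') * A w + B w|%:E.
have E : (\int[P]_w `|sine_sum N k.+1 u w|%:E = \int[P]_w \int[P]_w' Phi w w')%E.
  rewrite -(freezing indW (J1 := J1) (J2 := J2)).
  - by apply: eq_integral => w _; rewrite /sine_sum/= (bigD1 i0).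
  - by move=> v _ + vi; rewrite /J1/= vi eqxx.
  - apply/measurable_EFinP; apply: measurableT_comp => //.
    apply: measurable_funD; last exact: measurable_coords_fst.
    apply: measurable_funM; last exact: measurable_coords_fst.
    exact: (measurable_coords_snd (f := fun w => g (Wu (rcons u i0) w))).
  - by move=> w w'; rewrite lee_fin.
have mPhi : measurable_fun setT (fun w => \int[P]_w' Phi w w')%E.
  apply: (measurable_fun_coordsT (J := J1) (D := [set u | u != [::]]) (X := Wu)).
  apply: (measurable_freezing (J1 := J1) (J2 := J2) (Phi := Phi)).
  - apply/measurable_EFinP; apply: measurableT_comp => //.
    apply: measurable_funD; last exact: measurable_coords_fst.
    apply: measurable_funM; last exact: measurable_coords_fst.
    exact: (measurable_coords_snd (f := fun w => g (Wu (rcons u i0) w))).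
  - by move=> w w'; rewrite lee_fin.
have ig : P.-integrable setT (EFin \o (fun w => g (Wu (rcons u i0) w))).
  by apply: Rintegral_fine => //; rewrite Eg// ltry.
have Egf : \int[P]_w g (Wu (rcons u i0) w) = b%:R^-1 by rewrite /Rintegral Eg.
have iA : P.-integrable setT (EFin \o A) by exact: integrable_sine_sum.
have inA : P.-integrable setT (EFin \o (fun w => `|A w|)) by exact: (integrable_norm iA).
have iS : P.-integrable setT (EFin \o (fun w => `|sine_sum N k.+1 u w|)).
  exact: (integrable_norm (integrable_sine_sum N k.+1 u)).
rewrite -lee_fin -(integrable_Rintegral iS) E.
have inner w : ((dev / 2 * `|A w|)%:E <= \int[P]_w' Phi w w')%E.
  have iga : P.-integrable setT (EFin \o (fun w' => g (Wu (rcons u i0) w') * A w + B w)).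
    have icB : P.-integrable setT (EFin \o cst (B w)).
      exact: finite_measure_integrable_cst.
    have igt : P.-integrable setT (EFin \o (fun w' => g (Wu (rcons u i0) w') * A w)).
      exact: (integrableZr measurableT (A w) ig).
    exact: (integrableD measurableT igt icB).
  have inga : P.-integrable setT (EFin \o (fun w' => `|g (Wu (rcons u i0) w') * A w + B w|)).
    exact: (integrable_norm iga).
  rewrite /Phi (integrable_Rintegral inga) lee_fin.
  have := affine_deviation (A w) (B w) ig; rewrite Egf.
  have : `|A w| * dev <= `|A w| * \int[P]_w `|g (Wu (rcons u i0) w) - b%:R^-1|.
    by rewrite ler_wpM2l// devP.
  lra.
have dev0 : 0 <= dev \/ dev <= 0 by case: (leP 0 dev) => [|/ltW]; [left|right].
have s0 := sine_average_first_gt0 R b_gt1.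
case: dev0 => [dev0|dev0]; last first.
  apply: le_trans (_ : 0 <= _)%E.
    rewrite lee_fin mulr_le0_ge0 ?(ltW s0)//; lra.
  by apply: integral_ge0 => w _; apply: integral_ge0 => w' _; rewrite lee_fin.
apply: (@le_trans _ _ (\int[P]_w (dev / 2 * `|A w|)%:E)%E).
  have idA : P.-integrable setT (EFin \o (fun w => dev / 2 * `|A w|)).
    exact: (integrableZl measurableT _ inA).
  rewrite (integrable_Rintegral idA) lee_fin RintegralZl// ler_wpM2l//; first lra.
  have <- : \int[P]_w A w = sine_average R [:: i0].
    rewrite Rintegral_sine_sum ?size_rcons ?uN//.
    by rewrite -cats1 drop_size_cat.
  apply: le_trans (ler_norm _) _.
  exact: le_normr_Rintegral.
apply: ge0_le_integral => //.
- by move=> w _; rewrite lee_fin mulr_ge0//; lra.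
- apply/measurable_EFinP; apply: measurable_funM => //.
  exact: measurableT_comp.
Qed.

End sine_sums.

(** * Anticoncentration *)

Section anticoncentration.
Context (R : realType) (b : nat) d (T : measurableType d) (P : probability T R).
Context (Wu : seq 'I_b -> {RV P >-> R}).
Hypothesis indW : mutually_independent [set u | u != [::]] Wu.
Hypothesis b_gt1 : (1 < b)%N.
Context (g : R -> R).
Hypotheses (mg : measurable_fun setT g) (g0 : forall y, 0 <= g y).
Hypothesis Eg : forall v, v != [::] -> (\int[P]_w (g (Wu v w))%:E = (b%:R^-1)%:E)%E.

Local Notation meas J f :=
  (measurable_fun [set: coords [set u | u != [::]] Wu J] f).
Local Notation D := [set u : seq 'I_b | u != [::]].

Let b_gt0 : 0 < b%:R :> R. Proof. by rewrite ltr0n ltnW. Qed.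

Let measurable_le (h f : T -> R) : measurable_fun setT h -> measurable_fun setT f ->
  measurable [set w | h w <= f w].
Proof. by move=> mh mf; rewrite -[X in measurable X]setTI; apply: measurable_fun_ler. Qed.

(** The rooted variables meet the conditions of [charfun_sqr_small] with common constants: they are
    centred because a word of length [N] spans one full period, and they are dominated by the mass
    below [u], whose [p]-th moments are bounded. *)
Lemma charfun_sine_sum (p r dev : R) : 1 < p -> p <= 2 -> 0 <= r -> b%:R * r < 1 ->
  (forall v, v != [::] -> (\int[P]_w (g (Wu v w) `^ p)%:E = r%:E)%E) -> 0 < dev ->
  (forall v, v != [::] -> dev <= \int[P]_w `|g (Wu v w) - b%:R^-1|) ->
  exists c s0 : R, [/\ 0 < c, 0 < s0 & forall N k u, size u = N ->
    forall s, `|s| <= s0 ->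
    charfun_sqr P (sine_sum Wu g N k.+1 u) s <= expR (- (c * s ^+ 2))].
Proof.
move=> p1 p2 r0 br Ep dev0 devP.
have binv0 : 0 <= b%:R^-1 :> R by rewrite invr_ge0 ltW.
have [C C0 CP] := tree_sum_moment_bound indW mg g0 binv0
  (divff (lt0r_neq0 b_gt0)) p1 p2 br r0 Eg Ep.
pose c1 := dev / 2 * sine_average R [:: Ordinal (ltnW b_gt1)].
have c10 : 0 < c1 by rewrite mulr_gt0 ?sine_average_first_gt0// divr_gt0.
have [c [s0 [c0 s00 H]]] := charfun_sqr_small P p1 p2 c10 C0.
exists c, s0; split => // N k u uN s ss0; apply: H => //.
- exact: measurable_sine_sumT.
- by rewrite Rintegral_sine_sum ?uN// -uN drop_size sine_average_nil.
- exact: sine_sum_deviation.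
- apply: le_trans (CP k.+1 u); apply: ge0_le_integral => //.
  + apply/measurable_EFinP; apply: (measurableT_comp (f := fun x : R => x `^ p)).
      exact: measurable_powR.
    by apply: measurableT_comp => //; exact: measurable_sine_sumT.
  + apply/measurable_EFinP; apply: (measurableT_comp (f := fun x : R => x `^ p)).
      exact: measurable_powR.
    apply: (measurable_fun_coordsT (J := words_below u) (D := D) (X := Wu)).
    exact: measurable_random_tree_sum.
  + move=> w _; rewrite lee_fin ge0_ler_powR ?nnegrE//; first lra.
      exact: tree_sum_ge0.
    exact: ler_norm_sine_sum.
Qed.

Lemma measurable_weighted_sine_sum x N k n u :
  meas (words_below u) (fun w => tree_sum x (fun v => sine_sum Wu g N k v w) n u).
Proof.
apply: (@measurable_tree_sum R b _ (coords D Wu (words_below u))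
  (fun v w => x v) (fun v w => sine_sum Wu g N k v w) n u) => [v _ _|v uv _].
  exact: measurable_cst.
apply: measurable_coords_sub (@measurable_sine_sum _ _ _ _ _ Wu g mg N k v).
move=> v' [vv' sv]; split; first exact: prefix_trans uv vv'.
by apply: leq_ltn_trans sv; exact: size_prefix.
Qed.

Lemma measurable_weighted_branch x N k n u i :
  meas (words_from (rcons u i)) (fun w => x (rcons u i) *
    tree_sum x (fun v => sine_sum Wu g N k v w) n (rcons u i)).
Proof.
apply: measurable_funM; first exact: measurable_cst.
apply: measurable_coords_sub (@measurable_weighted_sine_sum x N k n (rcons u i)).
exact: words_below_from.
Qed.

(** Independent branches multiply the bounds, and the exponents add up to the tree sum of squares.
    The frequency reaching a leaf is [l] times the product of its weights; the constraint on the
    whole sum keeps it within [s0]. *)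
Lemma charfun_weighted_sine_sum (c s0 : R) N k : 0 < s0 ->
  (forall u, size u = N -> forall s, `|s| <= s0 ->
    charfun_sqr P (sine_sum Wu g N k u) s <= expR (- (c * s ^+ 2))) ->
  forall x n u l, (size u + n)%N = N ->
  l ^+ 2 * tree_sum (fun v => x v ^+ 2) (fun=> 1) n u <= s0 ^+ 2 ->
  charfun_sqr P (fun w => tree_sum x (fun v => sine_sum Wu g N k v w) n u) l <=
  expR (- (c * (l ^+ 2 * tree_sum (fun v => x v ^+ 2) (fun=> 1) n u))).
Proof.
move=> s00 H x; elim=> [|n IH] u l uN /= ls.
  rewrite addn0 in uN; rewrite mulr1 in ls *; apply: H => //.
  rewrite leNgt; apply/negP => sl; move: ls; apply/negP; rewrite -ltNge.
  by rewrite -[l ^+ 2]real_normK ?num_real// ltr_sqr ?nnegrE// ltW.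
rewrite (charfun_sqr_sum indW (J := fun i => words_from (rcons u i))
  (f := fun i w => x (rcons u i) *
    tree_sum x (fun v => sine_sum Wu g N k v w) n (rcons u i))).
- rewrite -[leRHS](_ : \prod_(i < b) expR (- (c * ((l * x (rcons u i)) ^+ 2 *
      tree_sum (fun v => x v ^+ 2) (fun=> 1) n (rcons u i)))) = _).
    apply: ler_prod => i _; apply/andP; split; first by rewrite addr_ge0 ?sqr_ge0.
    rewrite charfun_sqrZ; apply: IH; first by rewrite size_rcons addSnnS.
    apply: le_trans ls; rewrite exprMn -mulrA ler_wpM2l ?sqr_ge0//.
    rewrite (bigD1 i)//= lerDl; apply: sumr_ge0 => j _.
    by rewrite mulr_ge0 ?sqr_ge0//; apply: tree_sum_ge0 => // v; exact: sqr_ge0.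
  rewrite -expR_sum; congr expR; rewrite sumrN; congr (- _).
  rewrite -mulr_sumr; congr (_ * _); rewrite mulr_sumr.
  by apply: eq_bigr => i _; rewrite exprMn mulrA.
- exact: index_enum_uniq.
- by move=> i j ij v _; exact: words_from_neq.
- by move=> i; exact: measurable_weighted_branch.
Qed.

Lemma weighted_sine_sum_anticoncentration (c s0 : R) N k : 0 < c -> 0 < s0 ->
  (forall u, size u = N -> forall s, `|s| <= s0 ->
    charfun_sqr P (sine_sum Wu g N k u) s <= expR (- (c * s ^+ 2))) ->
  forall x n u (rho y : R), (size u + n)%N = N -> 0 < rho ->
  rho ^+ 2 <= tree_sum (fun v => x v ^+ 2) (fun=> 1) n u ->
  (1 - expR (- (c * s0 ^+ 2 / 2))) / 4 <=
  fine (P [set w | (1 - expR (- (c * s0 ^+ 2 / 2))) / (2 * s0) * rho <=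
    `|tree_sum x (fun v => sine_sum Wu g N k v w) n u - y|]).
Proof.
move=> c0 s00 H x n u rho y uN rho0 rhoY.
set Y := tree_sum _ _ _ _ in rhoY; set q := expR _.
have Y0 : 0 < Y by apply: lt_le_trans rhoY; rewrite exprn_gt0.
have sY0 : 0 < Num.sqrt Y by rewrite sqrtr_gt0.
(* The largest frequency that the constraint allows. The squared characteristic function is then at
   most [exp (- c s0^2) = q^2] whatever [Y], and the radius is chosen so that its product with [l]
   is at most [(1 - q) / 2]. *)
pose l := s0 / Num.sqrt Y.
have lY : l ^+ 2 * Y = s0 ^+ 2.
  by rewrite /l exprMn exprVn sqr_sqrtr ?(ltW Y0)// mulfVK// gt_eqF.
have q1 : q < 1.
  by rewrite expR_lt1 oppr_lt0 divr_gt0// mulr_gt0// exprn_gt0.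
have mD : measurable_fun setT (fun w => tree_sum x (fun v => sine_sum Wu g N k v w) n u).
  exact: measurable_fun_coordsT (@measurable_weighted_sine_sum x N k n u).
have r0 : 0 <= (1 - q) / (2 * s0) * rho.
  by rewrite mulr_ge0 ?(ltW rho0)// divr_ge0 ?mulr_ge0 ?(ltW s00)//; lra.
have l0 : 0 <= l by rewrite divr_ge0 ?ltW.
have cf : charfun_sqr P (fun w => tree_sum x (fun v => sine_sum Wu g N k v w) n u) l <= q ^+ 2.
  apply: le_trans (charfun_weighted_sine_sum s00 H uN _) _; first by rewrite lY.
  by rewrite lY /q -expRM_natl ler_expR; lra.
apply: le_trans (charfun_sqr_concentration y mD l0 (expR_ge0 _) r0 cf).
have : l * ((1 - q) / (2 * s0) * rho) <= (1 - q) / 2.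
  have rs : rho <= Num.sqrt Y.
    rewrite -(@ler_sqr R) ?nnegrE ?(ltW rho0) ?(ltW sY0)//.
    by rewrite sqr_sqrtr ?(ltW Y0).
  have -> : l * ((1 - q) / (2 * s0) * rho) = (1 - q) / 2 * (rho / Num.sqrt Y).
    rewrite /l; move: (Num.sqrt Y) (1 - q) sY0 => z e z0.
    by field; rewrite !gt_eqF.
  by rewrite ler_piMr ?divr_ge0//; [lra|rewrite ler_pdivrMr// mul1r].
rewrite -/q; lra.
Qed.

(** The outcome is split by level: [z.1] supplies the weights of the first [n] levels below [u],
    [z.2] those of the rooted variables. *)
Lemma measurable_joint_tree_sum J1 J2 N k n u (t y : R) :
  words_below u `&` [set v | (size v <= size u + n)%N] `<=` J1 ->
  words_below u `&` [set v | (size u + n < size v)%N] `<=` J2 ->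
  measurable ([set z : T * T | t <=
    `|tree_sum (fun v => g (Wu v z.1)) (fun v => sine_sum Wu g N k v z.2) n u - y|]
    : set (coords D Wu J1 * coords D Wu J2)%type).
Proof.
move=> uJ1 uJ2; rewrite -[X in measurable X]setTI; apply: measurable_fun_ler => //.
apply: measurableT_comp => //; apply: measurable_funB; last exact: measurable_cst.
elim: n u uJ1 uJ2 => [|n IH] u uJ1 uJ2 /=.
  apply: (measurable_coords_snd (f := sine_sum Wu g N k u)).
  apply: measurable_coords_sub (@measurable_sine_sum _ _ _ _ _ Wu g mg N k u).
  by move=> v [uv sv]; apply: uJ2; rewrite /words_below/= addn0; exact: (conj (conj uv sv) sv).
apply: measurable_sum => i; apply: measurable_funM.
  apply: (measurable_coords_fst (f := fun w => g (Wu (rcons u i) w))).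
  apply: measurable_weight => //; last by case: (u).
  apply: uJ1; split; last by rewrite /= size_rcons addnS ltnS leq_addr.
  by split; [exact: prefix_rcons|rewrite size_rcons].
apply: IH => v [/words_below_rcons uv]; rewrite /= size_rcons addSnnS => sv.
  exact: uJ1.
exact: uJ2.
Qed.

(** The weights down to level [N] are frozen and play the part of [x]; the bound for deterministic
    weights applies on the event that their sum of squares is at least [t], which depends on these
    levels only. *)
Lemma sine_sum_anticoncentration (c1 k1 k2 t : R) N k n : 0 <= k2 -> 0 < t ->
  (forall u, c1 <= fine (P [set w | t <=
     tree_sum (fun v => g (Wu v w) `^ 2) (fun=> 1) n u])) ->
  (forall x u (rho y : R), (size u + n)%N = N -> 0 < rho ->
    rho ^+ 2 <= tree_sum (fun v => x v ^+ 2) (fun=> 1) n u ->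
    k2 <= fine (P [set w | k1 * rho <=
      `|tree_sum x (fun v => sine_sum Wu g N k v w) n u - y|])) ->
  forall u y, (size u + n)%N = N ->
  k2 * c1 <= fine (P [set w | k1 * Num.sqrt t <= `|sine_sum Wu g N (n + k) u w - y|]).
Proof.
move=> k20 t0 HY HD u y uN.
pose J1 : set (seq 'I_b) := [set v | (size v <= N)%N].
pose J2 : set (seq 'I_b) := [set v | (N < size v)%N].
pose A := [set w | t <= tree_sum (fun v => g (Wu v w) `^ 2) (fun=> 1) n u].
pose B := [set z : T * T | k1 * Num.sqrt t <=
  `|tree_sum (fun v => g (Wu v z.1)) (fun v => sine_sum Wu g N k v z.2) n u - y|].
have J12 v : D v -> J1 v -> J2 v -> False.
  by move=> _; rewrite /J1 /J2/= leqNgt => /negP.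
have mg2 : measurable_fun setT (fun z => g z `^ 2).
  by apply: (measurableT_comp (f := fun x : R => x `^ 2)) => //; exact: measurable_powR.
have mA : measurable (A : set (coords D Wu J1)).
  rewrite -[X in measurable X]setTI; apply: measurable_fun_ler => //.
  have gen u' m' : (size u' + m' <= N)%N ->
      meas J1 (fun w => tree_sum (fun v => g (Wu v w) `^ 2) (fun=> 1) m' u').
    elim: m' u' => [|m' IH] u' um; first exact: measurable_cst.
    apply: measurable_sum => i; apply: measurable_funM.
      apply: (@measurable_weight _ _ _ _ _ _ (fun z => g z `^ 2)) => //; last by case: (u').
      by rewrite /J1/= size_rcons; apply: leq_trans um; rewrite addnS ltnS leq_addr.
    by apply: IH; rewrite size_rcons addSnnS.
  by apply: gen; rewrite uN.
have mB : measurable (B : set (coords D Wu J1 * coords D Wu J2)%type).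
  by apply: measurable_joint_tree_sum => v [_]; rewrite uN.
have HA w : A w -> k2 <= fine (P [set w' | B (w, w')]).
  move=> Aw; apply: (HD (fun v => g (Wu v w)) u (Num.sqrt t) y) => //; first by rewrite sqrtr_gt0.
  rewrite sqr_sqrtr ?(ltW t0)//; apply: le_trans Aw _.
  by rewrite le_eqVlt; apply/orP; left; apply/eqP;
    apply: eq_tree_suml => v; rewrite powR_mulrn.
apply: le_trans (_ : k2 * fine (P A) <= _); first by rewrite ler_wpM2l ?HY.
apply: le_trans (freezing_event indW J12 mA mB k20 HA) _.
have mS : measurable [set w | k1 * Num.sqrt t <= `|sine_sum Wu g N (n + k) u w - y|].
  apply: measurable_le; first exact: measurable_cst.
  apply: measurableT_comp => //; apply: measurable_funB; last exact: measurable_cst.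
  exact: measurable_sine_sumT.
rewrite (_ : [set w | A w /\ B (w, w)] = A `&` [set w | k1 * Num.sqrt t <=
    `|sine_sum Wu g N (n + k) u w - y|]); last first.
  have e w : B (w, w) = (k1 * Num.sqrt t <= `|sine_sum Wu g N (n + k) u w - y|) :> Prop.
    by rewrite /B/= /sine_sum tree_sumD.
  apply/seteqP; split=> w [Aw Bw].
    by apply: (conj Aw); rewrite /= -e.
  by apply: (conj Aw); rewrite e.
have mAT : measurable A := measurable_coords mA.
rewrite fine_le ?fin_num_measure//; first exact: measurableI.
by rewrite le_measure ?inE//; first exact: measurableI.
Qed.

(* The largest child carries at least a fraction [1 / b] of the mass, and the
   remaining children are independent of it. *)
Lemma sine_sum_anticoncentration_cut (c ka : R) N l x m : 0 <= c ->
  (forall v, 0 <= x v) -> 0 < ka ->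
  forall n u (eta : R), (size u + m + n)%N = N ->
  (forall v y, (size v + n)%N = N ->
    c <= fine (P [set w | ka <= `|sine_sum Wu g N l v w - y|])) ->
  0 < eta -> eta * b%:R ^+ m <= tree_sum x (fun=> 1) m u ->
  forall y, c <= fine (P [set w | eta * ka <=
    `|tree_sum x (fun v => sine_sum Wu g N l v w) m u - y|]).
Proof.
move=> c0 x0 ka0 n; elim: m => [|m IH] u eta uN H eta0 etab y.
  have e1 : eta <= 1 by move: etab; rewrite /= expr0 mulr1.
  apply: le_trans (H u y _) _; first by rewrite addn0 in uN.
  have m1 z : measurable [set w | z <= `|sine_sum Wu g N l u w - y|].
    apply: measurable_le; first exact: measurable_cst.
    apply: measurableT_comp => //; apply: measurable_funB; last exact: measurable_cst.
    exact: measurable_sine_sumT.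
  rewrite fine_le ?fin_num_measure// le_measure ?inE//.
  by move=> w /=; apply: le_trans; rewrite ler_piMl// ltW.
have [i xi] : exists i : 'I_b, eta * b%:R ^+ m <=
    x (rcons u i) * tree_sum x (fun=> 1) m (rcons u i).
  apply/existsP; rewrite -[X in is_true X]negbK negb_exists; apply/negP => /forallP h.
  move: etab; apply/negP; rewrite -ltNge /= exprS.
  rewrite (_ : eta * (b%:R * b%:R ^+ m) = \sum_(i < b) eta * b%:R ^+ m); last first.
    by rewrite sumr_const card_ord -[RHS]mulr_natl mulrCA.
  apply: ltr_sum => [|i _]; last by have := h i; rewrite -ltNge.
  by apply/hasP; exists (Ordinal (ltnW b_gt1)); rewrite ?mem_index_enum.
have etam : 0 < eta * b%:R ^+ m by rewrite mulr_gt0// exprn_gt0.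
have xi0 : 0 < x (rcons u i).
  rewrite lt_neqAle eq_sym x0 andbT; apply/eqP => xi0.
  by move: xi; rewrite xi0 mul0r leNgt etam.
pose J1 : set (seq 'I_b) := ~` words_from (rcons u i).
pose J2 : set (seq 'I_b) := words_from (rcons u i).
pose Di w := tree_sum x (fun v => sine_sum Wu g N l v w) m (rcons u i).
pose Rest w := \sum_(j < b | j != i) x (rcons u j) *
  tree_sum x (fun v => sine_sum Wu g N l v w) m (rcons u j).
pose B := [set z : T * T | eta * ka <= `|x (rcons u i) * Di z.2 + Rest z.1 - y|].
have J12 v : D v -> J1 v -> J2 v -> False by move=> _ h /h.
have mR : meas J1 Rest.
  rewrite (_ : Rest = (fun w => \sum_(j < b) if j != i then x (rcons u j) *
      tree_sum x (fun v => sine_sum Wu g N l v w) m (rcons u j) else 0)).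
    apply: measurable_sum => j; have [_|ji] := eqVneq j i; first exact: measurable_cst.
    apply: measurable_coords_sub (@measurable_weighted_branch x N l m u j).
    by move=> v vj vi; exact: words_from_neq ji vj vi.
  by apply/funext => w; rewrite /Rest big_mkcond.
have mD : meas J2 Di.
  apply: measurable_coords_sub (@measurable_weighted_sine_sum x N l m (rcons u i)).
  exact: words_below_from.
have mB : measurable (B : set (coords D Wu J1 * coords D Wu J2)%type).
  rewrite -[X in measurable X]setTI; apply: measurable_fun_ler => //.
  apply: measurableT_comp => //; apply: measurable_funB; last exact: measurable_cst.
  apply: measurable_funD; last exact: measurable_coords_fst.
  by apply: measurable_funM; [exact: measurable_cst|exact: measurable_coords_snd].
have HA w : setT w -> c <= fine (P [set w' | B (w, w')]).
  move=> _.
  have -> : [set w' | B (w, w')] = [set w' | eta / x (rcons u i) * ka <=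
      `|Di w' - (y - Rest w) / x (rcons u i)|].
    apply/funext => w'; apply/propext; rewrite /B/=.
    rewrite (_ : x (rcons u i) * Di w' + Rest w - y =
      x (rcons u i) * (Di w' - (y - Rest w) / x (rcons u i))); last first.
      by field; rewrite gt_eqF.
    rewrite normrM (gtr0_norm xi0) mulrAC ler_pdivrMr//.
    by rewrite [X in _ <-> is_true (_ <= X)]mulrC.
  apply: IH => //.
  - by rewrite size_rcons -uN addSnnS.
  - by rewrite divr_gt0.
  - by rewrite mulrAC ler_pdivrMr// [leRHS]mulrC.
have := freezing_event indW J12 (@measurableT _ (coords D Wu J1)) mB c0 HA.
rewrite [P setT]probability_setT mulr1; move/le_trans; apply.
rewrite le_eqVlt; apply/orP; left; apply/eqP; congr (fine (P _)).
by apply/seteqP; split=> w /=; rewrite /B/= (bigD1 i)//=; case.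
Qed.

(** Both [C] and the mass at level [m] are determined by the first [m] levels. Once these are
    frozen, the previous bound applies with the realised weights and the target point 0. *)
Lemma sine_sum_anticoncentration_event (c ka eta : R) m n l N (C : set T) :
  0 <= c -> 0 < ka -> (m + n)%N = N ->
  (forall v y, (size v + n)%N = N ->
    c <= fine (P [set w | ka <= `|sine_sum Wu g N l v w - y|])) ->
  0 < eta ->
  measurable (C : set (coords D Wu [set v | (size v <= m)%N])) ->
  c * fine (P (C `&` [set w | eta * b%:R ^+ m <=
      tree_sum (fun v => g (Wu v w)) (fun=> 1) m [::]])) <=
  fine (P (C `&` [set w | eta * ka <= `|sine_sum Wu g N (m + l) [::] w|])).
Proof.
move=> c0 ka0 mnN H eta0 mC.
pose J1 : set (seq 'I_b) := [set v | (size v <= m)%N].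
pose J2 : set (seq 'I_b) := [set v | (m < size v)%N].
pose A := C `&` [set w | eta * b%:R ^+ m <=
      tree_sum (fun v => g (Wu v w)) (fun=> 1) m [::]].
pose B := [set z : T * T | eta * ka <=
  `|tree_sum (fun v => g (Wu v z.1)) (fun v => sine_sum Wu g N l v z.2) m [::] - 0|].
have J12 v : D v -> J1 v -> J2 v -> False.
  by move=> _; rewrite /J1 /J2/= leqNgt => /negP.
have mA : measurable (A : set (coords D Wu J1)).
  apply: measurableI => //.
  rewrite -[X in measurable X]setTI; apply: measurable_fun_ler => //.
  have gen u m' : (size u + m' <= m)%N ->
      meas J1 (fun w => tree_sum (fun v => g (Wu v w)) (fun=> 1) m' u).
    elim: m' u => [|m' IH] u um; first exact: measurable_cst.
    apply: measurable_sum => i; apply: measurable_funM.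
      apply: measurable_weight => //; last by case: (u).
      by rewrite /J1/= size_rcons; apply: leq_trans um; rewrite addnS ltnS leq_addr.
    by apply: IH; rewrite size_rcons addSnnS.
  exact: gen.
have mB : measurable (B : set (coords D Wu J1 * coords D Wu J2)%type).
  by apply: measurable_joint_tree_sum => v [].
have HA w : A w -> c <= fine (P [set w' | B (w, w')]).
  by move=> [_ Aw]; exact: (@sine_sum_anticoncentration_cut c ka N l _ m c0
    (fun v => g0 (Wu v w)) ka0 n [::] eta mnN H eta0 Aw 0).
apply: le_trans (freezing_event indW J12 mA mB c0 HA) _.
have mCT : measurable C := measurable_coords mC.
have mS : measurable [set w | eta * ka <= `|sine_sum Wu g N (m + l) [::] w|].
  apply: measurable_le; first exact: measurable_cst.
  by apply: measurableT_comp => //; exact: measurable_sine_sumT.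
rewrite (_ : [set w | A w /\ B (w, w)] = A `&` [set w | eta * ka <= `|sine_sum Wu g N (m + l) [::] w|]); last first.
  have e w : B (w, w) = (eta * ka <= `|sine_sum Wu g N (m + l) [::] w|) :> Prop.
    by rewrite /B/= /sine_sum tree_sumD subr0.
  apply/seteqP; split=> w [Aw Bw].
    by apply: (conj Aw); rewrite /= -e.
  by apply: (conj Aw); rewrite e.
have mAT : measurable A := measurable_coords mA.
rewrite fine_le ?fin_num_measure//; [exact: measurableI|exact: measurableI|].
rewrite le_measure ?inE//; [exact: measurableI|exact: measurableI|].
by apply: setSI; exact: subIsetl.
Qed.

End anticoncentration.

(** * Recurrence along finite-level events *)

Section recurrence.
Context d (T : measurableType d) (R : realType) (P : probability T R).
Local Notation pr A := (fine (P A)).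

Let pr_le (A B : set T) : measurable A -> measurable B -> A `<=` B -> pr A <= pr B.
Proof. by move=> mA mB AB; rewrite fine_le ?fin_num_measure// le_measure ?inE. Qed.

Let pr_setD (A B : set T) : measurable A -> measurable B -> B `<=` A ->
  pr (A `\` B) = pr A - pr B.
Proof.
move=> mA mB BA; rewrite measureD//; last by rewrite (le_lt_trans (probability_le1 _ _))// ltry.
by rewrite (setIidr BA) fineB ?fin_num_measure.
Qed.

Lemma nondecreasing_approx (F : (set T)^nat) (e : R) : (forall j, measurable (F j)) ->
  nondecreasing_seq F -> 0 < e -> exists j, pr (\bigcup_j F j) - e <= pr (F j).
Proof.
move=> mF ndF e0.
have mUF : measurable (\bigcup_j F j) by exact: bigcup_measurable.
have h : P \o F @ \oo --> (pr (\bigcup_j F j))%:E.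
  by rewrite fineK ?fin_num_measure//; exact: nondecreasing_cvg_mu.
move/fine_cvg : h => /cvgrPdist_le/(_ e e0)[j _ /(_ j (leqnn j))] /=.
rewrite ler_norml => /andP[_ h]; exists j; move: h; lra.
Qed.

Lemma nonincreasing_approx (F : (set T)^nat) (e : R) : (forall j, measurable (F j)) ->
  nonincreasing_seq F -> 0 < e -> exists j, pr (F j) <= pr (\bigcap_j F j) + e.
Proof.
move=> mF ndF e0.
have mIF : measurable (\bigcap_j F j) by exact: bigcap_measurable.
have F0 : (P (F 0%N) < +oo)%E by rewrite (le_lt_trans (probability_le1 _ _))// ltry.
have h : P \o F @ \oo --> (pr (\bigcap_j F j))%:E.
  by rewrite fineK ?fin_num_measure//; exact: nonincreasing_cvg_mu.
move/fine_cvg : h => /cvgrPdist_le/(_ e e0)[j _ /(_ j (leqnn j))] /=.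
rewrite ler_norml => /andP[h _]; exists j; move: h; lra.
Qed.

Context (E : nat -> nat -> set T) (S : set T) (c : R).
Hypotheses (mE : forall n k, measurable (E n k)) (mS : measurable S).
Hypotheses (c0 : 0 < c) (c1 : c <= 1).

(** The order of the quantifiers reflects the use: [n] is a frequency and [k] a depth of truncation,
    large depending on [n]. The slack [e] is what makes the property pass to monotone limits. *)
Definition asymptotically_hit (A : set T) := measurable A /\
  forall e : R, 0 < e -> exists n0, forall n, (n0 <= n)%N ->
  exists k0, forall k, (k0 <= k)%N -> c * pr (A `&` S) - e <= pr (A `&` E n k).

Lemma asymptotically_hit_bigcup (F : (set T)^nat) :
  (forall j, asymptotically_hit (F j)) -> nondecreasing_seq F ->
  asymptotically_hit (\bigcup_j F j).
Proof.
move=> hF ndF; have mF j : measurable (F j) by case: (hF j).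
have mUF : measurable (\bigcup_j F j) by exact: bigcup_measurable.
split=> // e e0; have e2 : 0 < e / 2 by rewrite divr_gt0.
have [j jE] : exists j, pr ((\bigcup_j F j) `&` S) - e / 2 <= pr (F j `&` S).
  rewrite setI_bigcupl; apply: nondecreasing_approx => //.
    by move=> j; exact: measurableI.
  move=> i j ij; apply/subsetPset; apply: setSI; exact/subsetPset/ndF.
have [_ /(_ _ e2)[n0 n0P]] := hF j.
exists n0 => n nn; have [k0 k0P] := n0P n nn; exists k0 => k kk.
have := k0P k kk.
have : pr (F j `&` E n k) <= pr ((\bigcup_j F j) `&` E n k).
  apply: pr_le; [exact: measurableI|exact: measurableI|].
  by apply: setSI; exact: bigcup_sup.
have : c * (pr ((\bigcup_j F j) `&` S) - pr (F j `&` S)) <= e / 2.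
  have [h|h] := leP 0 (pr ((\bigcup_j F j) `&` S) - pr (F j `&` S)).
    by apply: le_trans (ler_piMl h c1) _; lra.
  by apply: le_trans (ltW e2); rewrite nmulr_lle0// ltW.
lra.
Qed.

Lemma asymptotically_hit_bigcap (F : (set T)^nat) :
  (forall j, asymptotically_hit (F j)) -> nonincreasing_seq F ->
  asymptotically_hit (\bigcap_j F j).
Proof.
move=> hF niF; have mF j : measurable (F j) by case: (hF j).
have mIF : measurable (\bigcap_j F j) by exact: bigcap_measurable.
split=> // e e0; have e2 : 0 < e / 2 by rewrite divr_gt0.
have [j jE] := nonincreasing_approx mF niF e2.
have [_ /(_ _ e2)[n0 n0P]] := hF j.
exists n0 => n nn; have [k0 k0P] := n0P n nn; exists k0 => k kk.
have := k0P k kk.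
have IFj : \bigcap_j F j `<=` F j by exact: bigcap_inf.
have : c * pr ((\bigcap_j F j) `&` S) <= c * pr (F j `&` S).
  rewrite ler_wpM2l ?(ltW c0)//; apply: pr_le; [exact: measurableI|exact: measurableI|].
  exact: setSI.
have : pr (F j `&` E n k) <= pr ((\bigcap_j F j) `&` E n k) + pr (F j `\` \bigcap_j F j).
  apply: probability_subU; [exact: measurableI|exact: measurableI|exact: measurableD|].
  move=> w [Fw Ew]; have [Iw|Iw] := pselect ((\bigcap_j F j) w); first by left.
  by right.
rewrite pr_setD//; lra.
Qed.

(* The avoiding set [A] is a monotone limit of asymptotically hit sets, hence
   asymptotically hit, but it misses [E n k] for all large [n] and then all large
   [k]; so [c * pr (A `&` S) <= 0]. *)
Lemma avoiding_null (M : nat) :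
  (forall N K K', asymptotically_hit [set w | forall n k, (M <= n < M + N)%N ->
     (K <= k < K + K')%N -> ~ E n k w]) ->
  P ([set w | forall N, exists K, forall K' n k, (M <= n < M + N)%N ->
     (K <= k < K + K')%N -> ~ E n k w] `&` S) = 0%E.
Proof.
move=> hG; pose G N K K' := [set w | forall n k, (M <= n < M + N)%N ->
     (K <= k < K + K')%N -> ~ E n k w].
(* [G] involves finite ranges of [n] and [k] only, while [B] says that for every [n >= M] the event
   [E n k] fails for all large [k]. *)
pose B := \bigcap_N \bigcup_K \bigcap_K' G N K K'.
have -> : [set w | forall N, exists K, forall K' n k, (M <= n < M + N)%N ->
     (K <= k < K + K')%N -> ~ E n k w] = B.
  apply/seteqP; split=> w /= h.
    by move=> N _; have [K KP] := h N; exists K => // K' _; exact: KP.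
  by move=> N; have [K _ KP] := h N I; exists K => K'; exact: KP.
have [mB hB] : asymptotically_hit B.
  apply: asymptotically_hit_bigcap => [N|N N' NN'].
    apply: asymptotically_hit_bigcup => [K|K L KL].
      apply: asymptotically_hit_bigcap => [K'|K' L' KL']; first exact: hG.
      apply/subsetPset => w h n k nN /andP[Kk kL]; apply: h => //.
      by rewrite Kk (leq_trans kL)// leq_add2l.
    apply/subsetPset => w h K' _ n k nN /andP[Lk kL].
    apply: (h (L - K + K')%N I) => //; rewrite (leq_trans KL Lk)/=.
    by rewrite addnA subnKC.
  apply/subsetPset => w [K _ h]; exists K => // K' _ n k /andP[Mn nN].
  by apply: (h K' I); rewrite Mn (leq_trans nN)// leq_add2l.
have mBS : measurable (B `&` S) by exact: measurableI.
suff : pr (B `&` S) <= 0.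
  move=> h; have : pr (B `&` S) = 0 by apply/eqP; rewrite eq_le h fine_ge0.
  by move=> h0; rewrite -[LHS]fineK ?fin_num_measure// h0.
apply/ler_addgt0Pl => e e0; rewrite addr0.
have ce : 0 < c * e / 2 by rewrite divr_gt0// mulr_gt0.
have [n0 n0P] := hB _ ce.
pose n := maxn n0 M.
have [k0 k0P] := n0P n (leq_maxl _ _).
(* The outcomes of [B] outside [E n k] for all [k >= j]. They increase to [B], so for [k] large
   [E n k] meets [B] with arbitrarily small probability. *)
pose H j := \bigcap_(k in [set k | (j <= k)%N]) (B `&` ~` E n k).
have mH j : measurable (H j).
  by apply: bigcap_measurableType => k _; apply: measurableI => //; exact: measurableC.
have BH : B `<=` \bigcup_j H j.
  move=> w Bw; have [K _ KP] := Bw (n - M).+1 I.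
  exists K => // k /= Kk; split=> // Ew.
  apply: (KP (k - K).+1 I n k _ _ Ew); first by rewrite leq_maxr addnS ltnS subnKC ?leqnn ?leq_maxr.
  by rewrite Kk addnS ltnS subnKC ?leqnn.
have ndH : nondecreasing_seq H.
  move=> i j ij; apply/subsetPset => w h k jk; apply: h; exact: leq_trans ij jk.
have [j jP] := nondecreasing_approx mH ndH ce.
have mUH : measurable (\bigcup_j H j) by exact: bigcup_measurable.
pose k := maxn k0 j.
have := k0P k (leq_maxl _ _).
have : pr (B `&` E n k) <= pr B - pr (H j).
  have HB : H j `<=` B by move=> w /(_ j (leqnn j))[].
  rewrite -pr_setD//; apply: pr_le; [exact: measurableI|exact: measurableD|].
  move=> w [Bw Ew]; split=> // /(_ k (leq_maxr _ _))[_]; exact.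
have : pr B <= pr (\bigcup_j H j) by exact: pr_le.
move=> h1 h2 h3.
have : c * pr (B `&` S) <= c * e by lra.
by rewrite ler_pM2l.
Qed.

End recurrence.

(** * The moment function *)

Section chord.
Context (R : realType).

Lemma lipschitz_continuous (f : R -> R) (C : R) : 0 <= C ->
  (forall x y, `|f x - f y| <= C * `|x - y|) -> continuous f.
Proof.
move=> C0 lip x; apply/cvgrPdist_lt => e e0.
have eC : 0 < e / (C + 1) by rewrite divr_gt0//; lra.
near=> t; apply: le_lt_trans (lip x t) _.
have xt : `|x - t| < e / (C + 1) by near: t; exact: cvgr_dist_lt.
apply: le_lt_trans (_ : (C + 1) * `|x - t| < _); last first.
  by rewrite mulrC -ltr_pdivlMr//; lra.
by rewrite ler_wpM2r//; lra.
Unshelve. all: by end_near. Qed.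

(** The retraction onto [1, 2]: composed with it, a function that is Lipschitz on [1, 2] becomes
    continuous on the whole line. *)
Let clamp (x : R) := Num.max 1 (Num.min x 2).

Let clamp_itv x : 1 <= clamp x <= 2.
Proof. by rewrite /clamp /Num.max /Num.min; do ! case: ifPn; rewrite -?leNgt; lra. Qed.

Let clamp_id x : 1 <= x <= 2 -> clamp x = x.
Proof.
move=> /andP[x1 x2]; rewrite /clamp.
by rewrite (min_idPl x2) (max_idPr x1).
Qed.

Let clamp_lip x y : `|clamp x - clamp y| <= 1 * `|x - y|.
Proof.
rewrite mul1r /clamp /Num.max /Num.min.
by do ! case: ifPn; rewrite -?leNgt => *; rewrite ler_norml; case: (ler0P (x - y)); lra.
Qed.

(* The ratio [psi a / a] is minimal at [a0] on [[1, 2]].  A point [a < a0] with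
   [psi a = l * a], [l] slightly above the minimum, has slope about [l] because
   [psi] has no kink, so that the chord ending at [a] meets the abscissa [2] near
   [2 * l]. *)
Lemma chord_extrapolation (psi : R -> R) (C : R) : 0 <= C ->
  (forall x y, 1 <= x <= 2 -> 1 <= y <= 2 -> `|psi x - psi y| <= C * `|x - y|) ->
  (forall a h, 1 <= a <= 2 -> 0 < h <= 1 / 2 -> - (C * h) <= psi a - psi (a - h)) ->
  (forall a h, 1 <= a <= 2 -> 0 < h <= 1 / 2 ->
    psi (a + h) + psi (a - h) - 2 * psi a <= C * h ^+ 2) ->
  psi 1 = 0 -> (exists2 a1, 1 < a1 <= 2 & psi a1 < 0) ->
  forall e, 0 < e -> exists a0 a a' p,
    [/\ 1 <= a0 <= 2, [/\ 1 / 2 <= a', a' < a, 1 <= a & a < 2],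
        1 < p <= 2, psi (p * a) < p * psi a &
        2 * psi a0 / a0 - e <= psi a + (2 - a) * (psi a - psi a') / (a - a')].
Proof.
move=> C0 lip low kink psi1 [a1 a1i a1n] e e0.
pose Psi x := psi (clamp x).
have cPsi : continuous Psi.
  apply: (@lipschitz_continuous _ C C0) => x y.
  apply: le_trans (lip _ _ (clamp_itv x) (clamp_itv y)) _.
  by rewrite ler_wpM2l//; have := clamp_lip x y; rewrite mul1r.
have cclamp : continuous clamp by exact: (@lipschitz_continuous _ 1 ler01 clamp_lip).
have cN : {within `[1, 2], continuous (fun x => Psi x / clamp x)}.
  apply: continuous_subspaceT => x; apply: continuousM; first exact: cPsi.
  apply: continuousV; last exact: cclamp.
  by case/andP: (clamp_itv x) => x1 _; rewrite gt_eqF// (lt_le_trans _ x1).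
have [a0 + a0min] := EVT_min (ler1n R 2) cN.
rewrite in_itv/= => a0i.
pose N := psi a0 / a0.
have a00 : 0 < a0 by lra.
have Nmin x : 1 <= x <= 2 -> N * x <= psi x.
  move=> xi; have := a0min x; rewrite in_itv/= xi => /(_ isT).
  rewrite /Psi !clamp_id// -/N ler_pdivlMr//; lra.
have pa0 : psi a0 = N * a0 by rewrite /N divfK// gt_eqF.
clearbody N; clear a0min cN cclamp.
have N0 : N < 0.
  have /Nmin h : 1 <= a1 <= 2 by lra.
  by nra.
pose h := Num.min (1 / 2) (e / (3 + C)).
have C3 : 0 < 3 + C by lra.
have h0 : 0 < h by rewrite lt_min !divr_gt0.
have h12 : h <= 1 / 2 by rewrite ge_min lexx.
have he : (3 + C) * h <= e.
  by rewrite mulrC -ler_pdivlMr// ge_min lexx orbT.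
clearbody h.
(* [de <= h^2] makes the excess of slope negligible in a difference quotient of step [h], and
   [de <= - N / 2] keeps [l] negative, so that [psi x - l * x] is positive at 1 and negative at
   [a0]. *)
pose de := Num.min (h ^+ 2) (- N / 2).
have de0 : 0 < de by rewrite lt_min exprn_gt0//= divr_gt0// oppr_gt0.
have deh : de <= h ^+ 2 by rewrite ge_min lexx.
have deN : de <= - N / 2 by rewrite ge_min lexx orbT.
clearbody de.
pose l := N + de.
have l0 : l < 0 by rewrite /l; lra.
have a01 : 1 <= a0 by lra.
have cf : {within `[1, a0], continuous (fun x => Psi x - l * x)}.
  apply: continuous_subspaceT => x; apply: continuousB; first exact: cPsi.
  by apply: continuousM; [exact: cvg_cst|exact: cvg_id].
have f1 : Psi 1 - l * 1 = - l by rewrite /Psi clamp_id ?psi1 ?mulr1 ?sub0r ?lexx ?ler1n.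
have f2 : Psi a0 - l * a0 = - (de * a0) by rewrite /Psi clamp_id// pa0 /l; ring.
have dea : 0 < de * a0 by rewrite mulr_gt0.
have [|a] := IVT (v := 0) a01 cf.
  by rewrite f1 f2 ge_min le_max; apply/andP; split; apply/orP; [right|left]; lra.
rewrite in_itv/= => aI.
have ai : 1 <= a <= 2 by lra.
rewrite /Psi clamp_id// => /eqP; rewrite subr_eq0 => /eqP psia.
have aa0 : a < a0.
  rewrite lt_neqAle; apply/andP; split; last by lra.
  by apply/eqP => aE; move: f2 dea; rewrite /Psi clamp_id// -aE psia; lra.
clear Psi cPsi cf f1 f2.
have a0' : 0 < a by lra.
(* With [p = a0 / a], the condition on [p] compares [psi a0 = N * a0] with [p * psi a = l * a0], and
   [N < l]. *)
exists a0, a, (a - h), (a0 / a).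
split=> //; [split; lra| | |].
- apply/andP; split; first by rewrite ltr_pdivlMr// mul1r.
  by rewrite ler_pdivrMr//; lra.
- rewrite divfK ?gt_eqF// psia pa0 (_ : a0 / a * (l * a) = l * a0); last first.
    by field; rewrite gt_eqF.
  by rewrite ltr_pM2r// /l; lra.
rewrite -[X in X - e <= _]mulrA pa0 mulfK ?gt_eqF// opprB addrCA subrr addr0.
have hh : 0 < h <= 1 / 2 by rewrite h0.
have L := low a h ai hh.
have K := kink a h ai hh.
set s := psi a - psi (a - h) in L *.
have a2 : 0 <= 2 - a by lra.
have a21 : 2 - a <= 1 by lra.
have pa : N * a <= psi a by exact: Nmin.
have Na : N * 2 <= N * a by rewrite ler_nM2l//; lra.
(* If [a + h] stays in the interval, minimality bounds the forward increment of [psi] from below by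
   [N * h - de * a], and the bound on second differences passes this on to the backward
   increment. *)
have [ah|ah] := leP (a + h) 2.
  have /Nmin pah : 1 <= a + h <= 2 by lra.
  have sh : N - (2 + C) * h <= s / h.
    rewrite ler_pdivlMr//.
    have : de * a <= h ^+ 2 * 2 by apply: ler_pM => //; lra.
    move: psia; rewrite /l /s expr2 in K *; nra.
  have : (2 - a) * (N - (2 + C) * h) <= (2 - a) * (s / h) by rewrite ler_wpM2l.
  have : (2 - a) * ((2 + C) * h) <= 1 * ((2 + C) * h).
    by rewrite ler_wpM2r// mulr_ge0//; lra.
  rewrite -[X in _ -> _ -> _ <= _ + X]mulrA; nra.
(* Here [2 - a < h], so a crude bound on the slope costs only a multiple of [h]. *)
have sh : - C <= s / h by rewrite ler_pdivlMr//; lra.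
have : (2 - a) * (- C) <= (2 - a) * (s / h) by rewrite ler_wpM2l.
have : (2 - a) * C <= h * C by rewrite ler_wpM2r//; lra.
rewrite -[X in _ -> _ -> _ <= _ + X]mulrA; nra.
Qed.

End chord.

(** * Bounds on real powers, uniform in the exponent *)

Section powR_bounds.
Context (R : realType).
Implicit Types x y a c h : R.

Lemma ler_norm_expR_subr1 y : `|expR y - 1| <= `|y| * (1 + expR y).
Proof.
have e0 := expR_gt0 y.
have h1 := expR_ge1Dx y.
have h2 : 1 - expR y <= - y by lra.
have h3 : expR y - 1 <= y * expR y.
  have := expR_ge1Dx (- y); rewrite expRN => h.
  have : (1 - y) * expR y <= (expR y)^-1 * expR y by rewrite ler_wpM2r// ltW.
  by rewrite mulVf ?gt_eqF//; lra.
have [y0|y0] := leP 0 y.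
  by rewrite (ger0_norm y0) ger0_norm; nra.
by rewrite (ltr0_norm y0) ler_norml; apply/andP; split; nra.
Qed.

Lemma expR_taylor1 y : expR y - 1 - y <= y ^+ 2 * (1 + expR y).
Proof.
have e0 := expR_gt0 y.
have h1 := expR_ge1Dx y.
have h3 : expR y - 1 <= y * expR y.
  have := expR_ge1Dx (- y); rewrite expRN => h.
  have : (1 - y) * expR y <= (expR y)^-1 * expR y by rewrite ler_wpM2r// ltW.
  by rewrite mulVf ?gt_eqF//; lra.
have : y * (expR y - 1) <= y ^+ 2 * (1 + expR y).
  apply: le_trans (ler_norm _) _; rewrite normrM -[y ^+ 2]real_normK ?num_real//.
  by rewrite expr2 -mulrA ler_wpM2l// ler_norm_expR_subr1.
lra.
Qed.

Lemma expR_cosh y : expR y + expR (- y) - 2 <= y ^+ 2 * (expR y + expR (- y)).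
Proof.
have h1 := expR_taylor1 y; have h2 := expR_taylor1 (- y).
have hN : expR y * expR (- y) = 1 by rewrite -expRD subrr expR0.
have e0 := expR_gt0 y; have e1 := expR_gt0 (- y).
have k1 := expR_ge1Dx y; have k2 := expR_ge1Dx (- y).
have E : expR y + expR (- y) - 2 = (expR y - 1) * (1 - expR (- y)) by nra.
rewrite E; apply: le_trans (ler_norm _) _.
rewrite normrM [`|1 - _|]distrC.
have [y0|y0] := leP 0 y.
  have : `|expR y - 1| <= y * expR y.
    rewrite ger0_norm; last by lra.
    have : (1 - y) * expR y <= expR (- y) * expR y by rewrite ler_wpM2r//; lra.
    lra.
  have : `|expR (- y) - 1| <= y by rewrite ler0_norm; [lra|rewrite subr_le0 expR_le1; lra].
  move=> ? ?; have := normr_ge0 (expR (-y) - 1); have := normr_ge0 (expR y - 1); nra.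
have : `|expR (- y) - 1| <= - y * expR (- y).
  rewrite ger0_norm; last by lra.
  have : (1 + y) * expR (- y) <= expR y * expR (- y) by rewrite ler_wpM2r//; lra.
  lra.
have : `|expR y - 1| <= - y by rewrite ler0_norm; [lra|rewrite subr_le0 expR_le1; lra].
move=> ? ?; have := normr_ge0 (expR (-y) - 1); have := normr_ge0 (expR y - 1); nra.
Qed.

(** The envelope [1 + x^5] dominates derivatives of [x^c] in [c]. For [x >= 1] it covers
    [x^3 * x^2]. For [x < 1] it uses [|ln x| <= 8 * x^(-1/8)], whose square costs [x^(-1/4)]: hence
    the lower limit 1/4 on [c] and the constant 64. *)
Lemma powR_ln_bound x c : 0 < x -> 1 / 4 <= c <= 3 ->
  x `^ c * `|ln x| <= 64 * (1 + x ^+ 5) /\ x `^ c * ln x ^+ 2 <= 64 * (1 + x ^+ 5).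
Proof.
move=> x0 /andP[c14 c3].
have x5 : 0 <= x ^+ 5 by rewrite exprn_ge0 ?ltW.
have [x1|x1] := leP 1 x.
  have l0 : 0 <= ln x by exact: ln_ge0.
  have lx : ln x <= x by rewrite ltW// ln_sublinear.
  have xc : x `^ c <= x ^+ 3 by rewrite -powR_mulrn ?(ltW x0)// ler_powR.
  have c0 := powR_ge0 x c.
  have l1 : x `^ c * ln x <= x ^+ 3 * x by exact: ler_pM.
  have l2 : x `^ c * ln x ^+ 2 <= x ^+ 3 * x ^+ 2.
    by rewrite ler_pM ?sqr_ge0// ler_sqr ?nnegrE// ltW.
  have x45 : x ^+ 3 * x <= x ^+ 5.
    by rewrite -exprSr -[leRHS]exprD || (rewrite -exprSr; exact: ler_weXn2l).
  rewrite ger0_norm//; split; first lra.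
  by rewrite -exprD/= in l2; lra.
have lx : `|ln x| <= 8 * x `^ (- (1 / 8)).
  rewrite ler0_norm ?ln_le0 ?(ltW x1)//.
  have := ln_sublinear (powR_gt0 (- (1 / 8)) x0); rewrite ln_powR; lra.
have xp q : 0 <= q -> x `^ q <= 1.
  by move=> q0; rewrite -[leRHS](powRr0 x) ger_powR// x0 ltW.
have c0 := powR_ge0 x c.
have D p q : x `^ p * x `^ q = x `^ (p + q).
  by rewrite powRD//; apply/implyP => _; rewrite gt_eqF.
split.
  apply: le_trans (_ : x `^ c * (8 * x `^ (- (1 / 8))) <= _); first by rewrite ler_wpM2l.
  rewrite mulrCA D; have := xp (c + - (1 / 8)); lra.
rewrite -real_normK ?num_real//.
apply: le_trans (_ : x `^ c * (8 * x `^ (- (1 / 8))) ^+ 2 <= _).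
  by rewrite ler_wpM2l// ler_sqr ?nnegrE// mulr_ge0 ?powR_ge0.
rewrite expr2 mulrACA D (_ : 8 * 8 = 64); last by ring.
rewrite mulrCA D; have := xp (c + (- (1 / 8) + - (1 / 8))); lra.
Qed.

Let powRDexp x a h : 0 < x -> x `^ (a + h) = x `^ a * expR (h * ln x).
Proof.
move=> x0; rewrite powRD; last by apply/implyP => _; rewrite gt_eqF.
by rewrite [x `^ h]/powR gt_eqF.
Qed.

Lemma powR_first_difference x a h : 0 <= x -> 1 / 2 <= a -> a + h <= 5 / 2 -> 0 < h ->
  `|x `^ (a + h) - x `^ a| <= h * (128 * (1 + x ^+ 5)).
Proof.
rewrite le_eqVlt => /predU1P[<- a0 ah h0|x0 a0 ah h0].
  by rewrite !powR0 ?subrr ?normr0 ?gt_eqF ?mulr_ge0 ?addr_ge0 ?exprn_ge0 ?(ltW h0)//; lra.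
have [l1 _] := @powR_ln_bound x a x0 ltac:(lra).
have [l2 _] := @powR_ln_bound x (a + h) x0 ltac:(lra).
rewrite powRDexp// in l2 *.
rewrite -[X in _ - X]mulr1 -mulrBr normrM (ger0_norm (powR_ge0 _ _)).
have := ler_norm_expR_subr1 (h * ln x); rewrite normrM (gtr0_norm h0) => k.
apply: le_trans (ler_wpM2l (powR_ge0 _ _) k) _.
move: l1 l2 (powR_ge0 x a); move: (x `^ a) (expR _) (`|ln x|) (1 + x ^+ 5) => p e l z.
move=> l1 l2 p0.
have -> : p * (h * l * (1 + e)) = h * (p * l + p * e * l) by ring.
by rewrite ler_wpM2l ?(ltW h0)//; lra.
Qed.

Lemma powR_second_difference x a h : 0 <= x -> 1 / 2 <= a - h -> a + h <= 5 / 2 -> 0 < h ->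
  x `^ (a + h) + x `^ (a - h) - 2 * x `^ a <= h ^+ 2 * (128 * (1 + x ^+ 5)).
Proof.
rewrite le_eqVlt => /predU1P[<- a0 ah h0|x0 a0 ah h0].
  rewrite !powR0 ?gt_eqF//; [|lra..].
  by rewrite mulr0 subr0 addr0 !mulr_ge0 ?exprn_ge0 ?addr_ge0 ?(ltW h0).
have [_ l1] := @powR_ln_bound x (a - h) x0 ltac:(lra).
have [_ l2] := @powR_ln_bound x (a + h) x0 ltac:(lra).
rewrite !powRDexp// in l1 l2 *; rewrite mulNr in l1 *.
have := expR_cosh (h * ln x) => k.
have {k} := ler_wpM2l (powR_ge0 x a) k.
move: l1 l2; rewrite ?mulNr.
move: (x `^ a) (expR (h * ln x)) (expR (- (h * ln x))) (1 + x ^+ 5) => p e e' z.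
move: (ln x) => l l1 l2 k.
have -> : p * e + p * e' - 2 * p = p * (e + e' - 2) by ring.
have : h ^+ 2 * (p * e' * l ^+ 2 + p * e * l ^+ 2) <= h ^+ 2 * (128 * z).
  by rewrite ler_wpM2l ?sqr_ge0//; lra.
apply: le_trans; rewrite exprMn in k; lra.
Qed.

Lemma powR_taylor1 x h : 0 <= x -> 0 < h <= 1 ->
  x `^ (1 + h) <= x + h * (x * ln x) + h ^+ 2 * (128 * (1 + x ^+ 5)).
Proof.
rewrite le_eqVlt => /predU1P[<- /andP[h0 _]|x0 /andP[h0 h1]].
  have h1 : 1 + h != 0 by rewrite gt_eqF//; lra.
  by rewrite powR0// !mul0r mulr0 !add0r !mulr_ge0 ?exprn_ge0 ?addr_ge0 ?(ltW h0).
have [_ l1] := @powR_ln_bound x 1 x0 ltac:(lra).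
have [_ l2] := @powR_ln_bound x (1 + h) x0 ltac:(lra).
rewrite powRDexp// in l2 *; rewrite powRr1 ?(ltW x0)// in l1 l2 *.
have k := ler_wpM2l (ltW x0) (expR_taylor1 (h * ln x)).
rewrite exprMn in k.
have : h ^+ 2 * (x * ln x ^+ 2 + x * expR (h * ln x) * ln x ^+ 2) <=
    h ^+ 2 * (128 * (1 + x ^+ 5)).
  by rewrite ler_wpM2l ?sqr_ge0//; lra.
move: k; lra.
Qed.

(** From [exp y >= 1 + y] and [x ln x >= x - 1]. Integrated against a variable of mean 1, the
    right-hand side dominates 1, which is Jensen's inequality for moments of order at least 1. *)
Lemma powR_ge_affine x a : 0 <= x -> 1 <= a -> x + (a - 1) * (x - 1) <= x `^ a.
Proof.
rewrite le_eqVlt => /predU1P[<- a1|x0 a1].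
  have a0 : a != 0 by rewrite gt_eqF//; lra.
  by rewrite powR0//; lra.
have -> : x `^ a = x * expR ((a - 1) * ln x).
  by rewrite -[X in X `^ _]/x -{1}(subrKC 1 a) powRDexp// powRr1// ltW.
have k := ler_wpM2l (ltW x0) (expR_ge1Dx ((a - 1) * ln x)).
apply: le_trans k.
have : x - 1 <= x * ln x.
  have := ln_sublinear; have := le_ln1Dx (x := x^-1 - 1).
  rewrite addrCA subrr addr0 lnV ?posrE// => /(_ ltac:(by rewrite ltrBrDl subrr invr_gt0)).
  move=> k _; have := ler_wpM2l (ltW x0) k; rewrite mulrBr mulfV ?gt_eqF//; lra.
move=> k; have : (a - 1) * (x - 1) <= (a - 1) * (x * ln x) by rewrite ler_wpM2l//; lra.
lra.
Qed.

End powR_bounds.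

Section log_chord.
Context (R : realType) (M : R -> R) (L C : R).
Hypotheses (L0 : 0 < L) (C0 : 0 <= C).
Hypotheses (M_ge1 : forall a, 1 <= a -> 1 <= M a) (M_gt0 : forall a, 0 < a -> 0 < M a).
Hypothesis first_difference : forall a h, 1 / 2 <= a -> a + h <= 5 / 2 -> 0 < h ->
  `|M (a + h) - M a| <= C * h.
Hypothesis second_difference : forall a h, 1 / 2 <= a - h -> a + h <= 5 / 2 -> 0 < h ->
  M (a + h) + M (a - h) - 2 * M a <= C * h ^+ 2.
Hypothesis M1 : M 1 = 1.

Let psi a := (1 - a) * L + ln (M a).

Lemma ln_le_subr1 (x : R) : 0 < x -> ln x <= x - 1.
Proof. by move=> x0; have := @le_ln1Dx R (x - 1); rewrite addrCA subrr addr0; apply; lra. Qed.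

(** Difference bounds pass from [M] to its logarithm through [ln x <= x - 1] applied to ratios,
    where [M >= 1] keeps the denominators away from 0; the linear part of [psi] has no second
    difference. *)
Lemma log_chord : (exists2 a1, 1 < a1 <= 2 & psi a1 < 0) ->
  forall e, 0 < e -> exists a0 a a' p,
    [/\ 1 <= a0 <= 2, [/\ 1 / 2 <= a', a' < a, 1 <= a & a < 2],
        1 < p <= 2, psi (p * a) < p * psi a &
        2 * psi a0 / a0 - e <= psi a + (2 - a) * (psi a - psi a') / (a - a')].
Proof.
move=> neg e e0; pose K := L + C + C ^+ 2.
have LL0 : 0 < L := L0.
have CC0 : 0 <= C := C0.
have K0 : 0 <= K by rewrite /K !addr_ge0 ?sqr_ge0// ltW.
have CK : L + C <= K by rewrite /K lerDl sqr_ge0.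
(* Only a lower bound is sought: [a - h] may be less than 1, where [M] is merely positive, so
   [ln (M (a - h))] is estimated from above alone. *)
have low a h : 1 <= a <= 2 -> 0 < h <= 1 / 2 ->
    - ((L + C) * h) <= psi a - psi (a - h).
  move=> ai hi; have Ma : 1 <= M a by apply: M_ge1; lra.
  have Mh : 0 < M (a - h) by apply: M_gt0; lra.
  have Ma0 : 0 < M a by apply: lt_le_trans Ma.
  have := ln_le_subr1 (divr_gt0 Mh Ma0).
  rewrite ln_div ?posrE//.
  have : M (a - h) / M a - 1 <= C * h.
    have d1 : `|M (a - h + h) - M (a - h)| <= C * h.
      by apply: first_difference; lra.
    rewrite subrK distrC in d1; have := le_trans (ler_norm _) d1 => d2.
    rewrite lerBlDr ler_pdivrMr//.
    have : C * h * 1 <= C * h * M a.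
      by rewrite ler_wpM2l// mulr_ge0//; lra.
    lra.
  rewrite /psi; lra.
apply: (@chord_extrapolation R psi K K0).
- have main x y : 1 <= x <= 2 -> 1 <= y <= 2 -> x < y ->
      `|psi x - psi y| <= K * (y - x).
    move=> xi yi xy.
    have Mx : 1 <= M x by apply: M_ge1; lra.
    have My : 1 <= M y by apply: M_ge1; lra.
    have Mx0 : 0 < M x by apply: lt_le_trans Mx.
    have My0 : 0 < M y by apply: lt_le_trans My.
    have d1 : `|M (x + (y - x)) - M x| <= C * (y - x).
      by apply: first_difference; lra.
    rewrite [x + _]addrC subrK in d1.
    have h1 := ln_le_subr1 (divr_gt0 Mx0 My0).
    have h2 := ln_le_subr1 (divr_gt0 My0 Mx0).
    rewrite ln_div ?posrE// in h1; rewrite ln_div ?posrE// in h2.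
    have t0 : 0 <= C * (y - x) by rewrite mulr_ge0//; lra.
    move: d1; rewrite ler_norml => /andP[d1 d2].
    have g1 : M x / M y - 1 <= C * (y - x).
      by rewrite lerBlDr ler_pdivrMr//; nra.
    have g2 : M y / M x - 1 <= C * (y - x).
      by rewrite lerBlDr ler_pdivrMr//; nra.
    have : (L + C) * (y - x) <= K * (y - x) by rewrite ler_wpM2r//; lra.
    rewrite /psi ler_norml => kk.
    have : 0 <= L * (y - x) by rewrite mulr_ge0 ?(ltW L0)//; lra.
    by move=> ll; apply/andP; split; lra.
  move=> x y xi yi; case: (ltgtP x y) => [xy|yx|->].
  + by rewrite [`|x - y|]distrC (gtr0_norm (_ : 0 < y - x)) ?subr_gt0//; exact: main.
  + by rewrite distrC (gtr0_norm (_ : 0 < x - y)) ?subr_gt0//; exact: main.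
  + by rewrite !subrr normr0 mulr0.
- move=> a h ai hi; apply: le_trans (low a h ai hi).
  by rewrite lerN2 ler_wpM2r//; lra.
- move=> a h ai hi.
  have Ma : 1 <= M a by apply: M_ge1; lra.
  have Ma0 : 0 < M a by apply: lt_le_trans Ma.
  have Mp : 0 < M (a + h) by apply: M_gt0; lra.
  have Mm : 0 < M (a - h) by apply: M_gt0; lra.
  have sd : M (a + h) + M (a - h) - 2 * M a <= C * h ^+ 2.
    by apply: second_difference; lra.
  have Q0 : 0 < M (a + h) * M (a - h) / M a ^+ 2.
    by rewrite divr_gt0 ?mulr_gt0 ?exprn_gt0.
  have := ln_le_subr1 Q0.
  rewrite ln_div ?posrE ?mulr_gt0 ?exprn_gt0// lnM ?posrE// lnXn//.
  have : M (a + h) * M (a - h) / M a ^+ 2 - 1 <= (C + C ^+ 2) * h ^+ 2.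
    rewrite lerBlDr ler_pdivrMr ?exprn_gt0//.
    move: sd Ma; move: (M (a + h)) (M (a - h)) (M a) Mp Mm => p q m p0 q0 sd m1.
    have h2 : h ^+ 2 <= 1 by have /andP[ha hb] := hi; nra.
    have h20 : 0 <= h ^+ 2 by exact: sqr_ge0.
    set t := h ^+ 2 in sd h2 h20 *.
    have Ct0 : 0 <= C * t by rewrite mulr_ge0.
    (* The second difference of [ln M] involves the product of the two outer values, which is at
       most the square of their half-sum. *)
    have pq : p * q <= (m + C * t / 2) ^+ 2.
      have : (p + q) ^+ 2 <= (2 * m + C * t) ^+ 2 by rewrite ler_sqr ?nnegrE; lra.
      have := sqr_ge0 (p - q); nra.
    apply: le_trans pq _.
    have e1 : C * t * m <= C * t * m ^+ 2.
      by rewrite ler_wpM2l// expr2 ler_peMl//; lra.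
    have e2 : C ^+ 2 * t ^+ 2 <= C ^+ 2 * t * m ^+ 2.
      rewrite -mulrA ler_wpM2l ?sqr_ge0// expr2 ler_wpM2l//.
      by apply: le_trans h2 _; nra.
    rewrite [(m + _) ^+ 2](_ : _ = m ^+ 2 + C * t * m + C ^+ 2 * t ^+ 2 / 4); last by field.
    have : 0 <= C ^+ 2 * t ^+ 2 by rewrite mulr_ge0 ?sqr_ge0.
    nra.
  have : (C + C ^+ 2) * h ^+ 2 <= K * h ^+ 2.
    by rewrite ler_wpM2r ?sqr_ge0// /K; lra.
  rewrite /psi; lra.
- by rewrite /psi M1 ln1 subrr mul0r addr0.
- exact: neg.
- exact: e0.
Qed.

End log_chord.

Section moment_function.
Context d (T : measurableType d) (R : realType) (P : probability T R).
Context (f : T -> R) (L : R).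
Hypotheses (mf : measurable_fun setT f) (f0 : forall w, 0 <= f w).
Hypothesis f_moment : forall a, 0 < a -> (\int[P]_w (f w `^ a)%:E < +oo)%E.
Hypothesis f1 : \int[P]_w f w = 1.
Hypothesis fln : \int[P]_w (f w * ln (f w)) < L.
Hypothesis L0 : 0 < L.

Definition moment a : R := \int[P]_w (f w `^ a).

Definition log_moment a : R := (1 - a) * L + ln (moment a).

Let mfp a : measurable_fun setT (fun w => f w `^ a).
Proof. by apply: (measurableT_comp (f := fun x : R => x `^ a)) => //; exact: measurable_powR. Qed.

Lemma integrable_moment a : 0 < a -> P.-integrable setT (EFin \o (fun w => f w `^ a)).
Proof.
by move=> a0; apply: Rintegral_fine => //; [move=> w; exact: powR_ge0|exact: f_moment].
Qed.

Let i1 (c : R) : P.-integrable setT (EFin \o cst c).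
Proof. exact: finite_measure_integrable_cst. Qed.

Let if_ : P.-integrable setT (EFin \o f).
Proof.
rewrite (_ : EFin \o f = EFin \o (fun w => f w `^ 1)); first exact: integrable_moment.
by apply/funext => w /=; rewrite powRr1.
Qed.

Let i5 : P.-integrable setT (EFin \o (fun w => 1 + f w ^+ 5)).
Proof.
have h : P.-integrable setT (EFin \o (fun w => f w `^ 5)) by exact: integrable_moment.
rewrite (_ : (fun w => 1 + f w ^+ 5) = (fun w => 1 + f w `^ 5)).
  exact: (integrableD measurableT (i1 1) h).
by apply/funext => w; rewrite powR_mulrn.
Qed.

Let iZ (c : R) (h : T -> R) : P.-integrable setT (EFin \o h) ->
  P.-integrable setT (EFin \o (fun w => c * h w)).
Proof. by move=> ih; exact: (integrableZl measurableT c ih). Qed.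

Let iD (h k : T -> R) : P.-integrable setT (EFin \o h) -> P.-integrable setT (EFin \o k) ->
  P.-integrable setT (EFin \o (fun w => h w + k w)).
Proof. by move=> ih ik; exact: (integrableD measurableT ih ik). Qed.

Let iB (h k : T -> R) : P.-integrable setT (EFin \o h) -> P.-integrable setT (EFin \o k) ->
  P.-integrable setT (EFin \o (fun w => h w - k w)).
Proof. by move=> ih ik; exact: (integrableB measurableT ih ik). Qed.

Lemma integrable_xlnx : P.-integrable setT (EFin \o (fun w => f w * ln (f w))).
Proof.
apply: le_integrable (iZ 64 i5) => //.
  apply/measurable_EFinP; apply: measurable_funM => //.
  by apply: measurableT_comp => //; exact: measurable_ln.
move=> w _ /=; rewrite lee_fin normrM (ger0_norm (f0 w)).
apply: le_trans (ler_norm _).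
have := f0 w; rewrite le_eqVlt => /predU1P[<-|fw0].
  by rewrite mul0r expr0n/= addr0 mulr1.
have [h _] := @powR_ln_bound R (f w) 1 fw0 ltac:(lra).
by rewrite powRr1 in h.
Qed.

Let C := 128 * \int[P]_w (1 + f w ^+ 5).

Let C0 : 0 <= C.
Proof.
by rewrite mulr_ge0//; apply: Rintegral_ge0 => w _; rewrite addr_ge0 ?exprn_ge0.
Qed.

Lemma moment1 : moment 1 = 1.
Proof. by rewrite -[RHS]f1; apply: eq_Rintegral => w _; rewrite powRr1. Qed.

Lemma moment_ge1 a : 1 <= a -> 1 <= moment a.
Proof.
move=> a1; have : \int[P]_w (f w + (a - 1) * (f w - 1)) <= moment a.
  apply: le_Rintegral => //.
  - exact: (iD if_ (iZ (a - 1) (iB if_ (i1 1)))).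
  - by apply: integrable_moment; lra.
  - by move=> w _; exact: powR_ge_affine.
rewrite (RintegralD measurableT if_ (iZ _ (iB if_ (i1 1)))) RintegralZl//; last exact: (iB if_ (i1 1)).
by rewrite (RintegralB measurableT if_ (i1 1)) f1 Rintegral_cst1 subrr mulr0 addr0.
Qed.

(** For [a < 1], the inequality [2 f <= s f^a + s^-1 f^(2-a)] would give
    [2 <= moment (2 - a) / s < 1] if the moment of order [a] vanished. *)
Lemma moment_gt0 a : 0 < a -> 0 < moment a.
Proof.
move=> a0; have [a1|a1] := leP 1 a.
  by apply: lt_le_trans (moment_ge1 a1).
rewrite lt_neqAle; apply/andP; split; last by apply: Rintegral_ge0 => w _; exact: powR_ge0.
apply/eqP => Ma0.
have M2 : 0 <= moment (2 - a) by apply: Rintegral_ge0 => w _; exact: powR_ge0.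
pose s := moment (2 - a) + 1.
have s0 : 0 < s by rewrite /s; lra.
have ia := integrable_moment a0.
have i2a : P.-integrable setT (EFin \o (fun w => f w `^ (2 - a))).
  by apply: integrable_moment; lra.
have : \int[P]_w (2 * f w) <= \int[P]_w (s * f w `^ a + s^-1 * f w `^ (2 - a)).
  apply: le_Rintegral => //; [exact: iZ|by apply: iD; exact: iZ|].
  move=> w _; have := f0 w; rewrite le_eqVlt => /predU1P[<-|fw0].
    by rewrite mulr0 addr_ge0// mulr_ge0 ?powR_ge0// ?invr_ge0 ltW.
  have E : f w ^+ 2 = f w `^ a * f w `^ (2 - a).
    rewrite -powR_mulrn// -powRD; last by apply/implyP => _; rewrite gt_eqF.
    by congr (_ `^ _); ring.
  have p0 := powR_gt0 a fw0; have q0 := powR_gt0 (2 - a) fw0.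
  move: E p0 q0; move: (f w `^ a) (f w `^ (2 - a)) => x y E x0 y0.
  rewrite -subr_ge0 -(pmulr_rge0 _ s0) mulrBr mulrDr [s * (s^-1 * _)]mulrA divff ?gt_eqF// mul1r.
  rewrite -(pmulr_rge0 _ x0).
  have := sqr_ge0 (s * x - f w).
  by rewrite (_ : x * _ = (s * x - f w) ^+ 2)//; rewrite sqrrB E; ring.
rewrite (RintegralD measurableT (iZ s ia) (iZ s^-1 i2a)) !RintegralZl// f1 -/(moment a) -Ma0.
rewrite -/(moment (2 - a)) mulr0 add0r mulr1.
apply/negP; rewrite -ltNge mulrC ltr_pdivrMr//; rewrite /s; lra.
Qed.

Let CE c : C * c = \int[P]_w (c * (128 * (1 + f w ^+ 5))).
Proof.
rewrite (RintegralZl _ measurableT (iZ 128 i5)) (RintegralZl _ measurableT i5).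
by rewrite mulrC.
Qed.

Let first_difference a h : 1 / 2 <= a -> a + h <= 5 / 2 -> 0 < h ->
  `|moment (a + h) - moment a| <= C * h.
Proof.
move=> a0 ah h0.
have i_ := integrable_moment; have [ia iah] : 0 < a /\ 0 < a + h by lra.
rewrite /moment -(RintegralB measurableT (i_ _ iah) (i_ _ ia)).
apply: le_trans (le_normr_Rintegral measurableT (iB (i_ _ iah) (i_ _ ia))) _.
rewrite CE.
apply: le_Rintegral => //.
- exact: (integrable_norm (iB (i_ _ iah) (i_ _ ia))).
- by apply: iZ; exact: iZ.
- by move=> w _; exact: powR_first_difference.
Qed.

Let second_difference a h : 1 / 2 <= a - h -> a + h <= 5 / 2 -> 0 < h ->
  moment (a + h) + moment (a - h) - 2 * moment a <= C * h ^+ 2.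
Proof.
move=> a0 ah h0.
have [ia iah ibh] : [/\ P.-integrable setT (EFin \o (fun w => f w `^ a)),
    P.-integrable setT (EFin \o (fun w => f w `^ (a + h))) &
    P.-integrable setT (EFin \o (fun w => f w `^ (a - h)))].
  by split; apply: integrable_moment; lra.
rewrite /moment -(RintegralD measurableT iah ibh) -RintegralZl//.
rewrite -(RintegralB measurableT (iD iah ibh) (iZ 2 ia)).
rewrite CE.
apply: le_Rintegral => //.
- by apply: iB; [exact: iD|exact: iZ].
- by apply: iZ; exact: iZ.
- by move=> w _; exact: powR_second_difference.
Qed.

(** At 1 the function vanishes with derivative [E[f ln f] - L < 0]. The step [h] is small enough for
    the quadratic remainder to use up at most half of the decrease. *)
Lemma log_moment_lt0 : exists2 a1, 1 < a1 <= 2 & log_moment a1 < 0.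
Proof.
pose m := \int[P]_w (f w * ln (f w)); have mL : m < L by [].
have CL0 : 0 <= C := C0.
pose h := Num.min 1 ((L - m) / (2 * (C + 1))).
have C1 : 0 < C + 1 by rewrite ltr_wpDl.
have h0 : 0 < h by rewrite lt_min ltr01/= divr_gt0 ?mulr_gt0// subr_gt0.
have h1 : h <= 1 by rewrite ge_min lexx.
have hC : h * (2 * (C + 1)) <= L - m by rewrite -ler_pdivlMr ?mulr_gt0// ge_min lexx orbT.
exists (1 + h); first lra.
have : moment (1 + h) <= 1 + h * m + C * h ^+ 2.
  have I : P.-integrable setT (EFin \o (fun w => f w + h * (f w * ln (f w)))).
    by apply: iD => //; apply: iZ; exact: integrable_xlnx.
  have : moment (1 + h) <= \int[P]_w (f w + h * (f w * ln (f w)) +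
      h ^+ 2 * (128 * (1 + f w ^+ 5))).
    apply: le_Rintegral => //.
    - by apply: integrable_moment; lra.
    - by apply: iD => //; apply: iZ; exact: iZ.
    - by move=> w _; apply: powR_taylor1 => //; lra.
  rewrite (RintegralD measurableT I (iZ _ (iZ _ i5))).
  rewrite (RintegralD measurableT if_ (iZ _ integrable_xlnx)).
  rewrite (RintegralZl _ measurableT integrable_xlnx).
  rewrite (RintegralZl _ measurableT (iZ 128 i5)) (RintegralZl _ measurableT i5).
  by rewrite f1 -/m /C; lra.
have M0 : 0 < moment (1 + h) by apply: moment_gt0; lra.
have := ln_le_subr1 M0.
rewrite /log_moment.
have : h * (h * (2 * (C + 1))) <= h * (L - m) by rewrite ler_wpM2l// ltW.
have : 0 < h * (L - m) by rewrite mulr_gt0// subr_gt0.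
have := sqr_ge0 h; rewrite expr2; nra.
Qed.

Lemma log_moment_chord e : 0 < e -> exists a0 a a' p,
    [/\ 1 <= a0 <= 2, [/\ 1 / 2 <= a', a' < a, 1 <= a & a < 2],
        1 < p <= 2, log_moment (p * a) < p * log_moment a &
        2 * log_moment a0 / a0 - e <= log_moment a +
          (2 - a) * (log_moment a - log_moment a') / (a - a')].
Proof.
exact: (log_chord L0 C0 moment_ge1 moment_gt0 first_difference second_difference
  moment1 log_moment_lt0).
Qed.

End moment_function.

(** * Integrals against the cascade measures *)

Section density.
Context d (T : measurableType d) (R : realType).
Context (mu nu : {measure set T -> \bar R}) (g : T -> R).
Hypotheses (mg : measurable_fun setT g) (g0 : forall x, 0 <= g x).
Hypothesis nuE : forall A, measurable A -> nu A = (\int[mu]_(x in A) (g x)%:E)%E.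

Import HBNNSimple.

Let integral_density_indic (E : set T) : measurable E ->
  (\int[nu]_x (\1_E x)%:E = \int[mu]_x ((\1_E x)%:E * (g x)%:E))%E.
Proof.
move=> mE; rewrite integral_indic// setIT nuE// integral_mkcond.
apply: eq_integral => x _; rewrite patchE indicE.
by case: ifPn => _; rewrite ?mul1e ?mul0e.
Qed.

Let integral_density_nnsfun (h : {nnsfun T >-> R}) :
  (\int[nu]_x (h x)%:E = \int[mu]_x ((h x)%:E * (g x)%:E))%E.
Proof.
under [LHS]eq_integral do rewrite fimfunE -fsumEFin//.
rewrite [LHS]ge0_integral_fsum//; last 2 first.
  - by move=> r; exact/measurable_EFinP/measurableT_comp.
  - by move=> n x _; rewrite EFinM nnfun_muleindic_ge0.
rewrite [RHS](eq_integral (fun x => \sum_(r \in range h)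
    ((g x)%:E * (r * \1_(h @^-1` [set r]) x)%:E))%E); last first.
  move=> x _; rewrite [X in (X%:E * _)%E = _]fimfunE -fsumEFin// muleC ge0_mule_fsumr//.
  by move=> r; rewrite EFinM nnfun_muleindic_ge0.
rewrite [RHS]ge0_integral_fsum//; last 2 first.
  - move=> r; apply/emeasurable_funM; first exact/measurable_EFinP.
    exact/measurable_EFinP/measurableT_comp.
  - move=> n x _; apply: mule_ge0; first by rewrite lee_fin.
    by rewrite EFinM nnfun_muleindic_ge0.
apply: eq_fsbigr => r /set_mem[x0 _ hr].
have r0 : 0 <= r by rewrite -hr.
have mr : measurable (h @^-1` [set r]) by exact: measurable_sfunP.
under [LHS]eq_integral do rewrite EFinM.
under [RHS]eq_integral do rewrite EFinM muleCA.
rewrite ge0_integralZl_EFin//; last exact/measurable_EFinP/measurable_indic.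
rewrite ge0_integralZl_EFin//.
- by rewrite integral_density_indic//; congr (_ * _)%E; apply: eq_integral => x _; rewrite muleC.
- by move=> x _; rewrite mule_ge0// lee_fin.
- by apply/emeasurable_funM; apply/measurable_EFinP => //; exact: measurable_indic.
Qed.

(** The formula holds for indicators by the definition of [nu], for simple functions by linearity,
    and in general by monotone convergence. *)
Lemma ge0_integral_density (f : T -> \bar R) : measurable_fun setT f ->
  (forall x, (0 <= f x)%E) ->
  (\int[nu]_x f x = \int[mu]_x (f x * (g x)%:E))%E.
Proof.
move=> mf f0.
pose f_ := nnsfun_approx measurableT mf.
transitivity (lim (\int[nu]_x (f_ n x)%:E @[n --> \oo])%E).
  rewrite -monotone_convergence//=.
  - apply: eq_integral => ? /[!inE] xD; apply/esym/cvg_lim => //=.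
    exact: cvg_nnsfun_approx.
  - by move=> n; exact/measurable_EFinP/measurable_funTS.
  - by move=> n ? _; rewrite lee_fin.
  - by move=> ? _ ? ? mn; rewrite lee_fin; exact/lefP/nd_nnsfun_approx.
under congr_lim do under eq_fun do rewrite integral_density_nnsfun.
rewrite -monotone_convergence//=.
- apply: eq_integral => x _; apply/cvg_lim => //=.
  by apply: cvgeMr => //; exact: cvg_nnsfun_approx.
- by move=> n; apply/emeasurable_funM; apply/measurable_EFinP => //; exact/measurable_funTS.
- by move=> n x _; rewrite mule_ge0// lee_fin.
- move=> x _ m n mn; rewrite lee_pmul// ?lee_fin//.
  exact/lefP/nd_nnsfun_approx.
Qed.

End density.

Section sin_scale.
Context (R : realType).

Lemma continuous_sin_scale (q : R) : continuous (fun x : R => sin (q * x)).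
Proof.
move=> x; apply: (@continuous_comp _ _ _ (fun x => q * x) sin); first exact: mulrl_continuous.
exact: continuous_sin.
Qed.

Lemma integrable_sin_scale (mu : {finite_measure set (measurableTypeR R) -> \bar R}) (q : R) :
  mu.-integrable setT (EFin \o (fun x : R => sin (q * x))).
Proof.
apply: (@le_integrable _ _ _ _ _ measurableT _ (cst 1%E)).
- by apply/measurable_EFinP; apply: continuous_measurable_fun; exact: continuous_sin_scale.
- by move=> x _ /=; rewrite lee_fin normr1 ler_norml sin_geN1 sin_le1.
- by apply: finite_measure_integrable_cst.
Qed.

End sin_scale.

Section cascade_integrals.
Context (R : realType) (b : nat).
Hypothesis b_gt1 : (1 < b)%N.
Implicit Types w : seq 'I_b -> R.

Let b_gt0 : 0 < b%:R :> R. Proof. by rewrite ltr0n ltnW. Qed.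
Let bN0 : b%:R != 0 :> R. Proof. by rewrite gt_eqF. Qed.

Lemma big_tupleS k (G : seq 'I_b -> R) :
  \sum_(t : k.+1.-tuple 'I_b) G t = \sum_(i < b) \sum_(t : k.-tuple 'I_b) G (i :: t).
Proof.
rewrite pair_bigA/=.
rewrite (reindex (fun p : 'I_b * k.-tuple 'I_b => cons_tuple p.1 p.2))//.
exists (fun t => (thead t, [tuple of behead t])) => [[i t] _|t _] /=.
  by congr (_, _); apply/val_inj.
by rewrite [RHS]tuple_eta; apply/val_inj.
Qed.

Lemma tree_sum_tupleE x (F : seq 'I_b -> R) k u : tree_sum x F k u =
  \sum_(t : k.-tuple 'I_b) (\prod_(j < k) x (u ++ take j.+1 t)) * F (u ++ t).
Proof.
elim: k u => [|k IH] u /=.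
  rewrite (big_pred1 [tuple]) => [|t]; last first.
    by apply/esym/eqP/val_inj; case: t => -[].
  by rewrite big_ord0 mul1r cats0.
rewrite (big_tupleS _ (fun t => (\prod_(j < k.+1) x (u ++ take j.+1 t)) * F (u ++ t))).
apply: eq_bigr => i _; rewrite IH mulr_sumr; apply: eq_bigr => t _.
rewrite big_ord_recl /= take0 cats1 -mulrA cat_rcons; congr (_ * (_ * _)).
by apply: eq_bigr => j _; rewrite cat_rcons.
Qed.

(** Dividing each weight by [b] accounts for the length [b^-N] of a cell; the factor [j = 0] of the
    product is the weight of the empty word. *)
Lemma tree_sum_cascadeE w (F : seq 'I_b -> R) N : w [::] = 1 ->
  tree_sum (fun v => w v / b%:R) F N [::] =
  \sum_(t : N.-tuple 'I_b) (\prod_(j < N.+1) w (take j t)) * (b%:R ^- N * F t).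
Proof.
move=> w1; rewrite tree_sum_tupleE; apply: eq_bigr => t _ /=.
rewrite big_ord_recl take0 w1 mul1r big_split/= prodr_const card_ord exprVn.
by rewrite mulrA.
Qed.

Lemma badic_leftE n (u : n.-tuple 'I_b) : badic_left R u = word_left R u.
Proof.
rewrite /word_left -(big_mkord xpredT (fun k => (nth 0%N (map val u) k)%:R * b%:R ^- k.+1)).
rewrite size_tuple big_mkord; apply: eq_bigr => k _.
rewrite (tnth_nth (Ordinal (ltnW b_gt1))).
by rewrite (nth_map (Ordinal (ltnW b_gt1))) ?size_tuple.
Qed.

Section integrals_of_cascade_measure.
Context (w : seq 'I_b -> R).
Hypotheses (w0 : forall v, 0 <= w v) (w1 : w [::] = 1).

Lemma cascade_density_ge0 N t : 0 <= cascade_density w N t.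
Proof.
by apply: sumr_ge0 => u _; rewrite mulr_ge0// ?prodr_ge0.
Qed.

Lemma integral_cascade_measure N (f : R -> R) : measurable_fun setT f ->
  (forall x, 0 <= f x) ->
  (\int[cascade_measure w N]_x (f x)%:E = \sum_(u : N.-tuple 'I_b)
    (\prod_(j < N.+1) w (take j u))%:E *
    \int[lebesgue_measure]_(x in badic_interval u) (f x)%:E)%E.
Proof.
move=> mf f0.
have mI (u : N.-tuple 'I_b) : measurable (badic_interval u : set R) by exact: measurable_itv.
have c0 (u : N.-tuple 'I_b) : 0 <= \prod_(j < N.+1) w (take j u) by exact: prodr_ge0.
rewrite (@ge0_integral_density _ _ _ lebesgue_measure (cascade_measure w N)
  (fun t => `|cascade_density w N t|)) //; last first.
- exact/measurable_EFinP.
- by apply: measurableT_comp => //; exact: measurable_cascade_density.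
have mfI (u : N.-tuple 'I_b) : measurable_fun [set: measurableTypeR R]
    (fun x => (f x)%:E * (\1_(badic_interval u) x)%:E)%E.
  apply: emeasurable_funM; first exact/measurable_EFinP.
  by apply/measurable_EFinP; apply: measurable_indic; exact: mI.
transitivity (\int[lebesgue_measure]_x (\sum_(u : N.-tuple 'I_b)
    (\prod_(j < N.+1) w (take j u))%:E * ((f x)%:E * (\1_(badic_interval u) x)%:E)))%E.
  apply: eq_integral => x _; rewrite ger0_norm ?cascade_density_ge0//.
  rewrite -EFinM mulr_sumr -sumEFin; apply: eq_bigr => u _.
  by rewrite -!EFinM mulrCA.
rewrite ge0_integral_sum//; last 2 first.
- by move=> u; exact: emeasurable_funM.
- by move=> u x _; rewrite !mule_ge0 ?lee_fin.
apply: eq_bigr => u _; rewrite ge0_integralZl_EFin//; last first.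
 
by move=> x _; rewrite mule_ge0 ?lee_fin.
congr (_ * _)%E; rewrite [RHS]integral_mkcond; apply: eq_integral => x _.
by rewrite patchE indicE; case: ifPn => _; rewrite ?mule1 ?mule0.
Qed.

Lemma integral_badic_interval1 N (u : N.-tuple 'I_b) :
  (\int[lebesgue_measure]_(x in badic_interval u) (1 : R)%:E = (b%:R ^- N)%:E)%E.
Proof.
rewrite integral_cst ?mul1e; last exact: measurable_itv.
rewrite [LHS](lebesgue_measure_itv `[badic_left R u, badic_left R u + b%:R ^- N[)/=.
rewrite lte_fin ltrDl invr_gt0 exprn_gt0//.
by rewrite -EFinB addrAC subrr add0r.
Qed.

Let cos_natD (y : R) m : cos (2 * pi * (y + m%:R)) = cos (2 * pi * y).
Proof.
rewrite mulrDr; move: (2 * pi * y) => x.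
rewrite -[RHS](periodicn (@cosD2pi R) m x); congr (cos (x + _)).
by rewrite -[RHS]mulr_natr -[pi *+ 2]mulr_natl.
Qed.

(** Under the change of variable [y = b^n x] the cell of [u] becomes that of [drop n u] up to an
    integer translation, which the cosines do not see. *)
Lemma sine_average_drop N n (u : N.-tuple 'I_b) : (n <= N)%N ->
  (cos (2 * pi * b%:R ^+ n * badic_left R u) -
   cos (2 * pi * b%:R ^+ n * (badic_left R u + b%:R ^- N))) / (2 * pi * b%:R ^+ n) =
  b%:R ^- N * sine_average R (drop n u).
Proof.
move=> nN; rewrite badic_leftE.
have su : size u = N by rewrite size_tuple.
have st : size (take n u) = n by rewrite size_takel// su.
have sd : size (drop n u) = (N - n)%N by rewrite size_drop su.
have [m mE] := word_left_natE R b_gt1 (take n u); rewrite st in mE.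
have E : b%:R ^+ n * word_left R u = word_left R (drop n u) + m%:R.
  rewrite -[in LHS](cat_take_drop n u) word_left_cat st mulrDr mE mulVKf ?expf_neq0//.
  by rewrite addrC.
have EN : b%:R ^- N = b%:R ^- n * b%:R ^- (N - n) :> R.
  by rewrite -invfM -exprD subnKC.
rewrite /sine_average sd -!(mulrA (2 * pi)) [b%:R ^+ n * (_ + _)]mulrDr E.
rewrite EN mulVKf ?expf_neq0// [_ + m%:R + _]addrAC !cos_natD.
have : 0 < 2 * pi :> R by rewrite mulr_gt0// pi_gt0.
move: (cos _) => A; move: (cos _) => B; move: (2 * pi) => q q0.
by field; rewrite gt_eqF ?expf_neq0.
Qed.

Let derivative_sin_antiderivative (q x : R) : q != 0 ->
  is_derive x 1 (fun y => y - cos (q * y) / q) (1 + sin (q * x)).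
Proof.
move=> q0; have -> : (fun y => y - cos (q * y) / q) =
    (fun y => y) - q^-1 *: (cos \o (fun y => q * y)).
  by apply/funext => y /=; rewrite mulrC.
apply: is_derive_eq.
by rewrite /GRing.scale/=; field.
Qed.

Let continuous_1Dsin (q : R) : continuous (fun x : R => 1 + sin (q * x)).
Proof.
move=> x; apply: continuousD; first exact: cst_continuous.
exact: continuous_sin_scale.
Qed.

(** The added 1 keeps the integrand nonnegative, as the density formula demands; the antiderivative
    is [y - cos (q y) / q]. *)
Lemma integral_badic_interval_sin N n (u : N.-tuple 'I_b) : (n <= N)%N ->
  (\int[lebesgue_measure]_(x in badic_interval u)
    (1 + sin (2 * pi * b%:R ^+ n * x))%:E =
  (b%:R ^- N * (1 + sine_average R (drop n u)))%:E)%E.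
Proof.
move=> nN; set q := 2 * pi * b%:R ^+ n.
have q0 : q != 0 by rewrite gt_eqF// mulr_gt0 ?exprn_gt0// mulr_gt0// pi_gt0.
have cf : continuous (fun x : R => 1 + sin (q * x)).
  exact: continuous_1Dsin.
have dF x := derivative_sin_antiderivative x q0.
have cF : continuous (fun y => y - cos (q * y) / q).
  by move=> x; apply/differentiable_continuous/derivable1_diffP; apply: ex_derive.
have lt : badic_left R u < badic_left R u + b%:R ^- N.
  by rewrite ltrDl invr_gt0 exprn_gt0.
rewrite /badic_interval integral_itv_bndo_bndc; last first.
  by apply/measurable_EFinP; apply: measurable_funTS; exact: continuous_measurable_fun.
rewrite (@continuous_FTC2 _ _ (fun y => y - cos (q * y) / q))//.
- rewrite -EFinB; congr EFin; rewrite [RHS]mulrDr mulr1 -sine_average_drop//.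
  by rewrite -/q mulrBl; ring.
- exact: continuous_subspaceT.
- split.
  + by move=> x _; apply: ex_derive.
  + by apply: cvg_at_right_filter; exact: cF.
  + by apply: cvg_at_left_filter; exact: cF.
- by move=> x _; rewrite derive1E; apply: derive_val.
Qed.

Lemma integral_cascade_measure_sin N n : (n <= N)%N ->
  (\int[cascade_measure w N]_x (1 + sin (2 * pi * b%:R ^+ n * x))%:E =
  (tree_sum (fun v => w v / b%:R) (fun v => 1 + sine_average R (drop n v)) N [::])%:E)%E.
Proof.
move=> nN; rewrite integral_cascade_measure; last 2 first.
- by apply: continuous_measurable_fun; exact: continuous_1Dsin.
- by move=> x; rewrite -lerBlDl sub0r sin_geN1.
rewrite tree_sum_cascadeE// -sumEFin; apply: eq_bigr => u _.
by rewrite integral_badic_interval_sin// -EFinM.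
Qed.

Lemma integral_cascade_measure1 N :
  (\int[cascade_measure w N]_x (1 : R)%:E =
  (tree_sum (fun v => w v / b%:R) (fun=> 1) N [::])%:E)%E.
Proof.
rewrite (@integral_cascade_measure N (cst 1))// tree_sum_cascadeE// -sumEFin.
by apply: eq_bigr => u _; rewrite integral_badic_interval1 mulr1.
Qed.

Variable mu : {finite_measure set (measurableTypeR R) -> \bar R}.
Hypothesis w_mu : weakly_converges (cascade_measure w) mu.

Lemma cascade_mass_cvg :
  tree_sum (fun v => w v / b%:R) (fun=> 1) N [::] @[N --> \oo] --> fine (mu setT).
Proof.
apply: (@fine_cvg _ _ _ _ (fun N => (tree_sum (fun v => w v / b%:R) (fun=> 1) N [::])%:E)).
rewrite fineK ?fin_num_measure//.
have : (\int[cascade_measure w N]_x (1 : R)%:E)%E @[N --> \oo] --> (\int[mu]_x (1 : R)%:E)%E.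
  by apply: w_mu; [exact: cst_continuous|exists 1 => x; rewrite normr1].
by rewrite integral_cst// mul1e; under eq_fun do rewrite integral_cascade_measure1.
Qed.

Lemma cascade_sine_cvg n :
  tree_sum (fun v => w v / b%:R) (fun v => sine_average R (drop n v)) N [::]
    @[N --> \oo] --> \int[mu]_x sin (2 * pi * b%:R ^+ n * x).
Proof.
set q := 2 * pi * b%:R ^+ n.
have cs : continuous (fun x : R => 1 + sin (q * x)).
  exact: continuous_1Dsin.
have is1 := integrable_sin_scale mu q.
have ic1 : mu.-integrable setT (EFin \o (fun x : R => 1)).
  exact: finite_measure_integrable_cst.
have E : (\int[mu]_x (1 + sin (q * x))%:E)%E =
    (fine (mu setT) + \int[mu]_x sin (q * x))%:E.
  rewrite (integralD_EFin measurableT ic1 is1) EFinD fineK ?fin_num_measure//.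
  rewrite integral_cst// mul1e /Rintegral fineK//.
  exact: integrable_fin_num.
have H : tree_sum (fun v => w v / b%:R) (fun v => 1 + sine_average R (drop n v)) N [::]
    @[N --> \oo] --> fine (mu setT) + \int[mu]_x sin (q * x).
  apply: (@fine_cvg _ _ _ _ (fun N => (tree_sum (fun v => w v / b%:R)
    (fun v => 1 + sine_average R (drop n v)) N [::])%:E)); rewrite -E.
  apply: (cvg_trans _ (w_mu cs _)).
    apply: near_eq_cvg; near=> N.
    by rewrite integral_cascade_measure_sin//; near: N; exact: nbhs_infty_ge.
  exists 2 => x; apply: (le_trans (ler_normD _ _)).
  rewrite normr1 -[2]/(1 + 1) lerD2l.
  by rewrite ler_norml sin_geN1 sin_le1.
(* The auxiliary 1 is removed by subtracting the total masses, which converge as well. *)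
have := cvgB H cascade_mass_cvg; rewrite addrAC subrr add0r => h.
apply: (cvg_trans _ (h _)); apply: near_eq_cvg; near=> N.
by rewrite !fctE tree_sum_addr addrAC subrr add0r.
Unshelve. all: by end_near. Qed.

End integrals_of_cascade_measure.
End cascade_integrals.

(** * The Fourier dimension *)

Section fourier_dimension.
Context (R : realType) (b : nat) d0 (T0 : measurableType d0) (P0 : probability T0 R).
Context (W : {RV P0 >-> R}).
Hypotheses (b_gt1 : (1 < b)%N) (W0 : {ae P0, forall w, 0 <= W w}).
Hypothesis EW : ('E_P0[W] = 1)%E.
Hypothesis EWlnW : (mean_xlogx P0 W < (ln b%:R)%:E)%E.
Hypothesis W_moment : forall t : R, 0 < t -> ('E_P0[fun w => (W w `^ t)%R] < +oo)%E.

Let f w := `|W w|.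
Let L : R := ln b%:R.

Let L0 : 0 < L. Proof. by rewrite ln_gt0// ltr1n. Qed.

Let mf : measurable_fun setT f. Proof. exact: measurableT_comp. Qed.
Let f0 w : 0 <= f w. Proof. exact: normr_ge0. Qed.

(** [W] is nonnegative only almost surely; passing to [|W|] allows the pointwise inequalities on
    powers and logarithms. *)
Lemma expectation_normr (h : R -> R) : measurable_fun setT h ->
  ('E_P0[fun w => h (W w)] = \int[P0]_w (h `|W w|)%:E)%E.
Proof.
move=> mh; rewrite unlock; apply: ae_eq_integral => //.
- by apply/measurable_EFinP; exact: measurableT_comp.
- by apply/measurable_EFinP; apply: measurableT_comp.
- by apply: filterS W0 => w W0w _; rewrite ger0_norm.
Qed.

Let mp t : measurable_fun setT (fun x : R => x `^ t).
Proof. exact: measurable_powR. Qed.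

Lemma norm_weight_moment a : 0 < a -> (\int[P0]_w (f w `^ a)%:E < +oo)%E.
Proof. by move=> a0; rewrite -(expectation_normr (mp a)); exact: W_moment. Qed.

Lemma norm_weight_mean : \int[P0]_w f w = 1.
Proof.
have := expectation_normr (@measurable_id _ _ setT).
by rewrite [LHS]EW /Rintegral => <-.
Qed.

Let mxlnx : measurable_fun setT (fun x : R => x * ln x).
Proof. by apply: measurable_funM => //; exact: measurable_ln. Qed.

Lemma norm_weight_xlnx : \int[P0]_w (f w * ln (f w)) < ln b%:R.
Proof.
move: EWlnW; rewrite /mean_xlogx (expectation_normr mxlnx).
have /(integrable_fin_num measurableT) := integrable_xlnx mf f0 norm_weight_moment.
by rewrite /Rintegral -lte_fin => /fineK ->.
Qed.

Let q : R := moment P0 f 2.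

Let Ef2 : ('E_P0[fun w => (W w ^+ 2)%R] = q%:E)%E.
Proof.
rewrite (@expectation_normr (fun x => x ^+ 2)); last exact: exprn_measurable.
rewrite /q /moment /Rintegral fineK.
  by apply: eq_integral => w _; rewrite powR_mulrn.
exact: (integrable_fin_num measurableT (integrable_moment mf norm_weight_moment _)).
Qed.

Let q1 : 1 <= q.
Proof. by apply: (moment_ge1 mf f0 norm_weight_moment norm_weight_mean); rewrite ler1n. Qed.

Let V w := f w ^+ 2 / q.

Let V_moment a : 0 < a -> (\int[P0]_w (V w `^ a)%:E < +oo)%E.
Proof.
move=> a0; under eq_integral do
  rewrite /V powRM ?exprn_ge0 ?invr_ge0 ?(le_trans ler01 q1)// -powR_mulrn// -powRrM mulrC EFinM.
rewrite ge0_integralZl//.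
- by rewrite lte_mul_pinfty ?lee_fin ?powR_ge0// norm_weight_moment// mulr_gt0.
- by apply/measurable_EFinP; apply: measurableT_comp (mp _) _.
- by move=> w _; rewrite lee_fin powR_ge0.
- by rewrite lee_fin powR_ge0.
Qed.

(** If [E[V ln V] <= L], the function [ln (moment a)] lies above its tangent at 2, whose slope is at
    most [(L + ln q) / 2]; since [a <= 2], replacing the slope by this value only lowers the line.
    Otherwise, the infimum defining the dimension is at most its term at [t = a / 2]. *)
Lemma fourier_dim_log_moment a : 1 <= a <= 2 ->
  0 <= fourier_dim b W * ln b%:R + 2 * log_moment P0 f (ln b%:R) a / a.
Proof.
move=> /andP[a1 a2]; have a0 : 0 < a by lra.
have Ma1 : 1 <= moment P0 f a.
  exact: (moment_ge1 mf f0 norm_weight_moment norm_weight_mean).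
rewrite /fourier_dim; case: ifPn => h.
- move: h; rewrite /mean_xlogx /square_tilt Ef2/=.
  have mt : measurable_fun setT (fun x : R => x ^+ 2 / q * ln (x ^+ 2 / q)).
    apply: (@measurableT_comp _ _ _ _ _ _ (fun y : R => y * ln y)) => //.
    by apply: measurable_funM => //; exact: exprn_measurable.
  rewrite (expectation_normr mt).
  have V0 w : 0 <= V w by rewrite divr_ge0 ?exprn_ge0// (le_trans ler01 q1).
  have mV : measurable_fun setT V by apply: measurable_funM => //; exact: measurable_funX.
  have iV := integrable_xlnx mV V0 V_moment.
  have /(integrable_fin_num measurableT)/fineK <- := iV; rewrite lee_fin -/(Rintegral _ _ _) => h.
  (* The slope for which the line through [(2, ln q)] gives exactly the claimed inequality. The
     tangent bound is obtained from [exp y >= 1 + y] pointwise in [f]. *)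
  pose c := (L + ln q) / 2.
  have i2 : P0.-integrable setT (EFin \o (fun w => f w `^ 2)).
    exact: (integrable_moment mf norm_weight_moment).
  have ia : P0.-integrable setT (EFin \o (fun w => f w `^ a)).
    exact: (integrable_moment mf norm_weight_moment).
  have iV' := integrableZl measurableT (q / 2) iV.
  have i2' := integrableZl measurableT (- (L / 2)) i2.
  have iS := integrableZl measurableT (a - 2) (integrableD measurableT iV' i2').
  have iR := integrableZl measurableT (expR ((a - 2) * c)) (integrableD measurableT i2 iS).
  have pt w : expR ((a - 2) * c) * (f w `^ 2 + (a - 2) * (q / 2 * (V w * ln (V w)) +
      - (L / 2) * f w `^ 2)) <= f w `^ a.
    have := f0 w; rewrite le_eqVlt => /predU1P[f_eq0|fw0].
      by rewrite /V -f_eq0 !powR0 ?gt_eqF// expr0n/= !(mul0r, mulr0, addr0).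
    have y2 : f w `^ 2 = f w ^+ 2 by rewrite powR_mulrn.
    have lnV : ln (V w) = 2 * ln (f w) - ln q.
      by rewrite /V ln_div ?posrE ?exprn_gt0// ?(lt_le_trans ltr01 q1)// lnXn// mulr_natl.
    have ya : f w `^ a = expR ((a - 2) * c) * (f w ^+ 2 * expR ((a - 2) * (ln (f w) - c))).
      rewrite -y2 /powR gt_eqF// -!expRD; congr expR.
      by move: (ln (f w)) (c) => l k; ring.
    rewrite ya y2 ler_wpM2l ?expR_ge0// lnV.
    rewrite (_ : _ + _ = f w ^+ 2 * (1 + (a - 2) * (ln (f w) - c))).
      by rewrite ler_wpM2l ?exprn_ge0// expR_ge1Dx.
    rewrite /V /c; move: (ln (f w)) (ln q) L => l k l'.
    by field; rewrite gt_eqF// (lt_le_trans ltr01 q1).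
  have : expR ((a - 2) * c) * q <= moment P0 f a.
    have := le_Rintegral measurableT iR ia (fun w _ => pt w).
    apply: le_trans.
    rewrite (RintegralZl _ measurableT (integrableD measurableT i2 iS)).
    rewrite ler_wpM2l ?expR_ge0// (RintegralD measurableT i2 iS) -/(moment _ _ _) -/q lerDl.
    rewrite (RintegralZl _ measurableT (integrableD measurableT iV' i2')).
    rewrite (RintegralD measurableT iV' i2') (RintegralZl _ measurableT iV).
    rewrite (RintegralZl _ measurableT i2) -/(moment _ _ _) -/q.
    have hL : \int[P0]_w (V w * ln (V w)) <= L by [].
    rewrite mulr_le0//; first lra.
    have : q / 2 * \int[P0]_w (V w * ln (V w)) <= q / 2 * L.
      by rewrite ler_wpM2l// divr_ge0// (le_trans ler01 q1).
    lra.
  rewrite -ler_ln ?posrE ?mulr_gt0 ?expR_gt0 ?(lt_le_trans ltr01 q1) ?(lt_le_trans ltr01 Ma1)//.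
  rewrite lnM ?posrE ?expR_gt0 ?(lt_le_trans ltr01 q1)// expRK /c /log_moment.
  rewrite -/L [(1 - _ / L) * L]mulrBl mul1r divfK ?gt_eqF//.
  move: (ln q) (ln (moment _ _ _)) L => lq lM l.
  move=> hM; rewrite -(pmulr_lge0 _ a0) mulrDl divfK ?gt_eqF//; lra.
- have bt t : 0 < b%:R `^ t :> R by rewrite powR_gt0// ltr0n ltnW.
  have ES t : 0 < t -> fine ('E_P0[fun w => (b%:R `^ (1 - t) * W w `^ (2 * t))%R])%E =
      b%:R `^ (1 - t) * moment P0 f (2 * t).
    move=> t0; rewrite (@expectation_normr (fun x => b%:R `^ (1 - t) * x `^ (2 * t))).
      rewrite -/(Rintegral _ _ _) RintegralZl//.
      by apply: (integrable_moment mf norm_weight_moment); lra.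
    by apply: measurable_funM => //; exact: mp.
  set S := [set _ | _ in _].
  (* [inf] is below the elements of a set only when the set is bounded below; here every term is
     nonnegative because moments of order at least 1 are at least 1. *)
  have S_lb : lbound S 0.
    move=> y [t /=]; rewrite in_itv/= => /andP[t1 t2] <- {y}.
    have t0 : 0 < t by lra.
    rewrite ES// divr_ge0 ?(mulr_ge0 (ltW t0) (ltW L0))// ln_ge0//.
    have M1 : 1 <= moment P0 f (2 * t).
      by apply: (moment_ge1 mf f0 norm_weight_moment norm_weight_mean); lra.
    have b1 : 1 <= b%:R `^ (1 - t) :> R.
      rewrite -[leLHS](powRr0 b%:R) ler_powR//; first by rewrite ler1n ltnW.
      lra.
    by apply: (le_trans M1); apply: ler_peMl b1; exact: le_trans ler01 M1.
  have inf_le : inf S <= ln (b%:R `^ (1 - a / 2) * moment P0 f a) / (a / 2 * L).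
    apply: ge_inf; first by exists 0.
    exists (a / 2); first by rewrite /= in_itv/=; apply/andP; split; lra.
    have ha : 0 < a / 2 by rewrite divr_gt0.
    by rewrite (ES _ ha) [2 * (a / 2)]mulrC divfK.
  rewrite -(pmulr_lge0 _ a0) mulrDl divfK ?gt_eqF//.
  have : inf S * L * a <= 2 * ((1 - a / 2) * L + ln (moment P0 f a)).
    apply: (@le_trans _ _ (ln (b%:R `^ (1 - a / 2) * moment P0 f a) / (a / 2 * L) * L * a)).
      by rewrite !ler_wpM2r// ltW.
    rewrite lnM ?posrE ?(lt_le_trans ltr01 Ma1)// ln_powR -/L.
    rewrite le_eqVlt; apply/orP; left; apply/eqP.
    move: (ln (moment _ _ _)) L L0 => lM l l0.
    by field; rewrite !gt_eqF.
  rewrite /log_moment -/L; move: (ln (moment _ _ _)) L (inf S) => lM l i.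
  lra.
Qed.

End fourier_dimension.

(** * Recurrence for the cascade *)

Section recurrent_sine_sum.
Context (R : realType) (b : nat) d (T : measurableType d) (P : probability T R).
Context (Wu : seq 'I_b -> {RV P >-> R}).
Hypothesis indW : mutually_independent [set u | u != [::]] Wu.
Hypothesis b_gt1 : (1 < b)%N.
Context (g : R -> R).
Hypotheses (mg : measurable_fun setT g) (g0 : forall y, 0 <= g y).

Local Notation D := [set u : seq 'I_b | u != [::]].
Local Notation pr A := (fine (P A)).
Local Notation mass w := (tree_sum (fun v => g (Wu v w)) (fun=> 1)).

Let b_gt0 : 0 < b%:R :> R. Proof. by rewrite ltr0n ltnW. Qed.

Lemma eq_tree_suml_size (x y F : seq 'I_b -> R) k u :
  (forall v, v != [::] -> (size v <= size u + k)%N -> x v = y v) ->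
  tree_sum x F k u = tree_sum y F k u.
Proof.
elim: k u => //= k IH u xy; apply: eq_bigr => i _; congr (_ * _).
  by apply: xy; rewrite ?size_rcons; [case: (u)|lia].
by apply: IH => v v0; rewrite size_rcons addSnnS; exact: xy.
Qed.

Lemma measurable_sine_sum_coords m n k : (k <= m)%N ->
  measurable_fun [set: coords D Wu [set v | (size v <= m)%N]] (sine_sum Wu g n k [::]).
Proof.
(* The measurability criterion concerns every weight below the root, so the weights deeper than [m],
   absent from the sum, are set to 0. *)
move=> km; rewrite (_ : sine_sum Wu g n k [::] = fun w =>
    tree_sum (fun v => if (v != [::]) && (size v <= m)%N then g (Wu v w) else 0)
      (fun v => sine_average R (drop n v)) k [::]).
  apply: (@measurable_tree_sum R b _ (coords D Wu _)
    (fun v w => if (v != [::]) && (size v <= m)%N then g (Wu v w) else 0)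
    (fun v _ => sine_average R (drop n v))) => // v _ _ /=.
  by case: (boolP ((v != [::]) && (size v <= m)%N)) => // /andP[v0 vm]; exact: measurable_weight.
apply/funext => w; apply: eq_tree_suml_size => v v0 vk.
by rewrite v0 (leq_trans vk).
Qed.

Context (c ka q : R) (th : nat -> R).
Hypotheses (c0 : 0 < c) (c1 : c <= 1) (ka0 : 0 < ka) (q0 : 0 < q).
Hypothesis spread : forall N n k v y, (size v + n)%N = N ->
  c <= pr [set w | ka * q ^+ n <= `|sine_sum Wu g N (n + k.+1) v w - y|].
Hypothesis th_small : forall m eta, 0 < eta ->
  exists n0, forall n, (n0 <= n)%N -> th n <= eta * (ka * q ^+ (n - m)).

Let E n k := [set w | th n <= `|sine_sum Wu g n (n + k.+1) [::] w|].

Let pr_le (A B : set T) : measurable A -> measurable B -> A `<=` B -> pr A <= pr B.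
Proof. by move=> mA mB AB; rewrite fine_le ?fin_num_measure// le_measure ?inE. Qed.

Let measurable_ge (h : T -> R) r : measurable_fun setT h -> measurable [set w | r <= h w].
Proof. by move=> mh; rewrite -[X in measurable X]setTI; apply: measurable_fun_ler. Qed.

Let mE n k : measurable (E n k).
Proof.
by apply: measurable_ge; apply: measurableT_comp => //; exact: measurable_sine_sumT.
Qed.

(** Non-extinction at every finite level. It holds almost surely where the limit measure is nonzero,
    yet each of its conditions involves finitely many levels. *)
Definition surviving := \bigcap_m [set w | 0 < mass w m [::]].

Let mmass m : measurable_fun setT (fun w => mass w m [::]).
Proof.
by apply: (@measurable_tree_sum R b _ T (fun v w => g (Wu v w)) (fun _ _ => 1)) => // v _ _;
  apply: measurableT_comp.
Qed.

Lemma measurable_surviving : measurable surviving.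
Proof.
apply: bigcapT_measurable => m.
by rewrite -[X in measurable X]setTI; apply: measurable_fun_ltr.
Qed.

Lemma avoiding_measurable_coords m M N K K' : (M + N + K + K' <= m)%N ->
  measurable ([set w | forall n k, (M <= n < M + N)%N -> (K <= k < K + K')%N ->
    ~ E n k w] : set (coords D Wu [set v | (size v <= m)%N])).
Proof.
move=> mE'.
rewrite (_ : [set w | _] = \bigcap_n \bigcap_k
    (if (M <= n < M + N)%N && (K <= k < K + K')%N then ~` E n k else setT)).
  apply: bigcapT_measurable => n; apply: bigcapT_measurable => k.
  case: ifPn => // /andP[/andP[_ nN] /andP[_ kK]].
  apply: measurableC; rewrite /E -[X in measurable X]setTI.
  apply: measurable_fun_ler => //.
  by apply: measurableT_comp => //; apply: measurable_sine_sum_coords; lia.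
apply/seteqP; split => [w h n _ k _|w h n k nN kK].
  by case: ifPn => // /andP[]; exact: h.
by have := h n I k I; rewrite nN kK.
Qed.

(** An avoiding event over finite ranges depends on the levels up to [m]. For [n] beyond [m], the
    levels between [m] and [n] still spread the sine sum around 0 at scale [q^(n-m)], against which
    the threshold is negligible. *)
Let avoiding_surviving_eq0 M :
  P ([set w | forall N, exists K, forall K' n k, (M <= n < M + N)%N ->
     (K <= k < K + K')%N -> ~ th n <= `|sine_sum Wu g n (n + k.+1) [::] w|]
    `&` surviving) = 0%E.
Proof.
apply: (@avoiding_null _ T R P E surviving c mE measurable_surviving c0 c1 M) => N K K'.
set C := [set w | _]; pose m := (M + N + K + K')%N.
have mC := @avoiding_measurable_coords m M N K K' (leqnn _).
have mCT : measurable C := measurable_coords mC.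
split=> // e e0.
(* Positive mass at level [m] is at least [b^m / (j + 1)] for some [j]. These events increase, and
   one of them covers survival within [C] up to probability [e]. *)
pose F j := C `&` [set w | j.+1%:R^-1 * b%:R ^+ m <= mass w m [::]].
have mF j : measurable (F j) by apply: measurableI => //; exact: measurable_ge.
have ndF : nondecreasing_seq F.
  apply/nondecreasing_seqP => j; apply/subsetPset => w [Cw /= h]; split => //=.
  apply: le_trans h; rewrite ler_wpM2r ?exprn_ge0 ?(ltW b_gt0)//.
  by rewrite lef_pV2 ?posrE// ler_nat.
have [j jP] := nondecreasing_approx P mF ndF e0.
have sF : pr (C `&` surviving) <= pr (\bigcup_j F j).
  apply: pr_le.
  - exact: measurableI mCT measurable_surviving.
  - exact: bigcupT_measurable.
  move=> w [Cw Sw]; have := Sw m I => /= mw.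
  have bm : 0 < b%:R ^+ m :> R by rewrite exprn_gt0.
  exists (Num.truncn ((mass w m [::])^-1 * b%:R ^+ m)) => //; split => //=.
  rewrite mulrC ler_pdivrMr// -ler_pdivrMl//.
  by apply/ltW; rewrite truncnS_gt.
have eta0 : 0 < j.+1%:R^-1 :> R by rewrite invr_gt0.
have [n0 n0P] := th_small m eta0.
exists (maxn n0 m) => n; rewrite geq_max => /andP[n0n mn].
exists 0%N => k _.
have kan : 0 < ka * q ^+ (n - m) by rewrite mulr_gt0 ?exprn_gt0.
have := @sine_sum_anticoncentration_event R b _ T P Wu indW b_gt1 g mg g0 c
  (ka * q ^+ (n - m)) j.+1%:R^-1 m (n - m) (n - m + k.+1) n C (ltW c0) kan
  (subnKC mn) (fun v y vn => spread k y vn) eta0 mC.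
rewrite addnA subnKC// => /le_trans hit.
have : c * pr (F j) <= pr (C `&` E n k).
  apply: hit; apply: pr_le.
  - apply: measurableI => //; apply: measurable_ge.
    by apply: measurableT_comp => //; exact: measurable_sine_sumT.
  - exact: measurableI.
  by move=> w [Cw h]; split => //; apply: le_trans h; exact: n0P.
apply: le_trans.
have : c * (pr (C `&` surviving) - e) <= c * pr (F j).
  by rewrite ler_wpM2l ?(ltW c0)//; move: jP sF; lra.
have : c * e <= e by rewrite ler_piMl// ltW.
move: (pr _) (pr _) => x y; lra.
Qed.

Lemma avoiding_surviving_negligible M :
  P.-negligible ([set w | forall N, exists K, forall K' n k, (M <= n < M + N)%N ->
     (K <= k < K + K')%N -> ~ th n <= `|sine_sum Wu g n (n + k.+1) [::] w|]
    `&` surviving).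
Proof.
eexists; split; [|exact: avoiding_surviving_eq0|exact: subset_refl].
apply: measurableI; last exact: measurable_surviving.
rewrite (_ : [set w | _] = \bigcap_N \bigcup_K \bigcap_K' [set w | forall n k,
    (M <= n < M + N)%N -> (K <= k < K + K')%N -> ~ E n k w]).
  apply: bigcapT_measurable => N; apply: bigcupT_measurable => K.
  apply: bigcapT_measurable => K'.
  exact: (measurable_coords (@avoiding_measurable_coords _ M N K K' (leqnn _))).
apply/seteqP; split => [w h N _|w h N].
  by have [K KP] := h N; exists K => // K' _; exact: KP.
by have [K _ KP] := h N I; exists K => K'; exact: (KP K' I).
Qed.

End recurrent_sine_sum.

(** * Spread of the sine sums at the rate of the dimension *)

Section cascade_weights.
Context (R : realType) (b : nat).
Context d0 (T0 : measurableType d0) (P0 : probability T0 R).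
Context d (T : measurableType d) (P : probability T R).
Context (W : {RV P0 >-> R}) (Wu : seq 'I_b -> {RV P >-> R}).
Hypotheses (b_gt1 : (1 < b)%N) (W0 : {ae P0, forall w, 0 <= W w}).
Hypothesis W_nonconstant : nonconstant W.
Hypothesis EW : ('E_P0[W] = 1)%E.
Hypothesis EWlnW : (mean_xlogx P0 W < (ln b%:R)%:E)%E.
Hypothesis W_moment : forall t : R, 0 < t -> ('E_P0[fun w => (W w `^ t)%R] < +oo)%E.
Hypothesis W_Wu : cascade_weights W Wu.

Let b_gt0 : 0 < b%:R :> R. Proof. by rewrite ltr0n ltnW. Qed.
Let bN0 : b%:R != 0 :> R. Proof. by rewrite gt_eqF. Qed.
Let L : R := ln b%:R.
Let L0 : 0 < L. Proof. by rewrite ln_gt0// ltr1n. Qed.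
Let f w := `|W w|.
Let mf : measurable_fun setT f. Proof. exact: measurableT_comp. Qed.
Let f0 w : 0 <= f w. Proof. exact: normr_ge0. Qed.
Let f_moment := norm_weight_moment W0 W_moment.
Let f1 := norm_weight_mean W0 EW.
Let fln := norm_weight_xlnx W0 EWlnW W_moment.

Let g (y : R) := `|y| / b%:R.
Let mg : measurable_fun setT g. Proof. exact: measurable_funM. Qed.
Let g0 y : 0 <= g y. Proof. by rewrite divr_ge0 ?(ltW b_gt0). Qed.

Lemma weight_integral v (h : R -> R) : v != [::] -> measurable_fun setT h ->
  (forall y, 0 <= h y) ->
  (\int[P]_w (h (Wu v w))%:E = \int[P0]_w (h (W w))%:E)%E.
Proof.
move=> v0 mh h0; have [_ WuW _] := W_Wu.
have mhE : measurable_fun setT (EFin \o h) by exact/measurable_EFinP.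
have hE0 y : (0 <= (EFin \o h) y)%E by rewrite lee_fin.
rewrite -[LHS](ge0_integral_distribution (Wu v) mhE hE0).
rewrite -[RHS](ge0_integral_distribution W mhE hE0).
by apply: eq_measure_integral => A mA _; exact: WuW.
Qed.

(** The moment of order [a] of [|W| / b]. Since [b * gm a] is the exponential of [log_moment a],
    inequalities on the moment function become the conditions on [b m] and [b r] met above. *)
Let gm a : R := b%:R `^ (- a) * moment P0 f a.

Let weight_moment v a : v != [::] -> 0 < a ->
  (\int[P]_w (g (Wu v w) `^ a)%:E = (gm a)%:E)%E.
Proof.
move=> v0 a0; rewrite (@weight_integral v (fun y => g y `^ a))//; last 2 first.
- by apply: (measurableT_comp (measurable_powR a)).
- by move=> y; exact: powR_ge0.
have E w : g (W w) `^ a = b%:R `^ (- a) * f w `^ a.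
  by rewrite /g powRM ?invr_ge0 ?(ltW b_gt0)// -powR_inv1 ?(ltW b_gt0)// -powRrM mulN1r mulrC.
under eq_integral do rewrite E EFinM.
have mfa : measurable_fun setT (fun w => (f w `^ a)%:E).
  by apply/measurable_EFinP; apply: (measurableT_comp (measurable_powR a)).
rewrite ge0_integralZl ?lee_fin ?powR_ge0//; last by move=> w _; rewrite lee_fin powR_ge0.
rewrite /gm EFinM; congr (_ * _)%E; rewrite /moment /Rintegral fineK//.
exact: (integrable_fin_num measurableT (integrable_moment mf f_moment a0)).
Qed.

Let bgmE a : 0 < a -> b%:R * gm a = expR (log_moment P0 f L a).
Proof.
move=> a0; have M0 : 0 < moment P0 f a by apply: moment_gt0.
rewrite /gm /log_moment expRD lnK ?posrE// mulrA; congr (_ * _).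
rewrite -[X in X * _](powRr1 (ltW b_gt0)) -powRD.
  by rewrite /powR gt_eqF.
by apply/implyP => _; rewrite gt_eqF.
Qed.

Let gm_gt0 a : 0 < a -> 0 < gm a.
Proof. by move=> a0; rewrite mulr_gt0 ?powR_gt0//; exact: moment_gt0. Qed.

Lemma weight_mean v : v != [::] -> (\int[P]_w (g (Wu v w))%:E = (b%:R^-1)%:E)%E.
Proof.
move=> v0; have := weight_moment v0 ltr01.
rewrite /gm (moment1 f0 f1) mulr1 powR_inv1 ?(ltW b_gt0)// => <-.
by apply: eq_integral => w _; rewrite powRr1.
Qed.

Let dev := \int[P0]_w `|g (W w) - b%:R^-1|.

(** A vanishing deviation would force [W = 1] almost surely, against [nonconstant]. *)
Let dev_gt0 : 0 < dev.
Proof.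
have i1 (c : R) : P0.-integrable setT (EFin \o cst c).
  exact: finite_measure_integrable_cst.
have if_ : P0.-integrable setT (EFin \o f).
  rewrite (_ : EFin \o f = EFin \o (fun w => f w `^ 1)); first exact: integrable_moment.
  by apply/funext => w /=; rewrite powRr1.
have ig : P0.-integrable setT (EFin \o (fun w => g (W w) - b%:R^-1)).
  exact: (integrableB measurableT (integrableZr measurableT b%:R^-1 if_) (i1 b%:R^-1)).
have ing : P0.-integrable setT (EFin \o (fun w => `|g (W w) - b%:R^-1|)).
  exact: (integrable_norm ig).
have dev0 : 0 <= dev by apply: Rintegral_ge0.
rewrite lt_neqAle dev0 andbT; apply/negP => /eqP dev_eq0; apply: W_nonconstant.
exists 1; have : (\int[P0]_w `|(g (W w) - b%:R^-1)%:E|)%E = 0%E.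
  rewrite -[LHS]fineK; first by congr EFin.
  exact: (integrable_fin_num measurableT ing).
move=> /(ae_eq_integral_abs _ measurableT (measurable_int _ ig)) h.
apply: filterS2 W0 h => w W0w /(_ I) [] /eqP.
rewrite subr_eq0 /g ger0_norm// => /eqP h.
by apply: (mulIf (invr_neq0 bN0)); rewrite mul1r.
Qed.

Lemma weight_deviation v : v != [::] -> \int[P]_w `|g (Wu v w) - b%:R^-1| = dev.
Proof.
move=> v0; rewrite /Rintegral (@weight_integral v (fun y => `|g y - b%:R^-1|))//.
by apply: measurableT_comp => //; exact: measurable_funB.
Qed.

(** [q] is the square root of the growth rate [rho] of the sum of squared weights. The logarithm of
    [rho] is the height at abscissa 2 of the chord of the log-moment function through [a'] and [a],
    which [log_moment_chord] and [fourier_dim_log_moment] compare with the dimension. *)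
Lemma sine_sum_spread e : 0 < e -> exists c ka q : R,
  [/\ 0 < c <= 1, 0 < ka, 0 < q,
      forall N n k v y, (size v + n)%N = N ->
        c <= fine (P [set w | ka * q ^+ n <= `|sine_sum Wu g N (n + k.+1) v w - y|]) &
      - (fourier_dim b W * ln b%:R) - e <= 2 * ln q].
Proof.
move=> e0; have [_ _ indW] := W_Wu.
(* The exponent [p0] controls the moments of the rooted variables; the exponent [p] obtained below
   serves the tree sums of [a]-th powers. *)
have [p0 /andP[p01 p02] neg] := log_moment_lt0 mf f0 f_moment f1 fln.
have p00 : 0 < p0 := lt_trans ltr01 p01.
have bgm1 : b%:R * gm p0 < 1 by rewrite bgmE// expR_lt1.
have devP v : v != [::] -> dev <= \int[P]_w `|g (Wu v w) - b%:R^-1|.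
  by move=> v0; rewrite weight_deviation.
have [cs [s0 [cs0 s00 charP]]] := @charfun_sine_sum R b _ T P Wu indW b_gt1 g mg g0
  weight_mean p0 (gm p0) dev p01 p02 (ltW (gm_gt0 p00)) bgm1
  (fun v v0 => weight_moment v0 p00) dev_gt0 devP.
have [a0 [a [a' [p [/andP[a01 a02] [a'2 a'a a1 a2] /andP[p1 p2] psi_p psi_chord]]]]] :=
  log_moment_chord mf f0 f_moment f1 fln L0 e0.
have a_gt0 : 0 < a := lt_le_trans ltr01 a1.
have a'_gt0 : 0 < a' by apply: (lt_le_trans _ a'2); rewrite divr_gt0.
have pa_gt0 : 0 < p * a by rewrite mulr_gt0// (lt_trans ltr01 p1).
have bgm_lt : b%:R * gm (p * a) < (b%:R * gm a) `^ p.
  by rewrite !bgmE// -expRM ltr_expR [X in _ < X]mulrC.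
have [c1 [K [c10 K0 tailP]]] := @square_tree_sum_lower_tail R b _ T P Wu indW g mg g0
  a' a p (gm a') (gm a) (gm (p * a)) (ltnW b_gt1) a'_gt0 a'a a2 p1 p2 (gm_gt0 a'_gt0)
  (gm_gt0 a_gt0) (ltW (gm_gt0 pa_gt0)) bgm_lt (fun v v0 => weight_moment v0 a'_gt0)
  (fun v v0 => weight_moment v0 a_gt0) (fun v v0 => weight_moment v0 pa_gt0).
set rho := b%:R * gm a * _ in tailP.
have bgm0 : 0 < b%:R * gm a := mulr_gt0 b_gt0 (gm_gt0 a_gt0).
have gmq0 : 0 < gm a / gm a' := divr_gt0 (gm_gt0 a_gt0) (gm_gt0 a'_gt0).
have rho0 : 0 < rho := mulr_gt0 bgm0 (powR_gt0 _ gmq0).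
have ln_rho : ln rho = log_moment P0 f L a +
    (2 - a) * (log_moment P0 f L a - log_moment P0 f L a') / (a - a').
  rewrite /rho lnM ?posrE ?powR_gt0// bgmE// expRK; congr (_ + _).
  have -> : gm a / gm a' = expR (log_moment P0 f L a - log_moment P0 f L a').
    by rewrite expRB -!bgmE// -[RHS]mulf_div divff// mul1r.
  by rewrite ln_powR expRK mulrAC.
pose ex := expR (- (cs * s0 ^+ 2 / 2)).
have ex1 : ex < 1 by rewrite expR_lt1 oppr_lt0 divr_gt0// mulr_gt0 ?exprn_gt0.
pose k1 := (1 - ex) / (2 * s0); pose k2 := (1 - ex) / 4.
have k10 : 0 < k1 by rewrite divr_gt0 ?subr_gt0// mulr_gt0.
have k20 : 0 < k2 by rewrite divr_gt0 ?subr_gt0.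
have sqrt_exp n : Num.sqrt rho ^+ n = Num.sqrt (rho ^+ n).
  elim: n => [|n IH]; first by rewrite !expr0 sqrtr1.
  by rewrite [LHS]exprS [in RHS]exprS IH (sqrtrM _ (ltW rho0)).
have spread N n k v y : (size v + n)%N = N -> k2 * c1 <= fine (P [set w |
    k1 * Num.sqrt K * Num.sqrt rho ^+ n <= `|sine_sum Wu g N (n + k.+1) v w - y|]).
  move=> vn; rewrite -mulrA sqrt_exp -sqrtrM ?(ltW K0)//.
  apply: (@sine_sum_anticoncentration R b _ T P Wu indW g mg g0 c1 k1 k2 (K * rho ^+ n) N
    k.+1 n (ltW k20)) => //; first by rewrite mulr_gt0 ?exprn_gt0.
  move=> x u r z un r0 rx.
  apply: (weighted_sine_sum_anticoncentration indW mg cs0 s00 _ z un r0 rx) => u' uN s hs.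
  exact: charP.
exists (k2 * c1), (k1 * Num.sqrt K), (Num.sqrt rho); split => //.
- rewrite mulr_gt0//=; apply: (le_trans (spread 0 0 0 [::] 0 erefl)).
  set A := [set w | _]; have mA : measurable A.
    rewrite -[A]setTI; apply: measurable_fun_ler => //.
    apply: measurableT_comp => //; apply: measurable_funB => //.
    exact: measurable_sine_sumT.
  by rewrite -lee_fin fineK ?fin_num_measure// probability_le1.
- by rewrite mulr_gt0 ?sqrtr_gt0.
- by rewrite sqrtr_gt0.
- have -> : 2 * ln (Num.sqrt rho) = ln rho.
    by rewrite -[in RHS](sqr_sqrtr (ltW rho0)) lnXn ?sqrtr_gt0// mulr_natl.
  rewrite ln_rho; apply: le_trans psi_chord.
  have := @fourier_dim_log_moment R b _ T0 P0 W b_gt1 W0 EW W_moment a0.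
  rewrite a01 a02 => /(_ isT) D_ge.
  by rewrite lerD2r -subr_ge0 opprK addrC.
Qed.

End cascade_weights.

(** * From truncated sine sums to the Fourier transform *)

Lemma divergent_subsequence (R : realType) (v : nat -> R) :
  (forall l M : nat, exists2 n, (M <= n)%N & l%:R <= v n) ->
  exists n_ : nat -> nat, [/\ forall k, (0 < n_ k)%N, {homo n_ : i j / (i < j)%N} &
    v (n_ k) @[k --> \oo] --> +oo].
Proof.
move=> H; have [h hP] : {h : nat * nat -> nat & forall p : nat * nat,
    (p.2 <= h p)%N /\ p.1%:R <= v (h p)}.
  by apply: (@choice _ _ (fun p n => (p.2 <= n)%N /\ p.1%:R <= v n)) => -[l M]; have [n] := H l M; exists n.
(* Each index is taken beyond the previous one with a value at least [k]; the lower limit 1 at the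
   start makes the indices positive. *)
pose n_ := fix F k := if k is k'.+1 then h (k, (F k').+1) else h (0, 1)%N.
have nS k : (n_ k < n_ k.+1)%N by have [] := hP (k.+1, (n_ k).+1).
have nv k : k%:R <= v (n_ k) by case: k => [|k] /=; [have [] := hP (0, 1)%N|have [] := hP (k.+1, (n_ k).+1)].
exists n_; split.
- by case=> [|k]; [have [] := hP (0, 1)%N|exact: leq_ltn_trans (nS k)].
- exact: (homo_ltn ltn_trans nS).
- apply/cvgryPge => A; move: (nbhs_infty_ger A).
  by apply: (@filterS _ _ (@eventually_filter)) => k /le_trans; apply.
Qed.

Lemma exponential_domination (R : realType) (C c q s : R) : 0 <= C -> 0 < c -> 0 < q -> 0 < s + ln q ->
  forall m eta, 0 < eta -> exists n0, forall n, (n0 <= n)%N ->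
    C * expR (- (n%:R * s)) <= eta * (c * q ^+ (n - m)).
Proof.
move=> C0 c0 q0 sq m eta eta0; set x := s + ln q.
pose B := C * q ^+ m / (eta * c).
have [n1 _ n1P] := nbhs_infty_ger (B / x).
exists (maxn n1 m) => n; rewrite geq_max => /andP[n1n mn].
have Bn : B <= expR (n%:R * x).
  apply: le_trans (expR_ge1Dx _).
  have := n1P n n1n; rewrite /= ler_pdivrMr// => h.
  by rewrite (le_trans h)// lerDr.
have qn : q ^+ n = expR (n%:R * ln q).
  by rewrite expRM_natl lnK.
have qE : q ^+ (n - m) = q ^+ n / q ^+ m.
  by rewrite -[in RHS](subnK mn) exprD mulfK// expf_neq0// gt_eqF.
rewrite qE qn mulrA mulrA ler_pdivlMr ?exprn_gt0//.
have -> : expR (n%:R * ln q) = expR (n%:R * x) * expR (- (n%:R * s)).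
  by rewrite -expRD; congr expR; rewrite /x mulrDr addrAC subrr add0r.
rewrite mulrAC !mulrA ler_wpM2r ?expR_ge0//.
by rewrite [leRHS]mulrC -ler_pdivrMr ?mulr_gt0.
Qed.

(** The sine integral is the opposite of the imaginary part of the transform. *)
Lemma ler_sin_normc_fourier (R : realType)
    (mu : {finite_measure set (measurableTypeR R) -> \bar R}) (z : R) :
  `|\int[mu]_x sin (2 * pi * z * x)| <=
  ComplexField.Normc.normc (fourier_transform mu z).
Proof.
rewrite /fourier_transform /complex_integral /=.
have -> : \int[mu]_x sin (2 * pi * z * x) = - \int[mu]_x sin (- (2 * pi * z * x)).
  rewrite -[RHS]mulN1r -RintegralZl//.
    by apply: eq_Rintegral => x _; rewrite sinN mulN1r opprK.
  under eq_fun do rewrite -mulNr.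
  exact: integrable_sin_scale.
by rewrite normrN -sqrtr_sqr ler_sqrt ?lerDr ?addr_ge0 ?sqr_ge0.
Qed.

Section cascade_limit.
Context (R : realType) (b : nat).
Context d0 (T0 : measurableType d0) (P0 : probability T0 R).
Context d (T : measurableType d) (P : probability T R).
Context (W : {RV P0 >-> R}) (Wu : seq 'I_b -> {RV P >-> R}).
Hypotheses (b_gt1 : (1 < b)%N) (W0 : {ae P0, forall w, 0 <= W w}).
Hypothesis W_nonconstant : nonconstant W.
Hypothesis EW : ('E_P0[W] = 1)%E.
Hypothesis EWlnW : (mean_xlogx P0 W < (ln b%:R)%:E)%E.
Hypothesis W_moment : forall t : R, 0 < t -> ('E_P0[fun w => (W w `^ t)%R] < +oo)%E.
Hypothesis W_Wu : cascade_weights W Wu.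

Let b_gt0 : 0 < b%:R :> R. Proof. by rewrite ltr0n ltnW. Qed.
Let L0 : 0 < ln b%:R :> R. Proof. by rewrite ln_gt0// ltr1n. Qed.
Let g (y : R) := `|y| / b%:R.
Let mg : measurable_fun setT g. Proof. exact: measurable_funM. Qed.
Let g0 y : 0 <= g y. Proof. by rewrite divr_ge0 ?(ltW b_gt0). Qed.
Local Notation D := (fourier_dim b W).

Lemma weights_ge0_ae : {ae P, forall w v, 0 <= Wu v w}.
Proof.
have [W1 WuW _] := W_Wu.
have mI : measurable [set x : R | ~ 0 <= x].
  rewrite (_ : [set x : R | _] = `]-oo, 0[%classic)//.
  by apply/seteqP; split => x /=; rewrite in_itv/= ltNge => /negP.
have neg v : P.-negligible [set w | ~ 0 <= Wu v w].
  have [->|v0] := eqVneq v [::].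
    rewrite (_ : mkset _ = set0); first exact: negligible_set0.
    by apply/seteqP; split => // w /=; rewrite W1 ler01.
  have mN : measurable (Wu v @^-1` [set x : R | ~ 0 <= x]).
    by rewrite -[X in measurable X]setTI; exact: measurable_funP.
  exists (Wu v @^-1` [set x : R | ~ 0 <= x]); split => //.
  rewrite -[LHS]/(distribution P (Wu v) [set x : R | ~ 0 <= x]) (WuW v v0 _ mI).
  apply: (@measure_negligible _ _ _ P0 (W @^-1` [set x : R | ~ 0 <= x])) => //.
  by rewrite -[X in measurable X]setTI; exact: measurable_funP.
(* Words are countable: enumerated by [unpickle], the conditions form a countable family. *)
have H n : {ae P, forall w v, unpickle n = Some v -> 0 <= Wu v w}.
  case: (unpickle n) => [v|]; last by apply: aeW.
  by apply: filterS (neg v : {ae P, forall w, 0 <= Wu v w}) => w h _ [<-].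
apply: filterS (ae_foralln H) => w h v.
by apply: (h (pickle v)); rewrite pickleK.
Qed.

Lemma sine_sum_avoiding_negligible (eps : R) (l M : nat) : 0 < eps ->
  P.-negligible ([set w | forall N, exists K, forall K' n k, (M <= n < M + N)%N ->
     (K <= k < K + K')%N -> ~ l%:R * expR (- (n%:R * ((D + eps) * ln b%:R / 2))) <=
       `|sine_sum Wu g n (n + k.+1) [::] w|] `&` surviving Wu g).
Proof.
move=> eps0; have [_ _ indW] := W_Wu.
(* Half of the margin [eps] pays for the loss in the rate [q]; the other half makes the threshold
   exponentially small against [q^n]. *)
have e0 : 0 < eps * ln b%:R / 2 by rewrite divr_gt0// mulr_gt0.
have [c [ka [q [/andP[c0 c1] ka0 q0 spread rate]]]] :=
  sine_sum_spread b_gt1 W0 W_nonconstant EW EWlnW W_moment W_Wu e0.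
apply: (@avoiding_surviving_negligible R b _ T P Wu indW b_gt1 g mg g0 c ka q
  (fun n => l%:R * expR (- (n%:R * ((D + eps) * ln b%:R / 2)))) c0 c1 ka0 q0 spread).
apply: exponential_domination => //.
have eL0 : 0 < eps * ln b%:R by rewrite mulr_gt0.
move: rate eL0; rewrite [(D + eps) * _]mulrDl; move: (D * _) (eps * _) (ln q) => x y z; lra.
Qed.

(** The margins [1 / (j + 1)] stand for arbitrary [eps], so that one null event serves for all of
    them. *)
Lemma sine_sum_unbounded_ae : {ae P, forall w, surviving Wu g w -> forall j l M : nat,
  ~ forall N, exists K, forall K' n k, (M <= n < M + N)%N -> (K <= k < K + K')%N ->
    ~ l%:R * expR (- (n%:R * ((D + j.+1%:R^-1) * ln b%:R / 2))) <=
       `|sine_sum Wu g n (n + k.+1) [::] w|}.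
Proof.
suff : {ae P, forall w, forall j l M : nat, surviving Wu g w ->
  ~ forall N, exists K, forall K' n k, (M <= n < M + N)%N -> (K <= k < K + K')%N ->
    ~ l%:R * expR (- (n%:R * ((D + j.+1%:R^-1) * ln b%:R / 2))) <=
       `|sine_sum Wu g n (n + k.+1) [::] w|}.
  by apply: filterS => w h Sw j l M; exact: h.
apply: ae_foralln => j; apply: ae_foralln => l; apply: ae_foralln => M.
have j0 : 0 < j.+1%:R^-1 :> R by rewrite invr_gt0.
apply: negligibleS (@sine_sum_avoiding_negligible _ l M j0) => w /= h.
by apply: contrapT => h'; apply: h => Sw av; apply: h'.
Qed.

Section realisation.
Context (w : T) (mu : {finite_measure set (measurableTypeR R) -> \bar R}).
Hypothesis w0 : forall v, 0 <= Wu v w.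
Hypothesis w_mu : weakly_converges (cascade_measure (Wu ^~ w)) mu.
Hypothesis mu_neq0 : exists2 A, measurable A & mu A != 0%E.

Let w1 : Wu [::] w = 1. Proof. by have [W1 _ _] := W_Wu. Qed.

Let gE v : g (Wu v w) = Wu v w / b%:R.
Proof. by rewrite /g ger0_norm. Qed.

(** A level of zero mass forces zero mass at all deeper levels, and the total mass of the limit is
    the limit of these masses. *)
Lemma limit_surviving : surviving Wu g w.
Proof.
move=> m _ /=; rewrite lt_neqAle tree_sum_ge0// andbT; apply/negP => /eqP Zm.
have [A mA /negP] := mu_neq0; apply; apply/eqP.
have : fine (mu setT) = 0.
  apply: (cvg_unique (@Rhausdorff R) (cascade_mass_cvg b_gt1 w0 w1 w_mu)).
  apply: cvg_near_cst; near=> N.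
  have mN : (m <= N)%N by near: N; exact: nbhs_infty_ge.
  rewrite -(subnKC mN) tree_sumD tree_sum_eq0// => [v|].
    by rewrite divr_ge0 ?(ltW b_gt0).
  by rewrite [RHS]Zm; apply: eq_tree_suml => v; rewrite gE.
move=> mu0; apply/eqP; rewrite eq_le measure_ge0 andbT.
rewrite (_ : 0%E = mu setT); first by rewrite le_measure ?inE.
by rewrite -[RHS]fineK ?fin_num_measure// mu0.
Unshelve. all: by end_near. Qed.

Hypothesis w_unbounded : forall j l M : nat,
  ~ forall N, exists K, forall K' n k, (M <= n < M + N)%N -> (K <= k < K + K')%N ->
    ~ l%:R * expR (- (n%:R * ((D + j.+1%:R^-1) * ln b%:R / 2))) <=
       `|sine_sum Wu g n (n + k.+1) [::] w|.

(** Were all sine integrals from [M] on below the threshold, weak convergence would put the deep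
    enough truncated sums below it too, which is the avoidance that [w_unbounded] excludes. As only
    [N] frequencies are treated at a time, one depth suits them all. *)
Lemma fourier_unbounded j l M : exists2 n, (M <= n)%N &
  l%:R * expR (- (n%:R * ((D + j.+1%:R^-1) * ln b%:R / 2))) <=
    `|\int[mu]_x sin (2 * pi * b%:R ^+ n * x)|.
Proof.
set th := fun n : nat => l%:R * expR (- (n%:R * ((D + j.+1%:R^-1) * ln b%:R / 2))).
apply: contrapT => h; apply: (@w_unbounded j l M) => N.
have small n : (M <= n)%N -> `|\int[mu]_x sin (2 * pi * b%:R ^+ n * x)| < th n.
  by move=> Mn; rewrite ltNge; apply/negP => le; apply: h; exists n.
have : \forall k \near \oo, forall i : 'I_N, `|sine_sum Wu g (M + i) (M + i + k.+1) [::] w| < th (M + i)%N.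
  apply: filter_forall => i.
  have := cvg_norm (@cascade_sine_cvg R b b_gt1 _ w0 w1 mu w_mu (M + i)).
  move=> C; have [K0 _ KP] := cvgr_lt _ (C _) _ (small _ (leq_addr _ _)).
  exists K0 => // k kK; have := KP (M + i + k.+1)%N => /=.
  rewrite /sine_sum (eq_tree_suml _ _ _ gE); apply.
  by rewrite (leq_trans kK)// addnS -addSn leq_addl.
move=> [K _ KP]; exists K => K' n k /andP[Mn nN] /andP[Kk _].
have nMN : (n - M < N)%N by rewrite ltn_subLR.
have := KP k Kk (Ordinal nMN); rewrite /= subnKC// => lt.
by apply/negP; rewrite -ltNge.
Qed.

Lemma fourier_divergent_subsequence eps : 0 < eps ->
  exists n_ : nat -> nat,
      [/\ forall k, (0 < n_ k)%N,
          {homo n_ : i j / (i < j)%N} &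
          b%:R `^ ((n_ k)%:R * (D + eps) / 2) *
            ComplexField.Normc.normc (fourier_transform mu (b%:R ^+ n_ k))
            @[k --> \oo] --> +oo].
Proof.
move=> eps0; apply: (@divergent_subsequence R (fun n => b%:R `^ (n%:R * (D + eps) / 2) *
  ComplexField.Normc.normc (fourier_transform mu (b%:R ^+ n)))) => l M.
have [j _ jP] := nbhs_infty_ger eps^-1.
have j_eps : j.+1%:R^-1 <= eps.
  by rewrite -[eps]invrK lef_pV2 ?posrE ?invr_gt0//; exact: jP (leqnSn _).
have [n Mn h] := fourier_unbounded j l M; exists n => //.
have := le_trans h (ler_sin_normc_fourier mu _); rewrite -ler_pdivlMr ?expR_gt0//.
rewrite -expRN opprK => /le_trans; apply; rewrite mulrC ler_wpM2r//.
  by rewrite (le_trans _ (ler_sin_normc_fourier mu _)).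
rewrite /powR gt_eqF// ler_expR -[n%:R * _ / 2]mulrA -[n%:R * _ * _]mulrA ler_wpM2l//.
by rewrite mulrAC ler_wpM2r ?(ltW L0)// ler_wpM2r ?invr_ge0// lerD2l.
Qed.

End realisation.
End cascade_limit.

Theorem proposition1p11 (R : realType) (b : nat)
    (d0 d : measure_display)
    (T0 : measurableType d0) (P0 : probability T0 R)
    (T : measurableType d) (P : probability T R)
    (W : {RV P0 >-> R})
    (Wu : seq 'I_b -> {RV P >-> R})
    (mu : T -> {finite_measure set (measurableTypeR R) -> \bar R}) :
  (2 <= b)%N ->
  {ae P0, forall w, 0 <= W w} ->
  nonconstant W ->
  ('E_P0[W] = 1)%E ->
  (mean_xlogx P0 W < (ln b%:R)%:E)%E ->
  (forall t : R, 0 < t -> ('E_P0[fun w => (W w `^ t)%R] < +oo)%E) ->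
  (((ln b%:R)%:E < mean_xlogx P0 (square_tilt W))%E ->
    log_non_lattice W) ->
  cascade_weights W Wu ->
  is_cascade_limit Wu mu ->
  {ae P, forall w, (exists2 A, measurable A & mu w A != 0%E) ->
    forall eps : R, 0 < eps ->
    exists n_ : nat -> nat,
      [/\ forall k, (0 < n_ k)%N,
          {homo n_ : i j / (i < j)%N} &
          b%:R `^ ((n_ k)%:R * (fourier_dim b W + eps) / 2) *
            ComplexField.Normc.normc (fourier_transform (mu w) (b%:R ^+ n_ k))
            @[k --> \oo] --> +oo]}.
Proof.
move=> b_gt1 W0 Wnc EW EWlnW W_moment _ W_Wu [_ weak].
have unbounded := sine_sum_unbounded_ae b_gt1 W0 Wnc EW EWlnW W_moment W_Wu.
have weights0 := weights_ge0_ae W0 W_Wu.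
apply: filterS3 weak weights0 unbounded => w w_mu w0 unb mu_neq0 eps eps0.
have Sw := limit_surviving b_gt1 W_Wu w0 w_mu mu_neq0.
exact: (fourier_divergent_subsequence b_gt1 W_Wu w0 w_mu (unb Sw) eps0).
Qed.
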